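(* Let $\Delta=1_{B(0,1)}\ast 1_{B(0,1)}$ on $\mathbb{R}^d$, let $\mathcal{L}$ denote Lebesgue measure, and let $M$ be a weakly stationary random measure on $\mathbb{R}^d$ with covariance measure $C=\Delta\mathcal{L}$. Then $M$ is linearly maximally rigid on $B(0,\rho)$ if $\rho<\frac{2}{\pi}$. On the other hand, for $\rho>2$, $M$ is not $f$-rigid for $f\in\mathcal{C}_c^b(\mathbb{R}^d)$ with $\mathrm{supp}(f)=B(0,\rho)$.
   Context: $B(0,r)$ is the ball of $\mathbb{R}^d$ centred at $0$ with radius $r$. For $B\subset\mathbb{R}^d$, $\mathcal{C}_c^b(B)$ is the class of bounded measurable functions on $\mathbb{R}^d$ with bounded support, supported in $B$. A weakly stationary random measure $M$ on $\mathbb{R}^d$ is a collection of complex square integrable random variables $M(f)$, $f\in\mathcal{C}_c^b(\mathbb{R}^d)$, on a probability space $(\Omega,\mathbf{P})$ such that (i) $M$ a.s. induces a complex-valued measure on each compact set, and (ii) $\mathrm{Var}(M(\tau_x f))=\mathrm{Var}(M(f))$ for every translation $\tau_x$, $x\in\mathbb{R}^d$. Its (reduced) covariance measure $C$ is characterised by $\mathrm{Cov}(M(f),M(g))=\int f(y)\overline{g(x+y)}\,C(dx)\,dy$ for $f,g\in\mathcal{C}_c^b(\mathbb{R}^d)$. $M$ is linearly maximally rigid on $B$ if for every $f\in\mathcal{C}_c^b(B)$ there are $h_n\in\mathcal{C}_c^b(B^c)$, $n\ge1$, such that $M(h_n)\to M(f)$ in $L^2(\mathbf{P})$. For $f\in\mathcal{C}_c^b(\mathbb{R}^d)$,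 $M$ is (linearly) $f$-rigid if there are $h_n\in\mathcal{C}_c^b(\mathrm{supp}(f)^c)$, $n\ge1$, such that $\mathbf{E}|M(f)-M(h_n)|^2\to0$.
   Formalization: Maximal rigidity is proved assuming E M(f) is also translation invariant (it fails for M plus a fixed point mass at 0); non-f-rigidity is proved for f whose convolution with 1_{B(0,1)} is not identically 0 on B(0,ρ−1) (it fails for d=1, f=sin(πx) on [−ρ,ρ], M centred). *)

(* Defs.v *)
(* Uses MathComp-Analysis. *)
From HB Require Import structures.
From mathcomp Require Import all_boot all_order all_algebra.
From mathcomp Require Import all_classical all_reals all_analysis.
From mathcomp.real_closed Require Import complex.
Set Implicit Arguments.
Unset Strict Implicit.
Unset Printing Implicit Defensive.
Import Order.TTheory GRing.Theory Num.Theory.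
Import numFieldNormedType.Exports.
Local Open Scope classical_set_scope.
Local Open Scope ring_scope.
Local Open Scope complex_scope.

Definition measure_rV_display : measure_display.
Proof. exact default_measure_display. Qed.

Section measurable_rV.
Context {R : realType} (n : nat).

Definition rV_coord (i : 'I_n) (v : 'rV[R]_n) : measurableTypeR R := v ord0 i.

Let rV_set0 : g_sigma_preimage rV_coord set0.
Proof. exact: sigma_algebra0. Qed.

Let rV_setC A : g_sigma_preimage rV_coord A -> g_sigma_preimage rV_coord (~` A).
Proof. exact: sigma_algebraC. Qed.

Let rV_bigcup (F : (set 'rV[R]_n)^nat) :
  (forall i, g_sigma_preimage rV_coord (F i)) ->
  g_sigma_preimage rV_coord (\bigcup_i (F i)).
Proof. exact: sigma_algebra_bigcup. Qed.

(* The sigma-algebra generated by the coordinate projections, i.e. the Borel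
   sigma-algebra of R^n. *)
HB.instance Definition _ := @isMeasurable.Build measure_rV_display
  'rV[R]_n (g_sigma_preimage rV_coord) rV_set0 rV_setC rV_bigcup.

Lemma measurable_rV_coord (i : 'I_n) : measurable_fun [set: 'rV[R]_n] (rV_coord i).
Proof.
move=> _ Y mY; rewrite setTI; apply: sub_sigma_algebra => /=.
rewrite -bigcup_seq/=; exists i => /=; first by rewrite mem_index_enum.
by exists Y => //; rewrite setTI.
Qed.

Lemma measurable_rV_coordP d (T : measurableType d) (f : T -> 'rV[R]_n) :
  (forall i, measurable_fun [set: T] (rV_coord i \o f)) ->
  measurable_fun [set: T] f.
Proof.
move=> mf.
suff h : g_sigma_preimage rV_coord `<=` [set A | measurable (f @^-1` A)].
  by move=> _ A mA; rewrite setTI; exact: (h _ mA).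
apply: smallest_sub.
- split => [|A|F mF] /=.
  + by rewrite preimage_set0.
  + by rewrite setTD preimage_setC => /measurableC.
  + by rewrite preimage_bigcup; exact: bigcupT_measurable.
- rewrite -bigcup_seq => A [i _] [B mB <-] /=.
  by rewrite setTI -comp_preimage -[X in measurable X]setTI; exact: mf.
Qed.

End measurable_rV.

Section lebesgue_rV.
Context {R : realType}.

Definition rV_cons (n : nat) (p : (measurableTypeR R * 'rV[R]_n)%type) : 'rV[R]_n.+1 :=
  \row_i (if unlift ord0 i is Some j then p.2 ord0 j else p.1).

Definition rV_uncons (n : nat) (v : 'rV[R]_n.+1) : measurableTypeR R * 'rV[R]_n :=
  (v ord0 ord0, \row_j v ord0 (lift ord0 j)).

Lemma rV_consK n : cancel (@rV_cons n) (@rV_uncons n).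
Proof.
move=> [x v]; rewrite /rV_uncons /rV_cons mxE unlift_none; congr pair.
by apply/rowP => j; rewrite !mxE liftK.
Qed.

Lemma measurable_rV_cons n : measurable_fun setT (@rV_cons n).
Proof.
apply: measurable_rV_coordP => i.
rewrite (_ : _ \o _ = fun p : measurableTypeR R * 'rV[R]_n =>
    if unlift ord0 i is Some j then rV_coord j p.2 else p.1); last first.
  by apply/funext => p; rewrite /= /rV_coord mxE.
case: (unlift ord0 i) => [j|]; last exact: measurable_fst.
exact: (measurableT_comp (measurable_rV_coord j) measurable_snd).
Qed.

Lemma measurable_rV_uncons n : measurable_fun setT (@rV_uncons n).
Proof.
apply: measurable_fun_pair; first exact: (measurable_rV_coord ord0).
apply: measurable_rV_coordP => i.
rewrite (_ : _ \o _ = rV_coord (lift ord0 i)); first exact: measurable_rV_coord.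
by apply/funext => v; rewrite /= /rV_coord mxE.
Qed.

Section step.
Context (n : nat) (mu : {sigma_finite_measure set 'rV[R]_n -> \bar R}).

Definition lebesgue_rV_step : set 'rV[R]_n.+1 -> \bar R :=
  pushforward (@lebesgue_measure R \x mu)%E (@rV_cons n).

Let m_cons A : measurable A -> measurable (@rV_cons n @^-1` A).
Proof.
by move=> mA; rewrite -[X in measurable X]setTI; exact: measurable_rV_cons.
Qed.

Let step0 : lebesgue_rV_step set0 = 0%E.
Proof. by rewrite /lebesgue_rV_step /pushforward preimage_set0 measure0. Qed.

Let step_ge0 A : (0 <= lebesgue_rV_step A)%E.
Proof. exact: (@measure_ge0 _ _ _ (@lebesgue_measure R \x mu)%E). Qed.

Let step_sigma_additive : semi_sigma_additive lebesgue_rV_step.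
Proof.
move=> F mF tF mUF; rewrite /lebesgue_rV_step /pushforward preimage_bigcup.
apply: measure_semi_sigma_additive.
- by move=> k; exact: m_cons.
- apply/trivIsetP => /= i j _ _ ij; rewrite -preimage_setI.
  by move/trivIsetP : tF => /(_ _ _ _ _ ij) ->//; rewrite preimage_set0.
- by rewrite -preimage_bigcup; exact: m_cons.
Qed.

HB.instance Definition _ := isMeasure.Build _ _ _ lebesgue_rV_step
  step0 step_ge0 step_sigma_additive.

Let step_sigma_finite : sigma_finite setT lebesgue_rV_step.
Proof.
have /sigma_finiteP[F [TF ndF Foo]] := sigma_finiteT (@lebesgue_measure R).
have /sigma_finiteP[G [TG ndG Goo]] := sigma_finiteT mu.
exists (fun k => @rV_uncons n @^-1` (F k `*` G k)).
  rewrite -preimage_bigcup -(preimage_setT (@rV_uncons n)); congr (_ @^-1` _).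
  rewrite -setXTT TF TG predeqE => -[x y]; split.
    move=> [/= [i _ Fix] [j _ Gjy]]; exists (maxn i j) => //; split.
    - by move: x Fix; exact/subsetPset/ndF/leq_maxl.
    - by move: y Gjy; exact/subsetPset/ndG/leq_maxr.
  by move=> [i _ []/= ? ?]; split; exists i.
move=> k; have [mF Fk] := Foo k; have [mG Gk] := Goo k.
have mFG : measurable (F k `*` G k) by exact: measurableX.
split.
  by rewrite -[X in measurable X]setTI; exact: measurable_rV_uncons.
rewrite /lebesgue_rV_step /pushforward -comp_preimage.
rewrite (_ : _ \o _ = id); last by apply/funext => p /=; rewrite rV_consK.
rewrite preimage_id product_measure1E// lte_mul_pinfty// ge0_fin_numE//.
Qed.

HB.instance Definition _ := @Measure_isSigmaFinite.Build _ _ _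
  lebesgue_rV_step step_sigma_finite.

End step.

Fixpoint lebesgue_rV (n : nat) : {sigma_finite_measure set 'rV[R]_n -> \bar R} :=
  match n with
  | 0 => dirac (0 : 'rV[R]_0)
  | m.+1 => lebesgue_rV_step (lebesgue_rV m)
  end.

Lemma lebesgue_rV_box (n : nat) (F : 'I_n -> set (measurableTypeR R)) :
  (forall i, measurable (F i)) ->
  lebesgue_rV n [set v | forall i, F i (v ord0 i)] =
  (\prod_(i < n) lebesgue_measure (F i))%E.
Proof.
elim: n F => [|n IHn] F mF.
  by rewrite big_ord0 /= diracE mem_set// => -[].
have mbox : measurable [set v : 'rV[R]_n | forall i, F (lift ord0 i) (v ord0 i)].
  rewrite (_ : [set _ | _] = \big[setI/setT]_(i < n)
      (@rV_coord R n i @^-1` F (lift ord0 i))); last first.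
    rewrite -bigcap_seq; apply/seteqP; split => v /= H i; first by move=> _.
    by apply: H; rewrite /= mem_index_enum.
  apply: bigsetI_measurable => i _.
  by rewrite -[X in measurable X]setTI; exact: measurable_rV_coord.
rewrite big_ord_recl /= /lebesgue_rV_step /pushforward -IHn//.
rewrite -product_measure1E//; congr (_ _); apply/seteqP; split => -[x v] /=.
  move=> H; split => /=; first by have := H ord0; rewrite mxE unlift_none.
  by move=> i; have := H (lift ord0 i); rewrite mxE liftK.
move=> [Fx Fv] i; rewrite mxE; case: unliftP => [j ->|->//]; exact: Fv.
Qed.

End lebesgue_rV.

Section complex_integration.
Context d (T : measurableType d) (R : realType).

Definition cmeasurable (f : T -> R[i]) : Prop :=
  measurable_fun setT (fun x => complex.Re (f x)) /\
  measurable_fun setT (fun x => complex.Im (f x)).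

Definition cintegral (mu : {measure set T -> \bar R}) (D : set T)
    (f : T -> R[i]) : R[i] :=
  (\int[mu]_(x in D) complex.Re (f x)) +i* (\int[mu]_(x in D) complex.Im (f x)).

Definition charge_Rintegral (nu : {charge set T -> \bar R}) (g : T -> R) : R :=
  let P := sval (cid (Hahn_decomposition nu)) in
  let exN := svalP (cid (Hahn_decomposition nu)) in
  let nuPN := svalP (cid exN) in
  \int[jordan_pos nuPN]_x g x - \int[jordan_neg nuPN]_x g x.

(* The integral of f against the complex measure nu + i nu'. *)
Definition complex_measure_integral (nu nu' : {charge set T -> \bar R})
    (f : T -> R[i]) : R[i] :=
  (charge_Rintegral nu (fun x => complex.Re (f x)) -
   charge_Rintegral nu' (fun x => complex.Im (f x))) +i*
  (charge_Rintegral nu (fun x => complex.Im (f x)) +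
   charge_Rintegral nu' (fun x => complex.Re (f x))).

Definition sqnorm_integral (mu : {measure set T -> \bar R}) (X : T -> R[i]) :
    \bar R :=
  (\int[mu]_x ((ComplexField.Normc.normc (X x)) ^+ 2)%:E)%E.

Definition square_integrable (mu : {measure set T -> \bar R})
    (X : T -> R[i]) : Prop :=
  cmeasurable X /\ (sqnorm_integral mu X < +oo)%E.

Definition cexpectation (P : probability T R) (X : T -> R[i]) : R[i] :=
  cintegral P setT X.

Definition ccovariance (P : probability T R) (X Y : T -> R[i]) : R[i] :=
  cexpectation P (fun w =>
    (X w - cexpectation P X) * (Y w - cexpectation P Y)^*).

Definition cvariance (P : probability T R) (X : T -> R[i]) : R[i] :=
  ccovariance P X X.

End complex_integration.

Section test_functions.
Context {R : realType} {n : nat}.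
Implicit Types (f g : 'rV[R]_n -> R[i]) (B : set 'rV[R]_n).

Definition enorm (x : 'rV[R]_n) : R := Num.sqrt (\sum_i x ord0 i ^+ 2).

Definition eball (r : R) : set 'rV[R]_n := [set x | enorm x <= r].

(* Bounded measurable functions with bounded support vanishing outside B (B
   need not be closed, so supports are not closed up here). *)
Definition Ccb B : set ('rV[R]_n -> R[i]) :=
  [set f | [/\ cmeasurable f,
               exists K : R, forall x, ComplexField.Normc.normc (f x) <= K,
               exists r : R, [set x | f x != 0] `<=` eball r &
               [set x | f x != 0] `<=` B]].

Definition csupp f : set 'rV[R]_n := closure [set x | f x != 0].

Definition translate (x : 'rV[R]_n) f : 'rV[R]_n -> R[i] := fun y => f (y - x).

Definition conv (f g : 'rV[R]_n -> R) (x : 'rV[R]_n) : R :=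
  \int[lebesgue_rV n]_y (f y * g (x - y)).

Definition cconv f g (x : 'rV[R]_n) : R[i] :=
  cintegral (lebesgue_rV n) setT (fun y => f y * g (x - y)).

Definition Delta : 'rV[R]_n -> R := conv \1_(eball 1) \1_(eball 1).

End test_functions.

Section random_measure.
Context {R : realType} {n : nat} {d : measure_display} {Omega : measurableType d}.
Context (P : probability Omega R) (M : ('rV[R]_n -> R[i]) -> Omega -> R[i]).

(* Only the variances are required to be translation invariant: nothing is
   assumed on the mean f |-> E M(f). *)
Record weakly_stationary_random_measure : Prop := {
  random_measure_L2 : forall f, Ccb setT f -> square_integrable P (M f) ;
  random_measure_induces : {ae P, forall w, forall K, compact K ->
    exists nu nu' : {charge set 'rV[R]_n -> \bar R}, forall f, Ccb K f ->
      M f w = complex_measure_integral nu nu' f} ;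
  random_measure_stationary : forall f x, Ccb setT f ->
    cvariance P (M (translate x f)) = cvariance P (M f) }.

Definition stationary_mean : Prop := forall f x, Ccb setT f ->
  cexpectation P (M (translate x f)) = cexpectation P (M f).

(* C(dx) is the inner integral and dy the outer one. *)
Definition covariance_measure (C : {measure set 'rV[R]_n -> \bar R}) : Prop :=
  forall f g, Ccb setT f -> Ccb setT g ->
    ccovariance P (M f) (M g) =
    cintegral (lebesgue_rV n) setT (fun y =>
      cintegral C setT (fun x => f y * (g (x + y))^*)).

Definition L2_approximable (B : set 'rV[R]_n) (f : 'rV[R]_n -> R[i]) : Prop :=
  exists h : nat -> 'rV[R]_n -> R[i], (forall k, Ccb B (h k)) /\
    (sqnorm_integral P (fun w => M f w - M (h k) w) @[k --> \oo] --> 0%E).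

Definition linearly_maximally_rigid (B : set 'rV[R]_n) : Prop :=
  forall f, Ccb B f -> L2_approximable (~` B) f.

Definition linearly_rigid (f : 'rV[R]_n -> R[i]) : Prop :=
  L2_approximable (~` csupp f) f.

End random_measure.

(* Main.v *)
(* For a real test function [a] let [S a] be its convolution with the indicator
   of the unit ball, and [N a] the squared [L2] norm of [S a].  As the
   covariance is the autocorrelation of that indicator, the variance of [M f] is
   the sum of [N] over the real and imaginary parts of [f].

   If [h] vanishes on the ball of radius [rho > 2], then [S h] vanishes on the
   ball of radius [rho - 1 > 0], where [S f] is continuous and not zero; this
   bounds the variance of [M f - M h] from below.

   Let now [rho < 2 / pi].  The Fourier transform of the indicator of the unit
   ball is radial and, by a Sturm comparison in Bessel's equation, each interval
   of length [l > pi] far enough contains the modulus of a zero.  A plane wave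
   whose frequency is a zero is the limit on the ball of averages of plane waves
   over small truncated cones, on which the transform is small, so that these
   averages have small [N] by Plancherel's inequality: the wave restricted to
   the ball is approximated by functions living outside the ball.  Choosing [l]
   with [l rho < 2], any other plane wave of the same direction is, uniformly on
   the ball, the limit of its Lagrange interpolants at such frequencies.
   Trigonometric polynomials are dense in [L2] of the ball, which gives all test
   functions.  The mean is dealt with by translating the error far away. *)

Require Import Defs.
From HB Require Import structures.
From mathcomp Require Import all_boot all_order all_algebra.
From mathcomp Require Import all_classical all_reals all_analysis.
From mathcomp.real_closed Require Import complex.
From mathcomp Require Import measurable_realfun ring lra.
Import Order.TTheory GRing.Theory Num.Theory.
Import numFieldNormedType.Exports.
Local Open Scope classical_set_scope.
Local Open Scope ring_scope.

Set Implicit Arguments.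
Unset Strict Implicit.
Unset Printing Implicit Defensive.

(** * Bounded functions of finite support, Euclidean norm, Lebesgue measure *)

(** The threshold [2 / pi] comes from the remainder of Lagrange interpolation: with nodes [+- z m]
    of spacing about [l], the first [2 N] of them give on the ball an error of order
    [rho ^ (2 N) * (l ^ N * N!) ^ 2 / (2 N)!], and the ratio of consecutive terms tends to
    [(l * rho / 2) ^ 2]. The zeros provide every [l > pi].

    The transform vanishes at a frequency, while a superposition of waves needs a density on a set
    of positive volume. On the part of a cone inside a shell of relative thickness [e] around the
    zero, the transform is [O(e)], the density [O(1 / e)] and the volume [O(e)]: their product has
    squared [L2] norm [O(e)]. The opening of the cone, which controls the distance between the
    waves, is fixed before [e].

    Truncation to a ball adds a boundary term; since the squared norms over balls are bounded by
    Plancherel's inequality, some shell contributes little. This inequality is needed only up to a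
    constant and without inversion: weighting by a triangle function gives a nonnegative kernel
    whose mass is bounded independently of the truncation. *)

Section bounded_finite_support.
Context {R : realType} d (T : measurableType d).
Variable mu : {measure set T -> \bar R}.
Implicit Types f g : T -> R.

(** [Rintegral] is the [fine] of an extended integral and is linear on integrable functions only.
    This class ensures integrability and is stable under products, so that membership is the single
    side condition of the rules below. *)
Definition bfs f := [/\ measurable_fun setT f,
  exists K : R, forall x, `|f x| <= K &
  exists A, [/\ measurable A, (mu A < +oo)%E & forall x, ~ A x -> f x = 0]].

Lemma bfs_restrict f A : measurable A -> (forall x, ~ A x -> f x = 0) ->
  f \_ A = f.
Proof.
move=> mA f0; apply/funext => x; rewrite patchE.
by case: ifPn => // /negP; rewrite inE => /f0.
Qed.

Lemma bfs_integrable f : bfs f -> mu.-integrable setT (EFin \o f).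
Proof.
move=> [mf [K fK] [A [mA Aoo f0]]].
rewrite -(bfs_restrict mA f0).
have -> : EFin \o (f \_ A) = (EFin \o f) \_ A.
  by apply/funext => x; rewrite /= !patchE; case: ifP.
rewrite -integrable_mkcond//.
apply: measurable_bounded_integrable => //; first exact: measurable_funTS.
exists K; split; first by rewrite num_real.
by move=> x Kx y _ /=; rewrite (le_trans (fK y))// ltW.
Qed.

Lemma bfsD f g : bfs f -> bfs g -> bfs (fun x => f x + g x).
Proof.
move=> [mf [K fK] [A [mA Aoo f0]]] [mg [L gL] [B [mB Boo g0]]]; split.
- exact: measurable_funD.
- by exists (K + L) => x; rewrite (le_trans (ler_normD _ _))// lerD.
- exists (A `|` B); split; first exact: measurableU.
    by rewrite (le_lt_trans (measureU2 _ _ _))// lte_add_pinfty.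
  by move=> x /not_orP[Ax Bx]; rewrite f0// g0// addr0.
Qed.

Lemma bfsM f g : bfs f -> measurable_fun setT g ->
  (exists K : R, forall x, `|g x| <= K) -> bfs (fun x => f x * g x).
Proof.
move=> [mf [K fK] [A [mA Aoo f0]]] mg [L gL]; split.
- exact: measurable_funM.
- by exists (K * L) => x; rewrite normrM ler_pM.
- by exists A; split => // x /f0 ->; rewrite mul0r.
Qed.

Lemma bfsM2 f g : bfs f -> bfs g -> bfs (fun x => f x * g x).
Proof. by move=> bf [mg Kg _]; exact: bfsM. Qed.

Lemma bfsZ k f : bfs f -> bfs (fun x => k * f x).
Proof.
move=> bf; have -> : (fun x => k * f x) = (fun x => f x * cst k x).
  by apply/funext => x; rewrite mulrC.
by apply: bfsM => //; exists `|k|.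
Qed.

Lemma bfsN f : bfs f -> bfs (fun x => - f x).
Proof.
by move=> /(bfsZ (-1)); congr bfs; apply/funext => x; rewrite mulN1r.
Qed.

Lemma bfsB f g : bfs f -> bfs g -> bfs (fun x => f x - g x).
Proof. by move=> bf /bfsN; exact: bfsD. Qed.

Lemma bfs_indic A : measurable A -> (mu A < +oo)%E -> bfs \1_A.
Proof.
move=> mA Aoo; split; first exact: measurable_indic.
  by exists 1 => x; rewrite indicE; case: (_ \in _) => /=; rewrite ?normr1 ?normr0.
by exists A; split => // x Ax; rewrite indicE memNset.
Qed.

Lemma bfs_intD f g : bfs f -> bfs g ->
  \int[mu]_x (f x + g x) = \int[mu]_x f x + \int[mu]_x g x.
Proof. by move=> /bfs_integrable bf /bfs_integrable bg; rewrite RintegralD. Qed.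

Lemma bfs_intB f g : bfs f -> bfs g ->
  \int[mu]_x (f x - g x) = \int[mu]_x f x - \int[mu]_x g x.
Proof. by move=> /bfs_integrable bf /bfs_integrable bg; rewrite RintegralB. Qed.

Lemma bfs_intZ k f : bfs f -> \int[mu]_x (k * f x) = k * \int[mu]_x f x.
Proof. by move=> /bfs_integrable bf; rewrite RintegralZl. Qed.

Lemma bfs_int_le f g : bfs f -> bfs g -> (forall x, f x <= g x) ->
  \int[mu]_x f x <= \int[mu]_x g x.
Proof. by move=> /bfs_integrable bf /bfs_integrable bg fg; exact: le_Rintegral. Qed.

Lemma bfs_int_ge0 f : (forall x, 0 <= f x) -> 0 <= \int[mu]_x f x.
Proof. by move=> f0; exact: Rintegral_ge0. Qed.

Lemma bfs_int_norm f : bfs f -> `|\int[mu]_x f x| <= \int[mu]_x `|f x|.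
Proof. by move=> /bfs_integrable bf; exact: le_normr_Rintegral. Qed.

Lemma bfs_norm f : bfs f -> bfs (fun x => `|f x|).
Proof.
move=> [mf [K fK] [A [mA Aoo f0]]]; split.
- by apply: measurableT_comp.
- by exists K => x; rewrite normr_id.
- by exists A; split => // x /f0 ->; rewrite normr0.
Qed.

Lemma bfs_sqr f : bfs f -> bfs (fun x => f x ^+ 2).
Proof. by move=> bf; under eq_fun do rewrite expr2; exact: bfsM2. Qed.

Lemma int_indic A : measurable A -> \int[mu]_x \1_A x = fine (mu A).
Proof. by move=> mA; rewrite /Rintegral integral_indic// setIT. Qed.

Lemma bfs_int_bound f K A : bfs f -> measurable A -> (mu A < +oo)%E ->
  (forall x, `|f x| <= K * \1_A x) -> `|\int[mu]_x f x| <= K * fine (mu A).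
Proof.
move=> bf mA Aoo fK; rewrite (le_trans (bfs_int_norm bf))//.
rewrite -int_indic// -bfs_intZ; last exact: bfs_indic.
by apply: bfs_int_le => //; [exact: bfs_norm|apply: bfsZ; exact: bfs_indic].
Qed.

(* For [L > 0] this is the Cauchy-Schwarz inequality on [A], obtained from
   [0 <= \int_A (f - m)^2] with [m] the mean of [f] on [A]. *)
Lemma bfs_jensen f A : bfs f -> measurable A -> (mu A < +oo)%E ->
  (\int[mu]_x (f x * \1_A x)) ^+ 2 <=
    fine (mu A) * \int[mu]_x (f x ^+ 2 * \1_A x).
Proof.
move=> bf mA Aoo.
have bA := bfs_indic mA Aoo.
have bfA : bfs (fun x => f x * \1_A x) by exact: bfsM2.
have bf2A : bfs (fun x => f x ^+ 2 * \1_A x) by apply: bfsM2 => //; exact: bfs_sqr.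
set I := \int[mu]_x (f x * \1_A x); set J := \int[mu]_x (f x ^+ 2 * _).
set v := fine (mu A).
have key t : 0 <= J - 2 * t * I + t ^+ 2 * v.
  rewrite /v -int_indic// /I -!bfs_intZ// /J -bfs_intB//; last exact: bfsZ.
  rewrite -bfs_intD//; [|by apply: bfsB => //; exact: bfsZ|exact: bfsZ].
  apply: bfs_int_ge0 => x.
  have -> : f x ^+ 2 * \1_A x - 2 * t * (f x * \1_A x) + t ^+ 2 * \1_A x =
    (f x - t) ^+ 2 * \1_A x by ring.
  by rewrite mulr_ge0// ?sqr_ge0// indicE.
have [v0|v0] := eqVneq v 0.
  have I0 : I = 0.
    apply/eqP/negPn/negP => I0.
    (* With [v = 0] the inequality [key] is affine in [t], and this [t] would give its right-hand
       side the value [-1]. *)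
    have := key ((J + 1) / (2 * I)).
    have -> : 2 * ((J + 1) / (2 * I)) * I = J + 1 by field.
    by rewrite v0; lra.
  by rewrite I0 v0 mul0r expr0n.
have vp : 0 < v by rewrite lt_neqAle eq_sym v0 fine_ge0.
have := key (I / v).
have -> : J - 2 * (I / v) * I + (I / v) ^+ 2 * v = J - I ^+ 2 / v by field.
by rewrite subr_ge0 ler_pdivrMr// mulrC.
Qed.

End bounded_finite_support.

Section bfs_fubini.
Context {R : realType} d1 d2 (T1 : measurableType d1) (T2 : measurableType d2).
Variables (m1 : {sigma_finite_measure set T1 -> \bar R})
  (m2 : {sigma_finite_measure set T2 -> \bar R}) (F : T1 * T2 -> R).
Variables (A : set T1) (B : set T2) (K : R).
Hypothesis mF : measurable_fun setT F.
Hypothesis FK : forall z, `|F z| <= K.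
Hypothesis mA : measurable A.
Hypothesis mB : measurable B.
Hypothesis Aoo : (m1 A < +oo)%E.
Hypothesis Boo : (m2 B < +oo)%E.
Hypothesis FA : forall x y, ~ A x -> F (x, y) = 0.
Hypothesis FB : forall x y, ~ B y -> F (x, y) = 0.

Lemma bfs_prod : bfs (m1 \x m2)%E F.
Proof.
split => //; first by exists K.
exists (A `*` B); split; first exact: measurableX.
  by rewrite /= product_measure1E// lte_mul_pinfty// ge0_fin_numE.
by move=> [x y] /not_andP/= [/FA|/FB]; apply.
Qed.

Lemma bfs_pairr x : bfs m2 (fun y => F (x, y)).
Proof.
split; first by apply: measurableT_comp => //; exact: measurable_pair1.
  by exists K => y; exact: FK.
by exists B; split => // y; exact: FB.
Qed.

Lemma bfs_pairl y : bfs m1 (fun x => F (x, y)).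
Proof.
split; first by apply: measurableT_comp => //; exact: measurable_pair2.
  by exists K => x; exact: FK.
by exists A; split => // x; exact: FA.
Qed.

Lemma bfs_intr : bfs m1 (fun x => \int[m2]_y F (x, y)).
Proof.
have K0 : 0 <= K by rewrite (le_trans _ (FK point)).
split.
- have := measurable_fubini_F (bfs_integrable bfs_prod).
  exact/measurableT_comp.
- exists (K * fine (m2 B)) => x; apply: bfs_int_bound => //.
    exact: bfs_pairr.
  move=> y; rewrite indicE; have [/set_mem By|/negP Bf] := boolP (y \in B).
    by rewrite mulr1.
  by rewrite FB ?normr0 ?mulr0// => By; apply: Bf; exact: mem_set.
- exists A; split => // x nA; under eq_Rintegral do rewrite FA//.
  by rewrite Rintegral_cst// mul0r.
Qed.

Lemma bfs_intl : bfs m2 (fun y => \int[m1]_x F (x, y)).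
Proof.
split.
- have := measurable_fubini_G (bfs_integrable bfs_prod).
  exact/measurableT_comp.
- exists (K * fine (m1 A)) => y; apply: bfs_int_bound => //.
    exact: bfs_pairl.
  move=> x; rewrite indicE; have [/set_mem By|/negP Bf] := boolP (x \in A).
    by rewrite mulr1.
  by rewrite FA ?normr0 ?mulr0// => By; apply: Bf; exact: mem_set.
- exists B; split => // x nA; under eq_Rintegral do rewrite FB//.
  by rewrite Rintegral_cst// mul0r.
Qed.

Lemma EFin_bfs_int d (T : measurableType d) (mu : {measure set T -> \bar R}) f :
  bfs mu f -> (\int[mu]_x f x)%:E = (\int[mu]_x (f x)%:E)%E.
Proof.
move=> bf; rewrite /Rintegral fineK//.
exact: integrable_fin_num (bfs_integrable bf).
Qed.

Lemma bfs_int_prod :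
  \int[(m1 \x m2)%E]_z F z = \int[m1]_x \int[m2]_y F (x, y).
Proof.
rewrite /Rintegral -integral12_prod_meas1; last exact: (bfs_integrable bfs_prod).
by congr fine; apply: eq_integral => x _; rewrite (EFin_bfs_int (bfs_pairr x)).
Qed.

Lemma bfs_fubini :
  \int[m1]_x \int[m2]_y F (x, y) = \int[m2]_y \int[m1]_x F (x, y).
Proof.
rewrite -bfs_int_prod /Rintegral -integral21_prod_meas1; last exact: (bfs_integrable bfs_prod).
by congr fine; apply: eq_integral => x _; rewrite (EFin_bfs_int (bfs_pairl x)).
Qed.

End bfs_fubini.

Section euclidean_space.
Context {R : realType} {n : nat}.
Implicit Types x y z : 'rV[R]_n.

Definition dotv x y : R := \sum_i x ord0 i * y ord0 i.

Lemma dotvC x y : dotv x y = dotv y x.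
Proof. by apply: eq_bigr => i _; rewrite mulrC. Qed.

Lemma dotvDl x y z : dotv (x + y) z = dotv x z + dotv y z.
Proof.
by rewrite /dotv -big_split/=; apply: eq_bigr => i _; rewrite !mxE mulrDl.
Qed.

Lemma dotvZl k x y : dotv (k *: x) y = k * dotv x y.
Proof. by rewrite /dotv mulr_sumr; apply: eq_bigr => i _; rewrite !mxE mulrA. Qed.

Lemma dotvDr x y z : dotv x (y + z) = dotv x y + dotv x z.
Proof. by rewrite dotvC dotvDl !(dotvC _ x). Qed.

Lemma dotvZr k x y : dotv x (k *: y) = k * dotv x y.
Proof. by rewrite dotvC dotvZl dotvC. Qed.

Lemma dotvNl x y : dotv (- x) y = - dotv x y.
Proof. by rewrite -scaleN1r dotvZl mulN1r. Qed.

Lemma dotvNr x y : dotv x (- y) = - dotv x y.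
Proof. by rewrite dotvC dotvNl dotvC. Qed.

Lemma dotvBl x y z : dotv (x - y) z = dotv x z - dotv y z.
Proof. by rewrite dotvDl dotvNl. Qed.

Lemma dotvBr x y z : dotv x (y - z) = dotv x y - dotv x z.
Proof. by rewrite dotvDr dotvNr. Qed.

Lemma dotvv_ge0 x : 0 <= dotv x x.
Proof. by apply: sumr_ge0 => i _; rewrite -expr2 sqr_ge0. Qed.

Lemma enormE x : enorm x = Num.sqrt (dotv x x).
Proof. by congr Num.sqrt; apply: eq_bigr => i _; rewrite expr2. Qed.

Lemma enorm_sqr x : enorm x ^+ 2 = dotv x x.
Proof. by rewrite enormE sqr_sqrtr// dotvv_ge0. Qed.

Lemma enorm_ge0 x : 0 <= enorm x.
Proof. exact: sqrtr_ge0. Qed.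

Lemma enormZ k x : enorm (k *: x) = `|k| * enorm x.
Proof.
by rewrite !enormE dotvZl dotvZr mulrA -expr2 sqrtrM ?sqr_ge0// sqrtr_sqr.
Qed.

Lemma enormN x : enorm (- x) = enorm x.
Proof. by rewrite -scaleN1r enormZ normrN1 mul1r. Qed.

Lemma enorm_distC x y : enorm (x - y) = enorm (y - x).
Proof. by rewrite -enormN opprB. Qed.

Lemma enorm0 : enorm (0 : 'rV[R]_n) = 0.
Proof. by rewrite -(scale0r 0) enormZ normr0 mul0r. Qed.

Lemma dotv_le x y : dotv x y <= enorm x * enorm y.
Proof.
have [y0|y0] := eqVneq (enorm y) 0.
  have yz i : y ord0 i = 0.
    have : dotv y y = 0 by rewrite -enorm_sqr y0 expr0n.
    move/eqP; rewrite psumr_eq0; last by move=> j _; rewrite -expr2 sqr_ge0.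
    by move=> /allP/(_ i); rewrite mem_index_enum mulf_eq0 orbb => /(_ isT)/eqP.
  by rewrite y0 mulr0 /dotv big1// => i _; rewrite yz mulr0.
have yp : 0 < enorm y by rewrite lt_neqAle eq_sym y0 enorm_ge0.
have [xy|xy] := leP (dotv x y) 0.
  by rewrite (le_trans xy)// mulr_ge0 ?enorm_ge0.
rewrite -ler_sqr ?nnegrE ?mulr_ge0 ?enorm_ge0 ?(ltW xy)// exprMn !enorm_sqr.
have := dotvv_ge0 (dotv y y *: x - dotv x y *: y).
rewrite !(dotvBl, dotvBr, dotvZl, dotvZr) (dotvC y x).
have yyp : 0 < dotv y y by rewrite -enorm_sqr exprn_gt0.
set a := dotv x x; set b := dotv y y; set c := dotv x y => H.
have : 0 <= b * (a * b - c ^+ 2) by move: H; congr (_ <= _); ring.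
by rewrite (pmulr_rge0 _ yyp) subr_ge0.
Qed.

Lemma dotv_norm_le x y : `|dotv x y| <= enorm x * enorm y.
Proof.
by rewrite ler_norml dotv_le andbT lerNl -dotvNl (le_trans (dotv_le _ _))// enormN.
Qed.

Lemma enormD x y : enorm (x + y) <= enorm x + enorm y.
Proof.
rewrite -ler_sqr ?nnegrE ?addr_ge0 ?enorm_ge0// enorm_sqr.
rewrite dotvDl !dotvDr (dotvC y x) sqrrD !enorm_sqr.
by have := dotv_le x y; rewrite -mulr_natr; lra.
Qed.

Lemma enormB x y : enorm (x - y) <= enorm x + enorm y.
Proof. by rewrite (le_trans (enormD _ _))// enormN. Qed.

Lemma enorm_triangle x y : enorm x <= enorm (x - y) + enorm y.
Proof. by rewrite -{1}(subrK y x) enormD. Qed.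

Lemma enorm_dist x y : `|enorm x - enorm y| <= enorm (x - y).
Proof.
rewrite ler_norml lerBlDr enorm_triangle andbT.
by rewrite lerNl opprB lerBlDr enorm_distC enorm_triangle.
Qed.

Lemma coord_le_enorm x i : `|x ord0 i| <= enorm x.
Proof.
rewrite -ler_sqr ?nnegrE ?enorm_ge0// enorm_sqr real_normK ?num_real//.
rewrite /dotv (bigD1 i)//= -expr2 lerDl sumr_ge0// => j _.
by rewrite -expr2 sqr_ge0.
Qed.

Lemma enorm_eq0 x : (enorm x == 0) = (x == 0).
Proof.
apply/idP/idP => [/eqP x0|/eqP ->]; last by rewrite enorm0.
apply/eqP/rowP => i; apply/eqP; rewrite mxE -normr_le0.
by rewrite (le_trans (coord_le_enorm _ i))// x0.
Qed.

Lemma eballN r x : eball r (- x) = eball r x.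
Proof. by rewrite /eball/= enormN. Qed.

Lemma measurable_coord (i : 'I_n) :
  measurable_fun setT (fun v : 'rV[R]_n => v ord0 i).
Proof. exact: (measurable_rV_coord i). Qed.

Lemma measurable_to_rV d (T : measurableType d) (f : T -> 'rV[R]_n) :
  (forall i, measurable_fun setT (fun t => f t ord0 i)) ->
  measurable_fun setT f.
Proof. by move=> mf; exact: measurable_rV_coordP. Qed.

Lemma measurable_fun_dotv d (T : measurableType d) (f g : T -> 'rV[R]_n) :
  measurable_fun setT f -> measurable_fun setT g ->
  measurable_fun setT (fun t => dotv (f t) (g t)).
Proof.
move=> mf mg; apply: measurable_sum => i.
apply: measurable_funM.
  exact: (measurableT_comp (measurable_coord i) mf).
exact: (measurableT_comp (measurable_coord i) mg).
Qed.

Lemma measurable_enorm : measurable_fun setT (@enorm R n).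
Proof.
have -> : @enorm R n = Num.sqrt \o (fun x => dotv x x).
  by apply/funext => x /=; rewrite -enormE.
apply: measurableT_comp; last exact: measurable_fun_dotv.
by apply: continuous_measurable_fun; exact: sqrt_continuous.
Qed.

Lemma measurable_rVD d (T : measurableType d) (f g : T -> 'rV[R]_n) :
  measurable_fun setT f -> measurable_fun setT g ->
  measurable_fun setT (fun t => f t + g t).
Proof.
move=> mf mg; apply: measurable_to_rV => i.
under eq_fun do rewrite mxE.
apply: measurable_funD.
  exact: (measurableT_comp (measurable_coord i) mf).
exact: (measurableT_comp (measurable_coord i) mg).
Qed.

Lemma measurable_rVZ d (T : measurableType d) (k : T -> R) (f : T -> 'rV[R]_n) :
  measurable_fun setT k -> measurable_fun setT f ->
  measurable_fun setT (fun t => k t *: f t).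
Proof.
move=> mk mf; apply: measurable_to_rV => i.
under eq_fun do rewrite mxE.
apply: measurable_funM => //.
exact: (measurableT_comp (measurable_coord i) mf).
Qed.

Lemma measurable_rVN d (T : measurableType d) (f : T -> 'rV[R]_n) :
  measurable_fun setT f -> measurable_fun setT (fun t => - f t).
Proof.
move=> mf; under eq_fun do rewrite -scaleN1r.
exact: (measurable_rVZ (k := cst (-1))).
Qed.

Lemma measurable_rVB d (T : measurableType d) (f g : T -> 'rV[R]_n) :
  measurable_fun setT f -> measurable_fun setT g ->
  measurable_fun setT (fun t => f t - g t).
Proof. by move=> mf mg; apply: measurable_rVD => //; exact: measurable_rVN. Qed.

Lemma measurable_eball r : measurable (eball r : set 'rV[R]_n).
Proof.
have -> : (eball r : set 'rV[R]_n) = @enorm R n @^-1` `]-oo, r].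
  by apply/seteqP; split => x /=; rewrite in_itv.
by rewrite -[X in measurable X]setTI; exact: measurable_enorm.
Qed.

End euclidean_space.

(** * Translation invariance of Lebesgue measure, by induction on the dimension *)

Section lebesgue_translation.
Context {R : realType}.
Local Open Scope ereal_scope.

Lemma measurable_addr (a : R) :
  measurable_fun setT (fun x : measurableTypeR R => (x + a)%R : measurableTypeR R).
Proof. by apply: measurable_funD. Qed.

Lemma lebesgue_shift (a : R) (A : set R) : measurable A ->
  lebesgue_measure ((fun x : R => (x + a)%R) @^-1` A) = lebesgue_measure A.
Proof.
pose f : {mfun measurableTypeR R >-> measurableTypeR R} :=
  HB.pack (fun x : R => (x + a)%R) (isMeasurableFun.Build _ _ _ _ _ (measurable_addr a)).
move=> mA; rewrite [RHS](@lebesgue_measure_unique R (pushforward lebesgue_measure f))//.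
move=> X [[u v] _ <-]; rewrite /=; transitivity (lebesgue_measure ((fun x : R => (x + a)%R) @^-1` `]u, v])) => //.
have -> : (fun x => (x + a)%R) @^-1` `]u, v]%classic = `](u - a)%R, (v - a)%R]%classic :> set R.
  by apply/seteqP; split => x /=; rewrite !in_itv/= ltrBlDr lerBrDr.
rewrite !lebesgue_measure_itv/= !lte_fin ltrD2r; case: ifPn => // _.
by rewrite -!EFinB; congr EFin; lra.
Qed.

Lemma ge0_integral_shift (a : R) (f : R -> \bar R) :
  measurable_fun setT f -> (forall x, 0 <= f x) ->
  \int[lebesgue_measure]_x f (x + a)%R = \int[lebesgue_measure]_x f x.
Proof.
move=> mf f0.
pose phi (x : measurableTypeR R) : measurableTypeR R := (x + a)%R.
transitivity (\int[pushforward lebesgue_measure phi]_x f x).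
  by rewrite ge0_integral_pushforward//; exact: measurable_addr.
apply: eq_measure_integral => [|mphi A mA _]; first exact: measurable_addr.
exact: lebesgue_shift.
Qed.

Lemma rV_ge0_integralS n (f : 'rV[R]_n.+1 -> \bar R) :
  measurable_fun setT f -> (forall x, 0 <= f x) ->
  \int[lebesgue_rV n.+1]_v f v =
  \int[lebesgue_measure]_x \int[lebesgue_rV n]_w f (rV_cons (x, w)).
Proof.
move=> mf f0.
have := @ge0_integral_pushforward _ _ _ _ _ _ (@measurable_rV_cons R n)
  (lebesgue_measure \x lebesgue_rV n)%E setT f measurableT mf.
move=> -> //; rewrite preimage_setT fubini_tonelli1//=.
by apply: measurableT_comp => //; exact: measurable_rV_cons.
Qed.

Lemma ge0_rV_integral_shift n (a : 'rV[R]_n) (f : 'rV[R]_n -> \bar R) :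
  measurable_fun setT f -> (forall x, 0 <= f x) ->
  \int[lebesgue_rV n]_x f (x + a)%R = \int[lebesgue_rV n]_x f x.
Proof.
elim: n a f => [|n IHn] a f mf f0.
  by rewrite (_ : a = 0)%R; [apply: eq_integral => x _; rewrite addr0|apply/rowP => -[]].
have mfa : measurable_fun setT (fun x : 'rV[R]_n.+1 => f (x + a)%R).
  apply: (measurableT_comp mf); apply: (measurable_rVD (f := id) (g := cst a)) => //.
rewrite (rV_ge0_integralS mfa (fun x => f0 (x + a)%R)) (rV_ge0_integralS mf f0).
have [a0 [a' ->]] : exists a0, exists a', a = rV_cons (a0, a').
  exists (a ord0 ord0), (\row_j a ord0 (lift ord0 j)); apply/rowP => i.
  by rewrite mxE; case: unliftP => [j ->|->]//=; rewrite mxE.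
have consD (x : R) w : (rV_cons (x, w) + rV_cons (a0, a') =
    rV_cons ((x + (a0 : R) : R), w + a') :> 'rV[R]_n.+1)%R.
  by apply/rowP => i; rewrite !mxE; case: unliftP => [j _|_]//=; rewrite mxE.
have mfc : measurable_fun setT (f \o @rV_cons R n).
  by apply: measurableT_comp => //; exact: measurable_rV_cons.
under eq_integral => x _.
  under eq_integral do rewrite consD.
  rewrite (IHn a' (fun w => f (rV_cons (((x : R) + (a0 : R))%R : R, w))))//; last first.
    exact: (measurableT_comp mfc (measurable_pair1 _)).
  over.
rewrite (ge0_integral_shift a0 (f := fun x => \int[lebesgue_rV n]_w f (rV_cons (x, w))))//.
- apply: (@measurable_fun_fubini_tonelli_F _ _ _ _ _ (lebesgue_rV n) (f \o @rV_cons R n)) => //.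
  by move=> ?; exact: f0.
- by move=> x; exact: integral_ge0.
Qed.

End lebesgue_translation.

(** * Maps preserving Lebesgue measure; volumes of cubes and balls *)

Section measure_preserving.
Context {R : realType} {n : nat}.
Local Notation L := (@lebesgue_rV R n).
Implicit Types (phi : 'rV[R]_n -> 'rV[R]_n) (A B : set 'rV[R]_n).

Definition preserving phi := measurable_fun setT phi /\
  forall g : 'rV[R]_n -> \bar R, measurable_fun setT g -> (forall x, 0 <= g x)%E ->
    (\int[L]_x g (phi x) = \int[L]_x g x)%E.

Lemma preserving_int phi (f : 'rV[R]_n -> R) : preserving phi ->
  measurable_fun setT f -> \int[L]_x f (phi x) = \int[L]_x f x.
Proof.
move=> [mphi H] mf; rewrite /Rintegral; congr fine.
have mEf : measurable_fun setT (EFin \o f) by exact: measurableT_comp.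
rewrite integralE [RHS]integralE; congr (_ - _)%E.
- rewrite -(H _ (measurable_funepos mEf))//; apply: eq_integral => x _.
  by rewrite (funepos_comp (EFin \o f) phi).
- rewrite -(H _ (measurable_funeneg mEf))//; apply: eq_integral => x _.
  by rewrite (funeneg_comp (EFin \o f) phi).
Qed.

Lemma measurable_preim phi A : measurable_fun setT phi -> measurable A ->
  measurable (phi @^-1` A).
Proof. by move=> mphi mA; rewrite -[X in measurable X]setTI; exact: mphi. Qed.

Lemma preserving_set phi A : preserving phi -> measurable A ->
  L (phi @^-1` A) = L A.
Proof.
move=> [mphi H] mA.
have mphiA := measurable_preim mphi mA.
have m1 : measurable_fun setT (EFin \o \1_A : 'rV[R]_n -> \bar R).
  by apply: measurableT_comp.
have i0 x : (0 <= (EFin \o \1_A : 'rV[R]_n -> \bar R) x)%E by rewrite lee_fin indicE.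
have := H _ m1 i0.
have -> : (\int[L]_x (EFin \o \1_A) x = L A)%E by rewrite /= integral_indic// setIT.
move=> <-; transitivity (\int[L]_x (\1_(phi @^-1` A) x)%:E)%E => //.
by rewrite integral_indic// setIT.
Qed.

Lemma preserving_of_set phi : measurable_fun setT phi ->
  (forall A, measurable A -> L (phi @^-1` A) = L A) -> preserving phi.
Proof.
move=> mphi H; split => // g mg g0.
transitivity (\int[pushforward L phi]_x g x)%E.
  by rewrite ge0_integral_pushforward.
by apply: eq_measure_integral => A mA _; exact: H.
Qed.

Lemma preserving_shift a : preserving (fun x => x + a).
Proof.
split; first exact: measurable_rVD.
by move=> g mg g0; exact: ge0_rV_integral_shift.
Qed.

Lemma preserving_comp phi psi : preserving phi -> preserving psi ->
  preserving (fun x => phi (psi x)).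
Proof.
move=> [mphi H1] [mpsi H2]; split; first exact: measurableT_comp.
move=> g mg g0; rewrite (H2 (fun x => g (phi x)))//; first exact: H1.
exact: measurableT_comp.
Qed.

(* Both sides are the integral of [1_A (phi x) * 1_B (y - phi x)], computed in
   the two possible orders. *)
Lemma lebesgue_rV_additive phi psi A B : measurable_fun setT phi ->
  (forall x y, phi (x + y) = phi x + phi y) -> cancel psi phi ->
  measurable A -> measurable B -> (forall x, B (- x) <-> B x) ->
  (L (phi @^-1` A) * L B = L A * L (phi @^-1` B))%E.
Proof.
move=> mphi phiD psiK mA mB symB.
pose F (z : 'rV[R]_n * 'rV[R]_n) : \bar R :=
  (\1_A (phi z.1) * \1_B (z.2 - phi z.1))%:E.
have mphi1 : measurable_fun setT (fun z : 'rV[R]_n * 'rV[R]_n => phi z.1).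
  exact: measurableT_comp.
have mF : measurable_fun setT F.
  apply: measurableT_comp => //; apply: measurable_funM.
    by apply: measurableT_comp.
  by apply: measurableT_comp => //; exact: measurable_rVB.
have F0 z : (0 <= F z)%E by rewrite lee_fin mulr_ge0// indicE.
have mD C : measurable C ->
    measurable_fun setT (fun x => (\1_C (phi x) : R)%:E : \bar R).
  move=> mC; apply: measurableT_comp => //.
  by apply: (measurableT_comp (f := (\1_C : _ -> R))) => //; exact: measurable_indic.
have L1 C a : measurable C -> (\int[L]_y (\1_C (y + a))%:E = L C)%E.
  move=> mC; rewrite (ge0_rV_integral_shift a (f := fun y => (\1_C y)%:E))//.
  - by rewrite integral_indic// setIT.
  - by apply: measurableT_comp.
have LC C : measurable C -> (\int[L]_x (\1_C (phi x))%:E = L (phi @^-1` C))%E.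
  by move=> mC; rewrite -(setIT (phi @^-1` C)) -integral_indic//; exact: measurable_preim.
have i0 C x : (0 <= (\1_C x : R)%:E)%E by rewrite lee_fin indicE.
transitivity (\int[L]_x \int[L]_y F (x, y))%E.
  rewrite -LC// muleC -ge0_integralZl//; last exact: mD.
  apply: eq_integral => x _; rewrite /F/=.
  under eq_integral do rewrite EFinM.
  rewrite ge0_integralZl//; last by apply: measurableT_comp => //; apply: measurableT_comp => //; exact: measurable_rVB.
  by rewrite L1// muleC.
rewrite fubini_tonelli//.
transitivity (\int[L]_y \int[L]_x (\1_A (y + phi x) * \1_B (phi x))%:E)%E.
  apply: eq_integral => y _.
  (* Shifting [x] by [psi y] turns [phi x] into [phi x + y]; the symmetry of [B] then absorbs the
     remaining sign. *)
  rewrite -(ge0_rV_integral_shift (psi y) (f := fun x => F (x, y)))//; last first.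
    exact: (measurableT_comp mF).
  apply: eq_integral => x _; rewrite /F/= phiD psiK addrC; congr (_ * _)%:E.
  rewrite opprD addrA subrr add0r !indicE; congr (nat_of_bool _)%:R.
  by apply/idP/idP => /set_mem H; apply/mem_set; [rewrite -symB|rewrite symB].
have mG : measurable_fun setT (fun z : 'rV[R]_n * 'rV[R]_n =>
    (\1_A (z.1 + phi z.2) * \1_B (phi z.2) : R)%:E : \bar R).
  have m2 : measurable_fun setT (fun z : 'rV[R]_n * 'rV[R]_n => phi z.2).
    exact: measurableT_comp.
  apply: measurableT_comp => //; apply: measurable_funM.
    by apply: measurableT_comp => //; exact: measurable_rVD.
  by apply: measurableT_comp.
rewrite (@fubini_tonelli _ _ _ _ _ L L (fun z => (\1_A (z.1 + phi z.2) * \1_B (phi z.2))%:E))//=.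
rewrite -LC// -ge0_integralZl//; last exact: mD.
apply: eq_integral => x _.
under eq_integral do rewrite mulrC EFinM.
rewrite ge0_integralZl//; last first.
  by apply: measurableT_comp => //; apply: measurableT_comp => //; exact: measurable_rVD.
by rewrite L1// muleC.
Qed.

Definition cube (r : R) : set 'rV[R]_n :=
  [set v | forall i, `[- r, r]%classic (v ord0 i)].

Lemma prod_EFin (c : R) : (\prod_(i < n) c%:E = (c ^+ n)%:E)%E.
Proof.
elim: n => [|m IHm]; first by rewrite big_ord0.
by rewrite big_ord_recl IHm -EFinM exprS.
Qed.

Lemma lebesgue_cube r : 0 <= r -> L (cube r) = ((r *+ 2) ^+ n)%:E.
Proof.
move=> r0; rewrite /cube (lebesgue_rV_box (F := fun=> `[- r, r]%classic))//.
rewrite -prod_EFin; apply: eq_bigr => i _.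
rewrite lebesgue_measure_itv/= lte_fin.
have [r1|r1] := ltP (- r) r; first by rewrite -EFinB opprK.
have -> : r = 0 by lra.
by rewrite mul0rn.
Qed.

Lemma measurable_cube r : measurable (cube r).
Proof.
rewrite (_ : cube r = \big[setI/setT]_(i < n)
    ((fun v : 'rV[R]_n => v ord0 i) @^-1` `[- r, r])); last first.
  rewrite -bigcap_seq; apply/seteqP; split => v /= H i; first by move=> _; exact: H.
  by apply: H; rewrite /= mem_index_enum.
apply: bigsetI_measurable => i _.
by rewrite -[X in measurable X]setTI; exact: measurable_coord.
Qed.

Lemma eball_sub_cube r : eball r `<=` cube r.
Proof.
move=> x xr i; rewrite /= in_itv/= -ler_norml.
by rewrite (le_trans (coord_le_enorm _ _)).
Qed.

Lemma eball_finite r : (L (eball r) < +oo)%E.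
Proof.
have [r0|r0] := leP 0 r.
  rewrite (@le_lt_trans _ _ (L (cube r)))//; last by rewrite lebesgue_cube// ltry.
  by rewrite le_measure ?inE//; [exact: measurable_eball|exact: measurable_cube|exact: eball_sub_cube].
have -> : eball r = set0 :> set 'rV[R]_n.
  by apply/seteqP; split => // x /= xr; have := enorm_ge0 x; rewrite leNgt (le_lt_trans xr).
by rewrite measure0.
Qed.

Lemma cube_sub_eball r : 0 <= r -> cube r `<=` eball (r *+ n).
Proof.
move=> r0 x xr; rewrite /eball/=.
have H i : `|x ord0 i| <= r by have := xr i; rewrite /= in_itv/= -ler_norml.
rewrite -ler_sqr ?nnegrE ?enorm_ge0 ?mulrn_wge0// enorm_sqr.
rewrite (@le_trans _ _ (\sum_(i < n) r ^+ 2))//.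
  apply: ler_sum => i _; rewrite -expr2 -real_normK ?num_real//.
  by rewrite ler_sqr ?nnegrE.
rewrite sumr_const card_ord exprMn_n ler_wpMn2l ?sqr_ge0//.
by case: (n) => // m; rewrite leq_pmulr.
Qed.

(** [lebesgue_rV_additive] says that an additive bijection multiplies volumes by a constant;
    comparison with the unit cube, whose preimage is [cube r], identifies this constant. *)
Lemma lebesgue_scale r A : 0 < r -> measurable A ->
  L ((fun x => r^-1 *: x) @^-1` A) = ((r ^+ n)%:E * L A)%E.
Proof.
move=> r0 mA.
have rV0 : r^-1 != 0 by rewrite invr_eq0 gt_eqF.
have := @lebesgue_rV_additive (fun x => r^-1 *: x) (fun x => r *: x) A (cube 1).
rewrite lebesgue_cube//.
have -> : (fun x => r^-1 *: x) @^-1` cube 1 = cube r.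
  apply/seteqP; split => x /= H i; have := H i; rewrite /= !in_itv/= !mxE.
    by rewrite ler_pdivlMl// ler_pdivrMl// mulr1 mulrN1.
  by rewrite ler_pdivlMl// ler_pdivrMl// mulr1 mulrN1.
rewrite lebesgue_cube ?ltW// => H.
have e : (1 *+ 2 : R) ^+ n \is a GRing.unit by rewrite unitfE expf_neq0// pnatr_eq0.
have : (L ((fun x => r^-1 *: x) @^-1` A) * ((1 *+ 2) ^+ n)%:E =
        L A * ((r *+ 2) ^+ n)%:E)%E.
  apply: H => //.
  - exact: measurable_rVZ.
  - by move=> x y; rewrite scalerDr.
  - by move=> x; rewrite scalerA mulVf ?scale1r// gt_eqF.
  - exact: measurable_cube.
  - move=> x; split => H i; have := H i; rewrite /= !in_itv/= !mxE => /andP[]; lra.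
have -> : (r *+ 2 = r * (1 *+ 2)) by rewrite mulr_natr.
rewrite exprMn => /(congr1 (fun z => z * (((1 *+ 2) ^+ n)^-1)%:E)%E).
rewrite -!muleA -!EFinM divrr// -mulrA divrr// !mulr1 mule1 => ->.
by rewrite muleC.
Qed.

Lemma lebesgue_eball r : 0 < r -> L (eball r) = ((r ^+ n)%:E * L (eball 1))%E.
Proof.
move=> r0; rewrite -lebesgue_scale//; last exact: measurable_eball.
congr (L _); apply/seteqP; split => x /=; rewrite /eball/= enormZ.
  by rewrite ger0_norm ?invr_ge0 ?(ltW r0)// ler_pdivrMl// mulr1.
by rewrite ger0_norm ?invr_ge0 ?(ltW r0)// ler_pdivrMl// mulr1.
Qed.

Definition bvol : R := fine (L (eball 1)).

Lemma eball1_gt0 : (0 < L (eball 1))%E.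
Proof.
rewrite (@lt_le_trans _ _ (L (cube n.+1%:R^-1)))//.
  by rewrite lebesgue_cube// lte_fin exprn_gt0// pmulrn_lgt0.
rewrite le_measure ?inE//; [exact: measurable_cube|exact: measurable_eball|].
apply: subset_trans (cube_sub_eball _) _ => // x; rewrite /eball/= => H.
by rewrite (le_trans H)// -[_ *+ n]mulr_natl ler_pdivrMr// mul1r ler_nat.
Qed.

Lemma bvol_gt0 : 0 < bvol.
Proof. by rewrite fine_gt0// eball1_gt0 eball_finite. Qed.

Lemma fine_lebesgue_eball r : 0 < r -> fine (L (eball r)) = r ^+ n * bvol.
Proof. by move=> r0; rewrite lebesgue_eball// fineM// ge0_fin_numE// eball_finite. Qed.

(** The unit ball is its own preimage and has finite nonzero volume, so the constant by which [phi]
    multiplies volumes is [1]. No determinant is involved. *)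
Lemma preserving_iso phi psi : measurable_fun setT phi ->
  (forall x y, phi (x + y) = phi x + phi y) -> cancel psi phi ->
  (forall x, enorm (phi x) = enorm x) -> preserving phi.
Proof.
move=> mphi phiD psiK phin; apply: preserving_of_set => // A mA.
have sym (x : 'rV[R]_n) : eball 1 (- x) <-> eball 1 x by rewrite eballN.
have := lebesgue_rV_additive mphi phiD psiK mA (measurable_eball 1) sym.
have -> : phi @^-1` eball 1 = eball 1.
  by apply/seteqP; split => x; rewrite /eball/= phin.
have /fineK <- : L (eball 1) \is a fin_num by rewrite ge0_fin_numE// eball_finite.
move/(congr1 (fun z => z * (bvol^-1)%:E)%E).
by rewrite -!muleA -!EFinM divff ?gt_eqF ?bvol_gt0// !mule1.
Qed.

Lemma preserving_opp : preserving (fun x => - x).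
Proof.
apply: (@preserving_iso _ (fun x => - x)).
- exact: measurable_rVN.
- by move=> x y; rewrite opprD.
- exact: opprK.
- exact: enormN.
Qed.

Lemma preserving_subl a : preserving (fun x => a - x).
Proof.
rewrite (_ : (fun x => a - x) = (fun x => - x + a)).
  exact: (preserving_comp (preserving_shift a) preserving_opp).
by apply/funext => x; rewrite addrC.
Qed.

(** The orthogonal reflection in the hyperplane normal to [v]. Such reflections replace rotations:
    the one of normal [x - y] exchanges two vectors [x] and [y] of equal norm, which is enough to
    show that the transform of the ball is radial. *)
Definition householder (v : 'rV[R]_n) x := x - (2 * dotv v x / dotv v v) *: v.

Lemma householderK v : dotv v v != 0 -> involutive (householder v).
Proof.
move=> v0 x; rewrite /householder dotvBr dotvZr -addrA -opprD -scalerDl.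
have -> : 2 * dotv v x / dotv v v + 2 * (dotv v x - 2 * dotv v x / dotv v v * dotv v v) / dotv v v = 0.
  by field.
by rewrite scale0r subr0.
Qed.

Lemma preserving_householder v : dotv v v != 0 -> preserving (householder v).
Proof.
move=> v0; apply: (@preserving_iso _ (householder v)).
- apply: measurable_rVB => //; apply: measurable_rVZ => //.
  apply: measurable_funM => //; apply: measurable_funM => //.
  exact: measurable_fun_dotv.
- move=> x y; rewrite /householder dotvDr mulrDr mulrDl scalerDl opprD.
  by rewrite addrACA.
- exact: householderK.
- move=> x; rewrite !enormE; congr Num.sqrt; rewrite /householder.
  by rewrite !(dotvBl, dotvBr, dotvZl, dotvZr) (dotvC x v); field.
Qed.

Lemma householder_swap x y : enorm x = enorm y -> x != y ->
  householder (x - y) x = y.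
Proof.
move=> xy xny; rewrite /householder.
have e : dotv x x = dotv y y by rewrite -!enorm_sqr xy.
have v0 : dotv (x - y) (x - y) != 0.
  by rewrite -enorm_sqr sqrf_eq0 enorm_eq0 subr_eq0.
have -> : 2 * dotv (x - y) x / dotv (x - y) (x - y) = 1.
  move: v0; rewrite !(dotvBl, dotvBr) (dotvC y x) e => v0.
  by field; rewrite -[X in X != 0](_ : dotv y y - dotv x y - (dotv x y - dotv y y) = _)//; ring.
by rewrite scale1r opprB addrC subrK.
Qed.

Lemma dotv_householder v x y : dotv v v != 0 ->
  dotv (householder v x) y = dotv x (householder v y).
Proof.
move=> v0; rewrite /householder !(dotvBl, dotvBr, dotvZl, dotvZr) (dotvC x v).
by ring.
Qed.

End measure_preserving.

Arguments bvol R n : clear implicits.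

(** * Ball averages *)

Section ball_averages.
Context {R : realType} {n : nat}.
Local Notation L := (@lebesgue_rV R n).
Local Notation B1 := (\1_(eball 1) : 'rV[R]_n -> R).
Implicit Types (a b : 'rV[R]_n -> R) (x y : 'rV[R]_n).

(** Real and imaginary parts of test functions belong to this class. It is stable under translation
    and under [S] below, and [RB_bfs] gives it all the rules of integration. *)
Definition RB a := [/\ measurable_fun setT a,
  exists K : R, forall x, `|a x| <= K &
  exists r : R, forall x, r < enorm x -> a x = 0].

Lemma RB_bfs a : RB a -> bfs L a.
Proof.
move=> [ma bda [r ar]]; split => //; exists (eball r); split.
- exact: measurable_eball.
- exact: eball_finite.
- by move=> x /negP; rewrite -ltNge => /ar.
Qed.

Lemma RBD a b : RB a -> RB b -> RB (fun x => a x + b x).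
Proof.
move=> Ra Rb; have [? ? _] := bfsD (RB_bfs Ra) (RB_bfs Rb); split => //.
case: Ra Rb => [_ _ [r ar]] [_ _ [s bs]]; exists (Num.max r s) => x.
by rewrite gt_max => /andP[/ar -> /bs ->]; rewrite addr0.
Qed.

Lemma RBM a b : RB a -> measurable_fun setT b ->
  (exists K : R, forall x, `|b x| <= K) -> RB (fun x => a x * b x).
Proof.
move=> Ra mb Kb; have [? ? _] := bfsM (RB_bfs Ra) mb Kb; split => //.
by case: Ra => [_ _ [r ar]]; exists r => x /ar ->; rewrite mul0r.
Qed.

Lemma RBZ k a : RB a -> RB (fun x => k * a x).
Proof.
move=> Ra; have [? ? _] := bfsZ k (RB_bfs Ra); split => //.
by case: Ra => [_ _ [r ar]]; exists r => x /ar ->; rewrite mulr0.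
Qed.

Lemma RBB a b : RB a -> RB b -> RB (fun x => a x - b x).
Proof.
move=> Ra /(RBZ (-1)) /(RBD Ra); congr RB.
by apply/funext => x; rewrite mulN1r.
Qed.

Lemma RB0 : RB (fun=> 0).
Proof.
split; first exact: measurable_cst.
  by exists 0 => x; rewrite normr0.
by exists 0.
Qed.

Lemma RB_indicM a A : RB a -> measurable A -> RB (fun x => a x * \1_A x).
Proof.
move=> Ra mA; apply: RBM => //.
by exists 1 => x; rewrite indicE; case: (_ \in _) => /=; rewrite ?normr1 ?normr0.
Qed.

Lemma RB_shift a v : RB a -> RB (fun x => a (x + v)).
Proof.
move=> [ma [K aK] [r ar]]; split.
- by apply: (measurableT_comp ma); exact: measurable_rVD.
- by exists K.
- exists (r + enorm v) => x xr; apply: ar.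
  have := enormB (x + v) v; rewrite addrK; lra.
Qed.

Lemma RB_ball r : RB (\1_(eball r)).
Proof.
split; first by apply: measurable_indic; exact: measurable_eball.
  by exists 1 => x; rewrite indicE; case: (_ \in _) => /=; rewrite ?normr1 ?normr0.
by exists r => x xr; rewrite indicE memNset//= /eball/=; rewrite leNgt xr.
Qed.

Lemma B1_ge0 x : 0 <= B1 x. Proof. by rewrite indicE. Qed.

Lemma B1_norm x : `|B1 x| <= 1.
Proof. by rewrite indicE; case: (_ \in _) => /=; rewrite ?normr1 ?normr0. Qed.

Lemma B1E x : B1 x = (enorm x <= 1)%R%:R.
Proof.
rewrite indicE; congr (nat_of_bool _)%:R.
by apply/idP/idP => [/set_mem|H]//; apply/mem_set.
Qed.

Lemma B1N x : B1 (- x) = B1 x.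
Proof. by rewrite !B1E enormN. Qed.

Lemma B1_distC x y : B1 (x - y) = B1 (y - x).
Proof. by rewrite -B1N opprB. Qed.

Lemma measurable_B1 d (T : measurableType d) (f : T -> 'rV[R]_n) :
  measurable_fun setT f -> measurable_fun setT (fun t => B1 (f t)).
Proof.
move=> mf; apply: (measurableT_comp _ mf); apply: measurable_indic.
exact: measurable_eball.
Qed.

Definition S a x : R := \int[L]_y (a y * B1 (x - y)).
Definition N a : R := \int[L]_x (S a x ^+ 2).

Lemma RB_SE a x : RB a -> RB (fun y => a y * B1 (x - y)).
Proof.
move=> Ra; apply: RBM => //; last by exists 1 => y; exact: B1_norm.
by apply: measurable_B1; exact: measurable_rVB.
Qed.

Lemma RB_fubini (F : 'rV[R]_n * 'rV[R]_n -> R) :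
  measurable_fun setT F -> (exists K : R, forall w, `|F w| <= K) ->
  (exists r, forall x y, r < enorm x -> F (x, y) = 0) ->
  (exists r, forall x y, r < enorm y -> F (x, y) = 0) ->
  [/\ \int[L]_x \int[L]_y F (x, y) = \int[L]_y \int[L]_x F (x, y),
    RB (fun x => \int[L]_y F (x, y)), RB (fun y => \int[L]_x F (x, y)) &
    \int[(L \x L)%E]_z F z = \int[L]_x \int[L]_y F (x, y)].
Proof.
move=> mF [K FK] [r Fr] [s Fs].
have FA x y : ~ eball r x -> F (x, y) = 0 by move=> /negP; rewrite -ltNge => /Fr.
have FB x y : ~ eball s y -> F (x, y) = 0 by move=> /negP; rewrite -ltNge => /Fs.
have [mr ms] := (measurable_eball (n := n) r, measurable_eball (n := n) s).
have [oor oos] := (eball_finite (n := n) r, eball_finite (n := n) s).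
split.
- exact: (@bfs_fubini _ _ _ _ _ L L F _ _ K mF FK mr ms oor oos FA FB).
- have [? ? _] := @bfs_intr _ _ _ _ _ L L F _ _ K mF FK mr ms oor oos FA FB.
  split => //; exists r => x xr; under eq_Rintegral do rewrite Fr//.
  by rewrite Rintegral_cst// mul0r.
- have [? ? _] := @bfs_intl _ _ _ _ _ L L F _ _ K mF FK mr ms oor oos FA FB.
  split => //; exists s => x xr; under eq_Rintegral do rewrite Fs//.
  by rewrite Rintegral_cst// mul0r.
- exact: (@bfs_int_prod _ _ _ _ _ L L F _ _ K mF FK mr ms oor oos FA FB).
Qed.

Lemma RB_norm_gt0 a : RB a -> exists2 K : R, 0 <= K & forall x, `|a x| <= K.
Proof. by move=> [_ [K aK] _]; exists K => //; rewrite (le_trans _ (aK 0)). Qed.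

Lemma B1_far r x y : enorm y <= r -> r + 1 < enorm x -> B1 (x - y) = 0.
Proof.
move=> yr xr; rewrite B1E; have := enorm_triangle x y => H.
by rewrite (_ : _ <= 1 = false)//; apply/negbTE; rewrite -ltNge; lra.
Qed.

Lemma RB_S a : RB a -> RB (S a).
Proof.
move=> Ra; have [ma _ [r ar]] := Ra; have [K K0 aK] := RB_norm_gt0 Ra.
have ar1 y : enorm y <= r \/ a y = 0.
  by have [|/ar] := leP (enorm y) r; [left|right].
have [||||_ RF _ _] := @RB_fubini (fun z => a z.2 * B1 (z.1 - z.2)); last exact: RF.
- apply: measurable_funM; first exact: measurableT_comp.
  by apply: measurable_B1; exact: measurable_rVB.
- exists K => z; rewrite normrM (le_trans (ler_wpM2l _ (B1_norm _)))// mulr1.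
  exact: aK.
- exists (r + 1) => x y xr /=; have [yr|->] := ar1 y; last by rewrite mul0r.
  by rewrite (B1_far yr xr) mulr0.
- by exists r => x y yr /=; rewrite ar// mul0r.
Qed.

Lemma S_alt a x : RB a -> S a x = \int[L]_y (a (x + y) * B1 y).
Proof.
move=> Ra; have [mSE _ _] := RB_SE x Ra.
rewrite /S -(preserving_int (preserving_shift x) mSE).
apply: eq_Rintegral => y _; rewrite addrC; congr (_ * _).
by rewrite opprD addrA subrr add0r B1N.
Qed.

Lemma SD a b x : RB a -> RB b -> S (fun y => a y + b y) x = S a x + S b x.
Proof.
move=> Ra Rb; rewrite /S -bfs_intD; try exact/RB_bfs/RB_SE.
by apply: eq_Rintegral => y _; rewrite mulrDl.
Qed.

Lemma SZ k a x : RB a -> S (fun y => k * a y) x = k * S a x.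
Proof.
move=> Ra; rewrite /S -bfs_intZ; try exact/RB_bfs/RB_SE.
by apply: eq_Rintegral => y _; rewrite mulrA.
Qed.

Lemma SB a b x : RB a -> RB b -> S (fun y => a y - b y) x = S a x - S b x.
Proof.
move=> Ra Rb; rewrite /S -bfs_intB; try exact/RB_bfs/RB_SE.
by apply: eq_Rintegral => y _; rewrite mulrBl.
Qed.

Lemma S_shift a v x : RB a -> S (fun y => a (y + v)) x = S a (x + v).
Proof.
move=> Ra; rewrite !S_alt//; last exact: RB_shift.
by apply: eq_Rintegral => y _; rewrite addrAC.
Qed.

Lemma RB_sqr a : RB a -> RB (fun x => a x ^+ 2).
Proof.
by move=> Ra; under eq_fun do rewrite expr2; apply: RBM => //; case: Ra.
Qed.

Lemma N_ge0 a : 0 <= N a.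
Proof. by apply: bfs_int_ge0 => x; exact: sqr_ge0. Qed.

Lemma NZ k a : RB a -> N (fun x => k * a x) = k ^+ 2 * N a.
Proof.
move=> Ra; rewrite /N -bfs_intZ; last exact/RB_bfs/RB_sqr/RB_S.
by apply: eq_Rintegral => x _; rewrite SZ// exprMn.
Qed.

Lemma N_shift a v : RB a -> N (fun x => a (x + v)) = N a.
Proof.
move=> Ra; have [mS _ _] := RB_sqr (RB_S Ra).
rewrite /N -[RHS](preserving_int (preserving_shift v) mS).
by apply: eq_Rintegral => x _; rewrite S_shift.
Qed.

Lemma ND_le a b : RB a -> RB b -> N (fun x => a x + b x) <= 2 * N a + 2 * N b.
Proof.
move=> Ra Rb; rewrite /N.
have [Sa Sb] := (RB_bfs (RB_sqr (RB_S Ra)), RB_bfs (RB_sqr (RB_S Rb))).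
have -> : 2 * \int[L]_x (S a x ^+ 2) + 2 * \int[L]_x (S b x ^+ 2) =
    \int[L]_x (2 * S a x ^+ 2 + 2 * S b x ^+ 2).
  by rewrite (bfs_intD (bfsZ _ Sa) (bfsZ _ Sb)) (bfs_intZ _ Sa) (bfs_intZ _ Sb).
apply: bfs_int_le; first exact/RB_bfs/RB_sqr/RB_S/RBD.
  exact: (bfsD (bfsZ _ Sa) (bfsZ _ Sb)).
move=> x; rewrite SD//; set u := S a x; set v := S b x.
by rewrite -subr_ge0 (_ : _ - _ = (u - v) ^+ 2) ?sqr_ge0//; ring.
Qed.

Lemma NB_le a b : RB a -> RB b -> N (fun x => a x - b x) <= 2 * N a + 2 * N b.
Proof.
move=> Ra Rb; have := ND_le Ra (RBZ (-1) Rb); rewrite NZ// sqrrN expr1n mul1r.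
by under eq_fun do rewrite mulN1r.
Qed.

Lemma int_B1 x : \int[L]_y B1 (x - y) = bvol R n.
Proof.
rewrite (preserving_int (f := B1) (preserving_subl x)).
  by rewrite int_indic//; exact: measurable_eball.
by apply: measurable_indic; exact: measurable_eball.
Qed.

(** Cauchy-Schwarz on the unit ball around [x] bounds [S a x ^+ 2] by [bvol R n] times the integral
    of [a ^+ 2] over that ball; integrating over [x] produces the second factor [bvol R n]. Thus
    closeness in [L2] implies closeness for [N]. *)
Lemma N_le a : RB a -> N a <= bvol R n ^+ 2 * \int[L]_x (a x ^+ 2).
Proof.
move=> Ra; have [ma2 [K aK] [r ar]] := RB_sqr Ra.
have [mF FK F1 F2] : [/\
    measurable_fun setT (fun z : 'rV[R]_n * 'rV[R]_n => a z.2 ^+ 2 * B1 (z.1 - z.2)),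
    exists K : R, forall z : 'rV[R]_n * 'rV[R]_n, `|a z.2 ^+ 2 * B1 (z.1 - z.2)| <= K,
    exists r : R, forall x y : 'rV[R]_n, r < enorm x -> a y ^+ 2 * B1 (x - y) = 0 &
    exists r : R, forall x y : 'rV[R]_n, r < enorm y -> a y ^+ 2 * B1 (x - y) = 0].
  split.
  - apply: measurable_funM; first exact: (measurableT_comp ma2).
    by apply: measurable_B1; exact: measurable_rVB.
  - exists K => z; rewrite normrM (le_trans (ler_wpM2l _ (B1_norm _)))// mulr1.
    exact: aK.
  - exists (r + 1) => x y xr; have [yr|/ar->] := leP (enorm y) r; last by rewrite mul0r.
    by rewrite (B1_far yr xr) mulr0.
  - by exists r => x y /ar ->; rewrite mul0r.
have [sw RF _ _] := RB_fubini mF FK F1 F2.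
have step x : S a x ^+ 2 <= bvol R n * \int[L]_y (a y ^+ 2 * B1 (x - y)).
  have mA := measurable_preim (preserving_subl x).1 (measurable_eball (n := n) 1).
  have vA : L ((fun y => x - y) @^-1` eball 1) = L (eball 1).
    by apply: preserving_set; [exact: preserving_subl|exact: measurable_eball].
  have Aoo : (L ((fun y => (x - y)%R) @^-1` eball 1) < +oo)%E.
    by rewrite vA; exact: eball_finite.
  have := bfs_jensen (RB_bfs Ra) mA Aoo.
  by rewrite [X in fine X]vA.
rewrite /N; apply: (@le_trans _ _ (\int[L]_x (bvol R n * \int[L]_y (a y ^+ 2 * B1 (x - y))))).
  apply: bfs_int_le step; first exact/RB_bfs/RB_sqr/RB_S.
  by apply: bfsZ; exact: RB_bfs RF.
rewrite (bfs_intZ _ (RB_bfs RF)).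
have {}sw : \int[L]_x \int[L]_y (a y ^+ 2 * B1 (x - y)) =
    \int[L]_y \int[L]_x (a y ^+ 2 * B1 (x - y)) by exact: sw.
rewrite sw expr2 -mulrA; apply: ler_wpM2l; first exact/ltW/bvol_gt0.
rewrite -(bfs_intZ _ (RB_bfs (RB_sqr Ra))).
rewrite le_eqVlt; apply/orP; left; apply/eqP; apply: eq_Rintegral => y _.
rewrite (bfs_intZ _ (RB_bfs (RB_shift (- y) (RB_ball 1)))).
rewrite mulrC; congr (_ * _); under eq_Rintegral do rewrite B1_distC.
exact: int_B1.
Qed.

(** A convolution is the density of a sum: [C] is the image under addition of Lebesgue measure on
    the product of two unit balls. This is checked on sets, and a change of variables extends it to
    bounded functions. *)
Lemma int_conv_ball (C : {measure set 'rV[R]_n -> \bar R}) (g : 'rV[R]_n -> R) :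
  (forall A, measurable A -> C A = (\int[L]_(x in A) (Delta x)%:E)%E) ->
  measurable_fun setT g -> (exists K : R, forall x, `|g x| <= K) ->
  \int[C]_x g x = \int[L]_u (B1 u * \int[L]_v (g (u + v) * B1 v)).
Proof.
move=> CE mg [K gK].
pose D := (eball 1 `*` eball 1 : set ('rV[R]_n * 'rV[R]_n)).
have mD : measurable D by apply: measurableX; exact: measurable_eball.
have Doo : ((L \x L)%E D < +oo)%E.
  rewrite /= product_measure1E; try exact: measurable_eball.
  by rewrite lte_mul_pinfty// ?eball_finite// ge0_fin_numE// eball_finite.
pose phi (z : 'rV[R]_n * 'rV[R]_n) := z.1 + z.2.
have mphi : measurable_fun setT phi by exact: measurable_rVD.
have mF (h : 'rV[R]_n -> R) : measurable_fun setT h -> measurable_fun setT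
    (fun z : 'rV[R]_n * 'rV[R]_n => B1 z.1 * (h (z.1 + z.2) * B1 z.2)).
  move=> mh; apply: measurable_funM; first exact: measurable_B1.
  apply: measurable_funM; last exact: measurable_B1.
  exact: (measurableT_comp mh mphi).
have B1z z : 1 < enorm z -> B1 z = 0 by move=> z1; rewrite B1E leNgt z1.
have fub (h : 'rV[R]_n -> R) : measurable_fun setT h -> (exists K : R, forall x, `|h x| <= K) ->
    \int[(L \x L)%E]_z (B1 z.1 * (h (z.1 + z.2) * B1 z.2)) =
    \int[L]_u (B1 u * \int[L]_v (h (u + v) * B1 v)).
  move=> mh [K' hK].
  have [||||_ _ _ ->] := @RB_fubini (fun z => B1 z.1 * (h (z.1 + z.2) * B1 z.2)).
  - exact: mF.
  - exists (1 * (K' * 1)) => z; rewrite !normrM !ler_pM ?mulr_ge0 ?B1_norm//.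
  - by exists 1 => u v /B1z ->; rewrite mul0r.
  - by exists 1 => u v /B1z ->; rewrite !mulr0.
  apply: eq_Rintegral => u _.
  have Rh : RB (fun v => h (u + v) * B1 v).
    under eq_fun do rewrite mulrC; apply: RBM; first exact: RB_ball.
      by apply: (measurableT_comp mh); exact: measurable_rVD.
    by exists K'.
  by rewrite -(bfs_intZ _ (RB_bfs Rh)).
have mB1 : measurable_fun setT B1 by apply: measurable_B1.
have CD A : measurable A -> C A = mrestr (L \x L)%E mD (phi @^-1` A).
  move=> mA; rewrite /mrestr CE//.
  have m1A : measurable_fun setT (\1_A : 'rV[R]_n -> R) by exact: measurable_indic.
  have K1A : exists K : R, forall x, `|(\1_A : 'rV[R]_n -> R) x| <= K.
    by exists 1 => x; rewrite indicE; case: (_ \in _) => /=; rewrite ?normr1 ?normr0.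
  have mphiA : measurable (phi @^-1` A) by rewrite -[X in measurable X]setTI; exact: mphi.
  have fin : ((L \x L)%E (phi @^-1` A `&` D) < +oo)%E.
    have mI : measurable (phi @^-1` A `&` D) by exact: measurableI.
    apply: le_lt_trans Doo; apply: le_measure; rewrite ?inE//.
  have -> : (\int[L]_(x in A) (Delta x)%:E = (\int[L]_x (Delta x * \1_A x))%:E)%E.
    have RDA : RB (fun x => Delta x * \1_A x).
      by apply: RB_indicM => //; exact: (RB_S (RB_ball 1)).
    rewrite (EFin_bfs_int (RB_bfs RDA)) [LHS]integral_mkcond; apply: eq_integral => x _.
    rewrite patchE indicE; case: ifP => _; first by rewrite mulr1.
    by rewrite mulr0.
  rewrite -[RHS]fineK ?ge0_fin_numE//; congr EFin.
  rewrite -int_indic; last exact: measurableI.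
  transitivity (\int[(L \x L)%E]_z (B1 z.1 * (\1_A (z.1 + z.2) * B1 z.2))); last first.
    apply: eq_Rintegral => -[u v] _ /=; rewrite !indicE in_setI /D in_setX/=.
    have -> : ((u, v) \in phi @^-1` A) = (u + v \in A).
      by apply/idP/idP => /set_mem H; apply/mem_set.
    by do 3 case: (_ \in _); rewrite ?(mulr0, mul0r, mulr1).
  rewrite fub//.
  (* Here [x] stands for the sum and [y] for the first summand; once the integrals are exchanged,
     the substitution of [v + u] for [x] gives the product form. *)
  have [||||sw _ _ _] := @RB_fubini (fun z => B1 z.2 * (\1_A z.1 * B1 (z.1 - z.2))).
  - apply: measurable_funM; first exact: measurable_B1.
    apply: measurable_funM; first exact: (measurableT_comp m1A).
    by apply: measurable_B1; exact: measurable_rVB.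
  - exists (1 * (1 * 1)) => z; rewrite !normrM !ler_pM ?mulr_ge0 ?B1_norm//.
    by rewrite indicE; case: (_ \in _) => /=; rewrite ?normr1 ?normr0.
  - exists 2 => x y x2; rewrite /= !B1E; have := enorm_triangle x y => ?.
    have [y1|y1] := leP (enorm y) 1; last by rewrite mul0r.
    by rewrite [_ <= 1]leNgt (_ : 1 < _ = true) ?mulr0//; lra.
  - by exists 1 => x y /B1z /= ->; rewrite mul0r.
  transitivity (\int[L]_x \int[L]_y (B1 y * (\1_A x * B1 (x - y)))).
    apply: eq_Rintegral => x _; rewrite /Delta /conv mulrC -bfs_intZ; last exact/RB_bfs/RB_SE/RB_ball.
    by apply: eq_Rintegral => y _; rewrite mulrCA.
  have {}sw : \int[L]_x \int[L]_y (B1 y * (\1_A x * B1 (x - y))) =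
    \int[L]_y \int[L]_x (B1 y * (\1_A x * B1 (x - y))) by exact: sw.
  rewrite sw; apply: eq_Rintegral => u _.
  have RA : RB (fun x => \1_A x * B1 (x - u)).
    under eq_fun do rewrite mulrC.
    exact: (RBM (RB_shift (- u) (RB_ball 1)) m1A K1A).
  rewrite bfs_intZ; last exact: RB_bfs.
  have [mRA _ _] := RA; rewrite -(preserving_int (preserving_shift u) mRA).
  congr (_ * _); apply: eq_Rintegral => v _.
  by rewrite addrK (addrC v).
rewrite -fub//; last by exists K.
rewrite /Rintegral; congr fine.
have mgphi : measurable_fun setT (EFin \o g \o phi : _ -> \bar R).
  by apply: measurableT_comp => //; exact: measurableT_comp.
have intg : (mrestr (L \x L)%E mD).-integrable setT (EFin \o g \o phi).
  apply: (@measurable_bounded_integrable _ _ _ _ (g \o phi)) => //.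
  - by rewrite /= /mrestr setTI.
  - exact: measurableT_comp.
  - exists K; split; first by rewrite num_real.
    by move=> x Kx y _ /=; rewrite (le_trans (gK _))// ltW.
transitivity (\int[pushforward (mrestr (L \x L)%E mD) phi]_x (g x)%:E)%E.
  by apply: eq_measure_integral => // A mA _; exact: CD.
have mEg : measurable_fun setT (EFin \o g) by exact: measurableT_comp.
rewrite (integral_pushforward mphi mEg intg measurableT).
(* The restricted measure is carried by [D], so only the integral over [D] remains, where it is the
   product measure. *)
have nD : mrestr (L \x L)%E mD (~` D) = 0%E by rewrite /mrestr setICl measure0.
rewrite preimage_setT (negligible_integral (measurableC mD) measurableT intg nD).
rewrite setTD setCK; transitivity (\int[(L \x L)%E]_(z in D) (g (phi z))%:E)%E.
  by apply: eq_measure_integral => A mA AD; exact: (congr1 (L \x L)%E (setIidl AD)).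
rewrite [LHS]integral_mkcond; apply: eq_integral => -[u v] _.
rewrite patchE/= !indicE in_setX/=.
by do 2 case: (_ \in _); rewrite ?(mulr0, mul0r, mulr1, mul1r).
Qed.

End ball_averages.

(** * Plancherel's inequality *)

Section calculus.
Context {R : realType}.
Implicit Types (f F : R -> R) (x s t : R).

Lemma is_derive_sinL s t x :
  is_derive x (1 : R) (fun y : R => sin (y * s + t)) (s * cos (x * s + t)).
Proof.
have h : is_derive x (1 : R) (fun y : R => y * s + t) s.
  by apply: is_derive_eq; rewrite addr0 scaler0 add0r -[s *: _]/(s * _) mulr1.
have := @is_derive1_comp R sin (fun y => y * s + t) x _ _ (is_derive_sin _) h.
by rewrite mulrC.
Qed.

Lemma is_derive_cosL s t x :
  is_derive x (1 : R) (fun y : R => cos (y * s + t)) (- (s * sin (x * s + t))).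
Proof.
have h : is_derive x (1 : R) (fun y : R => y * s + t) s.
  by apply: is_derive_eq; rewrite addr0 scaler0 add0r -[s *: _]/(s * _) mulr1.
have := @is_derive1_comp R cos (fun y => y * s + t) x _ _ (is_derive_cos _) h.
by rewrite mulNr mulrC.
Qed.

Lemma is_derive_continuous f df : (forall x, is_derive x (1 : R) f (df x)) ->
  continuous f.
Proof.
move=> H x; apply: differentiable_continuous; apply/derivable1_diffP.
by have [] := H x.
Qed.

Lemma Rintegral_FTC f F a b : a < b -> (forall x, is_derive x (1 : R) F (f x)) ->
  continuous f -> \int[lebesgue_measure]_(x in `[a, b]) f x = F b - F a.
Proof.
move=> ab FE cf.
have cF := is_derive_continuous FE.
rewrite /Rintegral (@continuous_FTC2 _ _ F)//.
- exact: continuous_subspaceT.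
- split.
  + by move=> x _; have [] := FE x.
  + by apply: cvg_at_right_filter; exact: cF.
  + by apply: cvg_at_left_filter; exact: cF.
- by move=> x _; rewrite derive1E; have [_ ->] := FE x.
Qed.

Lemma sin_le x : 0 <= x -> sin x <= x.
Proof.
rewrite le_eqVlt => /predU1P[<-|x0]; first by rewrite sin0.
have [|c _ e] := @MVT R sin cos 0 x x0 (fun y _ => is_derive_sin y).
  by apply: continuous_subspaceT; exact: continuous_sin.
move: e; rewrite sin0 !subr0 => ->.
by rewrite -[leRHS]mul1r ler_wpM2r ?(ltW x0)// cos_le1.
Qed.

Lemma sin_norm_le x : `|sin x| <= `|x|.
Proof.
wlog x0 : x / 0 <= x.
  move=> H; have [|x0] := leP 0 x; first exact: H.
  by rewrite -normrN -sinN -(normrN x) H// oppr_ge0 ltW.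
have [x1|x1] := leP 1 x.
  by rewrite (le_trans (sin_max x))// ger0_norm.
rewrite !ger0_norm// ?sin_le// sin_ge0_pi// x0/=.
by have := @pi_ge2 R; lra.
Qed.

Lemma oneBcos x : 1 - cos x = 2 * sin (x / 2) ^+ 2.
Proof.
rewrite {1}(_ : x = (x / 2) *+ 2); last by rewrite -mulr_natr divfK.
by rewrite cos_mulr2n sin2cos2; ring.
Qed.

Lemma oneBcos_le x : 1 - cos x <= x ^+ 2 / 2.
Proof.
rewrite oneBcos; have := sin_norm_le (x / 2).
rewrite -ler_sqr ?nnegrE// !real_normK ?num_real// => H.
by rewrite (le_trans (ler_wpM2l _ H))//; rewrite le_eqVlt; apply/orP; left; apply/eqP; field.
Qed.

Lemma measurable_cosL d (T : measurableType d) (h : T -> R) :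
  measurable_fun setT h -> measurable_fun setT (fun w => cos (h w)).
Proof.
move=> mh; apply: (measurableT_comp (f := @cos R)) => //.
by apply: continuous_measurable_fun; exact: continuous_cos.
Qed.

End calculus.

(** * Triangle functions and the Fejer kernel in one variable *)

Section fejer.
Context {R : realType}.
Local Notation leb := (@lebesgue_measure R).
Implicit Types (s t T : R).

(* The triangle function of height [1] on [[-T, T]], except that its value at
   [0] is [2]. *)
Definition triangle T (x : R) : R :=
  (1 + x / T) * \1_`[- T, 0] x + (1 - x / T) * \1_`[0, T] x.

(** The Fejer kernel, up to normalisation. Its nonnegativity, which the transform of a sharp cutoff
    lacks, is what allows absolute bounds in [fejer_energy]. *)
Definition fejer T s : R := \int[leb]_x (triangle T x * cos (x * s)).

Let lin_itv (F : R -> R) a b : a < b -> continuous F ->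
  bfs leb (fun x => F x * \1_`[a, b] x).
Proof.
move=> ab cF; split.
- by apply: measurable_funM; [exact: continuous_measurable_fun|exact: measurable_indic].
- have [c _ Fc] := @EVT_max R (fun x => `|F x|) _ _ (ltW ab)
    (continuous_subspaceT (fun x => continuous_comp (cF x) (@norm_continuous _ _ _))).
  exists `|F c| => x; rewrite indicE; have [/set_mem/= xab|_] := boolP (x \in _).
    by rewrite mulr1 Fc.
  by rewrite mulr0 normr0.
- exists `[a, b]%classic; split => //.
    by rewrite /= lebesgue_measure_itv/= lte_fin ab -EFinB ltry.
  by move=> x xab; rewrite indicE memNset// mulr0.
Qed.

Let int_itv (F : R -> R) a b :
  \int[leb]_x (F x * \1_`[a, b] x) = \int[leb]_(x in `[a, b]) F x.
Proof.
rewrite [RHS]Rintegral_mkcond; apply: eq_Rintegral => x _.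
by rewrite patchE indicE; case: ifP => _; rewrite ?mulr1 ?mulr0.
Qed.

Lemma triangle_ge0 T x : 0 < T -> 0 <= triangle T x.
Proof.
move=> T0; apply: addr_ge0; rewrite indicE; have [/set_mem/=|_] := boolP (x \in _); rewrite ?mulr0// mulr1 in_itv/= => /andP[x1 x2].
  by rewrite -lerBlDl sub0r ler_pdivlMr// mulN1r.
by rewrite subr_ge0 ler_pdivrMr// mul1r.
Qed.

Lemma triangle_ge T x : 0 < T -> `|x| <= T / 2 -> 1 / 2 <= triangle T x.
Proof.
move=> T0; rewrite ler_norml => /andP[x1 x2].
have e0 : - T <= 0 by lra.
rewrite /triangle !indicE !mem_setE !in_itv/=.
have h1 : - (1 / 2) <= x / T by rewrite ler_pdivlMr//; lra.
have h2 : x / T <= 1 / 2 by rewrite ler_pdivrMr//; lra.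
have e1 : (- T <= x) = true by apply/idP; lra.
have e2 : (x <= T) = true by apply/idP; lra.
rewrite e1 e2 andbT/=; move: h1 h2; set u := x / T => h1 h2.
by case: (leP x 0) => x0; case: (leP 0 x) => x0' /=;
  rewrite ?mulr1 ?mulr0 ?addr0 ?add0r; clear -h1 h2 x0 x0'; lra.
Qed.

Lemma triangle_bfs T : 0 < T -> bfs leb (triangle T).
Proof.
move=> T0; apply: bfsD.
  apply: (lin_itv (F := fun x => 1 + x / T)); first lra.
  by move=> x; apply: cvgD; [exact: cvg_cst|exact: mulrr_continuous].
apply: (lin_itv (F := fun x => 1 - x / T)) => // x.
by apply: cvgB; [exact: cvg_cst|exact: mulrr_continuous].
Qed.

Lemma triangle_out T x : T < `|x| -> triangle T x = 0.
Proof.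
move=> xT; rewrite /triangle !indicE !mem_setE !in_itv/=.
have [x0|x0] := leP 0 x.
  rewrite ger0_norm// in xT; rewrite [x <= T]leNgt xT andbF mulr0 addr0.
  have [x1|x1] := leP x 0; last by rewrite andbF mulr0.
  have -> : x = 0 by lra.
  by rewrite leNgt (_ : 0 < - T) ?mulr0//; lra.
rewrite ltr0_norm// in xT; rewrite /= mulr0 addr0.
by rewrite [- T <= x]leNgt (_ : x < - T) ?mulr0//; lra.
Qed.

(** Apart from the point [0] the triangle is even, so the phase factors out as [cos t]; the integral
    itself comes from explicit primitives on both halves. *)
Lemma int_triangle_cos T s t : 0 < T -> s != 0 ->
  \int[leb]_x (triangle T x * cos (x * s + t)) =
  cos t * (2 * (1 - cos (T * s)) / (T * s ^+ 2)).
Proof.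
move=> T0 s0; have Tn : T != 0 by rewrite gt_eqF.
have cc : continuous (fun x : R => cos (x * s + t)).
  exact: (is_derive_continuous (fun x => is_derive_cosL s t x)).
have c1 : continuous (fun x : R => (1 + x / T) * cos (x * s + t)).
  move=> x; apply: cvgM; last exact: cc.
  by apply: cvgD; [exact: cvg_cst|exact: mulrr_continuous].
have c2 : continuous (fun x : R => (1 - x / T) * cos (x * s + t)).
  move=> x; apply: cvgM; last exact: cc.
  by apply: cvgB; [exact: cvg_cst|exact: mulrr_continuous].
transitivity (\int[leb]_x ((1 + x / T) * cos (x * s + t) * \1_`[- T, 0] x +
    (1 - x / T) * cos (x * s + t) * \1_`[0, T] x)).
  by apply: eq_Rintegral => x _; rewrite /triangle; ring.
rewrite bfs_intD; [|by apply: lin_itv => //; lra|exact: lin_itv].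
rewrite !int_itv.
pose F1 x := (1 + x / T) * (sin (x * s + t) / s) + cos (x * s + t) / (T * s ^+ 2).
pose F2 x := (1 - x / T) * (sin (x * s + t) / s) - cos (x * s + t) / (T * s ^+ 2).
have d1 x : is_derive x (1 : R) F1 ((1 + x / T) * cos (x * s + t)).
  have h1 := is_derive_sinL s t x; have h2 := is_derive_cosL s t x.
  rewrite /F1; apply: is_derive_eq; rewrite /GRing.scale/=; field.
  by rewrite Tn s0.
have d2 x : is_derive x (1 : R) F2 ((1 - x / T) * cos (x * s + t)).
  have h1 := is_derive_sinL s t x; have h2 := is_derive_cosL s t x.
  rewrite /F2; apply: is_derive_eq; rewrite /GRing.scale/=; field.
  by rewrite Tn s0.
have NT0 : - T < 0 by lra.
rewrite (Rintegral_FTC NT0 d1 c1) (Rintegral_FTC T0 d2 c2) /F1 /F2.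
rewrite !mul0r !add0r !mulNr !cosD !sinD !sinN !cosN; field.
by rewrite Tn s0.
Qed.

End fejer.

Section fejer_bounds.
Context {R : realType}.
Local Notation leb := (@lebesgue_measure R).
Implicit Types (s t T : R).

Lemma triangle_cos T s t : 0 < T ->
  \int[leb]_x (triangle T x * cos (x * s + t)) = cos t * fejer T s.
Proof.
move=> T0; have [->|s0] := eqVneq s 0.
  rewrite /fejer -(bfs_intZ (cos t)).
    by apply: eq_Rintegral => x _; rewrite !mulr0 add0r cos0 mulr1 mulrC.
  under eq_fun do rewrite mulr0 cos0 mulr1.
  exact: triangle_bfs.
rewrite int_triangle_cos// /fejer; congr (_ * _).
rewrite -[LHS]mul1r -[X in X * _](@cos0 R) -int_triangle_cos//.
by apply: eq_Rintegral => x _; rewrite addr0.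
Qed.

Lemma fejerE T s : 0 < T -> s != 0 ->
  fejer T s = 2 * (1 - cos (T * s)) / (T * s ^+ 2).
Proof.
move=> T0 s0; rewrite -[LHS]mul1r -[X in X * _](@cos0 R) -triangle_cos//.
by rewrite int_triangle_cos// cos0 mul1r.
Qed.

(** A bell dominating the Fejer kernel, with primitive [5 * atan (T * x)]: its mass is at most
    [5 * pi] whatever [T]. *)
Definition majorant T s : R := 5 * T / (1 + (T * s) ^+ 2).

Lemma one_sqr_gt0 (x : R) : 0 < 1 + x ^+ 2.
Proof. by have := sqr_ge0 x; lra. Qed.

Lemma fejer_bound T s : 0 < T -> 0 <= fejer T s <= majorant T s.
Proof.
move=> T0; have [->|s0] := eqVneq s 0.
  rewrite /fejer /majorant mulr0 expr0n addr0 divr1.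
  under eq_Rintegral do rewrite mulr0 cos0 mulr1.
  apply/andP; split; first by apply: bfs_int_ge0 => x; exact: triangle_ge0.
  have m1 : measurable (`[- T, T] : set R) by [].
  have v1 : leb `[- T, T]%classic = (T + T)%:E.
    by rewrite lebesgue_measure_itv/= lte_fin ifT -?EFinB ?opprK//; lra.
  have f1 : (leb `[(- T)%R, T]%classic < +oo)%E by rewrite v1 ltry.
  rewrite (@le_trans _ _ (\int[leb]_x (2 * \1_`[- T, T] x)))//.
    apply: bfs_int_le; first exact: triangle_bfs.
      by apply: bfsZ; exact: bfs_indic.
    move=> x; rewrite indicE; have [/set_mem/=|] := boolP (x \in _).
      rewrite in_itv/= => /andP[x1 x2]; rewrite mulr1 /triangle !indicE.
      have h1 : x / T <= 1 by rewrite ler_pdivrMr//; lra.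
      have h2 : - 1 <= x / T by rewrite ler_pdivlMr//; lra.
      have h3 : x <= 0 -> x / T <= 0 by move=> ?; rewrite ler_pdivrMr// mul0r.
      have h4 : 0 <= x -> 0 <= x / T by move=> ?; rewrite ler_pdivlMr// mul0r.
      rewrite !mem_setE !in_itv/= x1 x2 andbT; move: h1 h2 h3 h4; set u := x / T.
      move=> h1 h2 h3 h4.
      case: (leP x 0) => x0; case: (leP 0 x) => x0' /=; rewrite ?mulr1 ?mulr0 ?addr0 ?add0r.
      + by have := h3 x0; have := h4 x0'; lra.
      + by have := h3 x0; lra.
      + by have := h4 x0'; lra.
      + by lra.
    rewrite mem_setE in_itv/= -ler_norml -ltNge => /triangle_out ->.
    by rewrite mulr0.
  rewrite bfs_intZ; last exact: bfs_indic.
  by rewrite int_indic// [X in fine X]v1/=; lra.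
rewrite fejerE// /majorant; set u := T * s.
have Ts : T * s ^+ 2 = u ^+ 2 / T by rewrite /u; field; rewrite gt_eqF.
have u0 : 0 < u ^+ 2 by rewrite exprn_even_gt0//= mulf_neq0// gt_eqF.
have c1 := cos_geN1 u; have c2 := cos_le1 u; have c3 := oneBcos_le u.
rewrite Ts; apply/andP; split.
  have h0 : 0 < u ^+ 2 / T by rewrite divr_gt0.
  by rewrite divr_ge0 ?(ltW h0)// mulr_ge0// subr_ge0.
move: c1 c2 c3 u0; set c := cos u; set v := u ^+ 2 => c1 c2 c3 u0.
have -> : 2 * (1 - c) / (v / T) = T * (2 * (1 - c) / v) by field; rewrite !gt_eqF.
have -> : 5 * T / (1 + v) = T * (5 / (1 + v)) by field; rewrite gt_eqF//; lra.
rewrite ler_pM2l// ler_pdivrMr// mulrAC ler_pdivlMr; last by lra.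
(* [2 * (1 - c)] is at most [v] and at most [4]. Multiplied by [1 + v], the first bound stays below
   [5 * v] for [v <= 4] and the second one for [v >= 4], which is where the constant [5] comes
   from. *)
have [v4|v4] := leP v 4.
  have : (2 * (1 - c)) * (1 + v) <= v * 5 by rewrite ler_pM//; lra.
  by rewrite mulrC (mulrC _ 5).
have : (2 * (1 - c)) * (1 + v) <= 4 * (1 + v) by rewrite ler_wpM2r//; lra.
by lra.
Qed.

Lemma majorant_ge0 T s : 0 < T -> 0 <= majorant T s.
Proof. by move=> T0; rewrite divr_ge0 ?mulr_ge0 ?ltW ?one_sqr_gt0. Qed.

Lemma is_derive_5atan T x :
  is_derive x (1 : R) (fun y => 5 * atan (T * y)) (majorant T x).
Proof.
have h : is_derive x (1 : R) (fun y : R => T * y) T.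
  by apply: is_derive_eq; rewrite /GRing.scale/=; ring.
have := @is_derive1_comp R atan (fun y => T * y) x _ _ (is_derive1_atan _) h.
move=> h2; have h3 : is_derive x (1 : R) (fun y => atan (T * y)) _ := h2.
apply: is_derive_eq; rewrite /GRing.scale/= /majorant.
by field; rewrite gt_eqF// one_sqr_gt0.
Qed.

Lemma continuous_majorant T : continuous (majorant T).
Proof.
move=> x; apply: cvgM; first exact: cvg_cst.
apply: cvgV; first by rewrite gt_eqF// one_sqr_gt0.
apply: cvgD; first exact: cvg_cst.
by apply: (@cvg_comp _ _ _ _ (fun y => y ^+ 2)); [exact: mulrl_continuous|exact: exprn_continuous].
Qed.

Lemma majorant_bfs T (r : R) : 0 < T -> bfs leb (fun s => majorant T s * \1_`[- r, r] s).
Proof.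
move=> T0; split.
- by apply: measurable_funM => //; apply: continuous_measurable_fun; exact: continuous_majorant.
- exists (5 * T) => x; have h := majorant_ge0 x T0.
  have T50 : 0 <= 5 * T by rewrite mulr_ge0// ltW.
  have h1 : majorant T x <= 5 * T.
    rewrite /majorant ler_pdivrMr ?one_sqr_gt0// -[leLHS]mulr1 ler_wpM2l//.
    by rewrite lerDl sqr_ge0.
  by rewrite indicE; case: (_ \in _) => /=; rewrite ?mulr1 ?mulr0 ?normr0 ?ger0_norm.
- exists (`[(- r)%R, r]%classic : set R); split => //.
    by rewrite /= lebesgue_measure_itv; case: ifP => _ /=; rewrite -?EFinB ltry.
  by move=> x nx; rewrite indicE memNset// mulr0.
Qed.

Lemma int_majorant_le T (r : R) : 0 < T -> 0 < r ->
  \int[leb]_s (majorant T s * \1_`[- r, r] s) <= 5 * pi.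
Proof.
move=> T0 r0.
have -> : \int[leb]_s (majorant T s * \1_`[- r, r] s) =
    \int[leb]_(s in `[- r, r]) majorant T s.
  rewrite [RHS]Rintegral_mkcond; apply: eq_Rintegral => x _.
  by rewrite patchE indicE; case: ifP => _; rewrite ?mulr1 ?mulr0.
have Nr : - r < r by lra.
rewrite (Rintegral_FTC Nr (@is_derive_5atan T) (@continuous_majorant T)).
have := atan_ltpi2 (T * r); have := atan_gtNpi2 (T * - r); lra.
Qed.

End fejer_bounds.

(** * Integrals of products over the coordinates *)

Section product_functions.
Context {R : realType}.
Local Notation leb := (@lebesgue_measure R).

Lemma rV_RintegralS n (f : 'rV[R]_n.+1 -> R) : RB f ->
  \int[lebesgue_rV n.+1]_v f v =
  \int[leb]_x \int[lebesgue_rV n]_w f (rV_cons (x, w)).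
Proof.
move=> [mf [K fK] [r fr]].
pose F : measurableTypeR R * 'rV[R]_n -> R := f \o @rV_cons R n.
have mF : measurable_fun setT F by apply: measurableT_comp => //; exact: measurable_rV_cons.
have FK z : `|F z| <= K by exact: fK.
have rle (x : measurableTypeR R) (w : 'rV[R]_n) : `|x : R| <= enorm (rV_cons (x, w)).
  by rewrite (le_trans _ (coord_le_enorm _ ord0))// mxE unlift_none.
have rle2 (x : measurableTypeR R) (w : 'rV[R]_n) : enorm w <= enorm (rV_cons (x, w)).
  rewrite !enormE ler_sqrt ?dotvv_ge0// /dotv big_ord_recl.
  rewrite -[leLHS]add0r lerD// -?expr2 ?sqr_ge0//.
  by apply: ler_sum => i _; rewrite !mxE liftK.
have FA (x : measurableTypeR R) w : ~ `[- r, r]%classic (x : R) -> F (x, w) = 0.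
  move=> xr; apply: fr; rewrite (lt_le_trans _ (rle x w))// ltNge.
  by apply/negP => xr'; apply: xr; rewrite /= in_itv/= -ler_norml.
have FB (x : measurableTypeR R) w : ~ eball r w -> F (x, w) = 0.
  move=> xr; apply: fr; rewrite (lt_le_trans _ (rle2 x w))// ltNge.
  exact/negP.
have oo1 : (leb `[(- r)%R, r]%classic < +oo)%E.
  by rewrite /= lebesgue_measure_itv; case: ifP => _ /=; rewrite -?EFinB ltry.
have m1 : measurable (`[- r, r]%classic : set R) by [].
have bF := @bfs_prod _ _ _ _ _ leb (lebesgue_rV n) F _ _ K mF FK m1
  (measurable_eball r) oo1 (eball_finite r) FA FB.
transitivity (\int[(leb \x lebesgue_rV n)%E]_z F z); last first.
  exact: (@bfs_int_prod _ _ _ _ _ leb (lebesgue_rV n) F _ _ K mF FK m1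
    (measurable_eball r) oo1 (eball_finite r) FA FB).
rewrite /Rintegral; congr fine.
have mEf : measurable_fun setT (EFin \o f) by exact: measurableT_comp.
have := integral_pushforward (@measurable_rV_cons R n) (mu := (leb \x lebesgue_rV n)%E) mEf (D := setT).
by move=> ->//; exact: bfs_integrable bF.
Qed.

Definition prodv n (h : R -> R) (x : 'rV[R]_n) : R := \prod_(i < n) h (x ord0 i).

Lemma RB_prodv n h r : 0 <= r -> bfs leb h -> (forall x, r < `|x| -> h x = 0) ->
  RB (@prodv n h).
Proof.
move=> r0 [mh [K hK] _] hr; split.
- apply: measurable_prod => i _.
  exact: (measurableT_comp mh (measurable_coord i)).
- exists (K ^+ n) => x; rewrite normr_prod.
  rewrite (@le_trans _ _ (\prod_(i < n) K))//; last by rewrite prodr_const card_ord.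
  by apply: ler_prod => i _; rewrite normr_ge0 hK.
- exists (r *+ n) => x xr; apply/eqP/negPn/negP => px.
  have : eball (r *+ n) x.
    apply: cube_sub_eball => // i; rewrite /= in_itv/= -ler_norml leNgt.
    by apply/negP => /hr h0; move/negP: px; apply; rewrite /prodv (bigD1 i)//= h0 mul0r.
  by rewrite /eball/= leNgt xr.
Qed.

Lemma prodv_cons n h x (w : 'rV[R]_n) :
  prodv h (rV_cons (x, w)) = h x * prodv h w.
Proof.
rewrite /prodv big_ord_recl mxE unlift_none; congr (_ * _).
by apply: eq_bigr => i _; rewrite mxE liftK.
Qed.

Lemma dotv_cons n x y (v w : 'rV[R]_n) :
  dotv (rV_cons (x, v)) (rV_cons (y, w)) = (x : R) * (y : R) + dotv v w.
Proof.
rewrite /dotv big_ord_recl !mxE unlift_none; congr (_ + _).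
by apply: eq_bigr => i _; rewrite !mxE liftK.
Qed.

Lemma Rintegral_rV0 (f : 'rV[R]_0 -> R) : RB f -> \int[lebesgue_rV 0]_x f x = f 0.
Proof.
move=> [mf _ _]; have mEf : measurable_fun setT (EFin \o f) by exact: measurableT_comp.
by rewrite /Rintegral/= integral_dirac//= indicE mem_set// mul1r.
Qed.

Lemma int_prodv n h r : 0 <= r -> bfs leb h -> (forall x, r < `|x| -> h x = 0) ->
  \int[lebesgue_rV n]_x prodv h x = (\int[leb]_x h x) ^+ n.
Proof.
move=> r0 bh hr; elim: n => [|n IHn].
  by rewrite Rintegral_rV0 ?/prodv ?big_ord0//; exact: RB_prodv r0 bh hr.
rewrite rV_RintegralS; last exact: RB_prodv r0 bh hr.
have b := RB_bfs (@RB_prodv n _ _ r0 bh hr).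
under eq_Rintegral => x _.
  under eq_Rintegral do rewrite prodv_cons.
  rewrite (bfs_intZ _ b) IHn mulrC.
  over.
by rewrite (bfs_intZ _ bh) -exprSr.
Qed.

(** The phase [t] makes the induction work: while the other coordinates are integrated, the
    contribution of the first one is part of the phase. *)
Lemma int_triangle_dotv n T (s : 'rV[R]_n) t : 0 < T ->
  \int[lebesgue_rV n]_x (prodv (triangle T) x * cos (dotv x s + t)) =
  cos t * prodv (fejer T) s.
Proof.
move=> T0; elim: n s t => [|n IHn] s t.
  rewrite Rintegral_rV0.
    by rewrite /prodv /dotv !big_ord0 mul1r mulr1 add0r.
  apply: RBM; first exact: (RB_prodv _ (ltW T0) (triangle_bfs T0) (@triangle_out _ T)).
    apply: measurable_cosL; apply: measurable_funD => //.
    exact: measurable_fun_dotv.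
  by exists 1 => x; exact: cos_max.
have RW k (v : 'rV[R]_k) u : RB (fun x => prodv (triangle T) x * cos (dotv x v + u)).
  apply: RBM; first exact: (RB_prodv _ (ltW T0) (triangle_bfs T0) (@triangle_out _ T)).
    apply: measurable_cosL; apply: measurable_funD => //.
    exact: measurable_fun_dotv.
  by exists 1 => x; exact: cos_max.
have [s0 [s' ->]] : exists s0, exists s', s = rV_cons (s0, s').
  exists (s ord0 ord0), (\row_j s ord0 (lift ord0 j)); apply/rowP => i.
  by rewrite mxE; case: unliftP => [j ->|->]//=; rewrite mxE.
rewrite rV_RintegralS// prodv_cons.
under eq_Rintegral => x _.
  under eq_Rintegral => w _.
    rewrite prodv_cons dotv_cons -mulrA addrAC addrC.
    over.
  rewrite (bfs_intZ _ (RB_bfs (RW _ _ _))) IHn mulrA mulrC.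
  over.
rewrite bfs_intZ; last first.
  apply: bfsM; first exact: triangle_bfs.
    apply: measurable_cosL; apply: measurable_funD => //.
    exact: measurable_funM.
  by exists 1 => x; exact: cos_max.
by rewrite triangle_cos//; ring.
Qed.

End product_functions.

Section plancherel.
Context {R : realType} {n : nat}.
Local Notation L := (@lebesgue_rV R n).
Local Notation E := 'rV[R]_n.
Implicit Types (U V G : E -> R).

Lemma kernel_fubini U V (k : E * E -> R) : RB U -> RB V ->
  measurable_fun setT k -> (exists K : R, forall w, `|k w| <= K) ->
  [/\ \int[L]_x (U x * \int[L]_y (V y * k (x, y))) =
      \int[L]_y (V y * \int[L]_x (U x * k (x, y))),
    RB (fun x => U x * \int[L]_y (V y * k (x, y))) &
    RB (fun y => V y * \int[L]_x (U x * k (x, y)))].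
Proof.
move=> RU RV mk [K kK]; have [mU [Ku UK] [ru Ur]] := RU.
have [mV [Kv VK] [rv Vr]] := RV.
have bk1 x : bfs L (fun y => V y * k (x, y)).
  apply/RB_bfs/RBM => //; last by exists K.
  by apply: (measurableT_comp mk); exact: measurable_pair1.
have bk2 y : bfs L (fun x => U x * k (x, y)).
  apply/RB_bfs/RBM => //; last by exists K.
  by apply: (measurableT_comp mk); exact: measurable_pair2.
have [||||sw R1 R2 _] := @RB_fubini R n (fun w => U w.1 * (V w.2 * k w)).
- apply: measurable_funM; first exact: (measurableT_comp mU).
  by apply: measurable_funM => //; exact: (measurableT_comp mV).
- exists (Ku * (Kv * K)) => w; rewrite !normrM.
  by apply: ler_pM; rewrite ?mulr_ge0// ler_pM.
- by exists ru => x y /Ur /= ->; rewrite mul0r.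
- by exists rv => x y /Vr /= ->; rewrite mul0r mulr0.
have e1 x : \int[L]_y (U x * (V y * k (x, y))) = U x * \int[L]_y (V y * k (x, y)).
  exact: bfs_intZ (bk1 x).
have e2 y : \int[L]_x (U x * (V y * k (x, y))) = V y * \int[L]_x (U x * k (x, y)).
  rewrite -(bfs_intZ _ (bk2 y)); apply: eq_Rintegral => x _.
  by rewrite mulrCA.
split.
- transitivity (\int[L]_x \int[L]_y (U x * (V y * k (x, y)))).
    by apply: eq_Rintegral => x _; rewrite e1.
  transitivity (\int[L]_y \int[L]_x (U x * (V y * k (x, y)))); first exact: sw.
  by apply: eq_Rintegral => y _; rewrite e2.
- by move: R1; congr RB; apply/funext => x; exact: e1.
- by move: R2; congr RB; apply/funext => y; exact: e2.
Qed.

(** Expands the square of a transform into a double integral over frequencies, for [cos] and [sin]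
    alike. Added together, the two kernels become a function of [z - y]. *)
Lemma trig_quad U G (c : R -> R) : RB U -> RB G -> measurable_fun setT c ->
  (forall x, `|c x| <= 1) ->
  let Q y := \int[L]_z (G z * \int[L]_x (U x * (c (dotv x z) * c (dotv x y)))) in
  [/\ \int[L]_x (U x * (\int[L]_y (G y * c (dotv x y))) ^+ 2) =
      \int[L]_y (G y * Q y),
    RB (fun x => U x * (\int[L]_y (G y * c (dotv x y))) ^+ 2),
    RB (fun y => G y * Q y) &
    forall y, RB (fun z => G z * \int[L]_x (U x * (c (dotv x z) * c (dotv x y))))].
Proof.
move=> RU RG mc c1 Q.
have mk1 : measurable_fun setT (fun w : E * E => c (dotv w.1 w.2)).
  by apply: (measurableT_comp mc); exact: measurable_fun_dotv.
have k1 : exists K : R, forall w : E * E, `|c (dotv w.1 w.2)| <= K by exists 1.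
pose A x := \int[L]_y (G y * c (dotv x y)).
have [_ RUA _] := kernel_fubini RU RG mk1 k1.
have [s1 R1 R1'] := kernel_fubini RUA RG mk1 k1.
have step2 y : \int[L]_x (U x * A x * c (dotv x y)) = Q y /\
    RB (fun z => G z * \int[L]_x (U x * (c (dotv x z) * c (dotv x y)))).
  have mk2 : measurable_fun setT (fun w : E * E => c (dotv w.1 w.2) * c (dotv w.1 y)).
    apply: (measurable_funM mk1).
    by apply: (measurableT_comp mc); exact: measurable_fun_dotv.
  have k2 : exists K : R, forall w : E * E, `|c (dotv w.1 w.2) * c (dotv w.1 y)| <= K.
    by exists (1 * 1) => w; rewrite normrM ler_pM.
  have [s2 _ R2] := kernel_fubini RU RG mk2 k2.
  split; last exact: R2.
  rewrite /Q; transitivity (\int[L]_x (U x * \int[L]_z (G z * (c (dotv x z) * c (dotv x y))))); last exact: s2.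
  apply: eq_Rintegral => x _; rewrite -mulrA; congr (_ * _); rewrite /A mulrC.
  have b : bfs L (fun z => G z * c (dotv x z)).
    apply/RB_bfs/(RBM RG); last by exists 1.
    by apply: (measurableT_comp mc); exact: measurable_fun_dotv.
  by rewrite -(bfs_intZ _ b); apply: eq_Rintegral => z _; ring.
have e1 x : U x * A x ^+ 2 = U x * A x * A x by rewrite expr2 mulrA.
split.
- transitivity (\int[L]_x (U x * A x * A x)); first by apply: eq_Rintegral => x _; exact: e1.
  transitivity (\int[L]_y (G y * \int[L]_x (U x * A x * c (dotv x y)))); first exact: s1.
  by apply: eq_Rintegral => y _; rewrite (step2 y).1.
- by move: R1; congr RB; apply/funext => x; rewrite -/(A x) -e1.
- by move: R1'; congr RB; apply/funext => y; rewrite -(step2 y).1.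
- by move=> y; exact: (step2 y).2.
Qed.

Lemma amgm2 (u v : R) : u * v <= 2^-1 * (u ^+ 2 + v ^+ 2).
Proof. by have := sqr_ge0 (u - v); rewrite sqrrB -mulr_natr; lra. Qed.

Lemma measurable_sin' : measurable_fun setT (@sin R).
Proof. by apply: continuous_measurable_fun; exact: continuous_sin. Qed.

Lemma measurable_cos' : measurable_fun setT (@cos R).
Proof. by apply: continuous_measurable_fun; exact: continuous_cos. Qed.

Lemma RB_triangle T : 0 < T -> RB (@prodv R n (triangle T)).
Proof.
by move=> T0; exact: (RB_prodv _ (ltW T0) (triangle_bfs T0) (@triangle_out _ T)).
Qed.

(** The kernel of the quadratic form in [G] is the product of Fejer kernels at [z - y]. By Schur's
    test the form is bounded by the mass of a majorant, which does not depend on [T]. *)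
Lemma fejer_energy T G : 0 < T -> RB G ->
  \int[L]_x (prodv (triangle T) x * ((\int[L]_y (G y * cos (dotv x y))) ^+ 2 +
     (\int[L]_y (G y * sin (dotv x y))) ^+ 2)) <=
  (5 * pi) ^+ n * \int[L]_y (G y ^+ 2).
Proof.
move=> T0 RG; have RW := RB_triangle T0.
set W := prodv (triangle T) in RW *.
have [c1 cR1 cR2 cR3] := trig_quad RW RG measurable_cos' (@cos_max R).
have [s1 sR1 sR2 sR3] := trig_quad RW RG measurable_sin' (@sin_max R).
have RWcc (c : R -> R) y z : measurable_fun setT c -> (forall x, `|c x| <= 1) ->
    RB (fun x => W x * (c (dotv x z) * c (dotv x y))).
  move=> mc cK; apply: RBM => //; last by exists (1 * 1) => x; rewrite normrM ler_pM.
  by apply: measurable_funM; apply: (measurableT_comp mc); exact: measurable_fun_dotv.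
have KE y z : \int[L]_x (W x * (cos (dotv x z) * cos (dotv x y))) +
    \int[L]_x (W x * (sin (dotv x z) * sin (dotv x y))) = prodv (fejer T) (z - y).
  have bc := RB_bfs (RWcc _ y z measurable_cos' (@cos_max R)).
  have bs := RB_bfs (RWcc _ y z measurable_sin' (@sin_max R)).
  rewrite -(bfs_intD bc bs).
  rewrite -[RHS]mul1r -[X in X * _](@cos0 R) -(int_triangle_dotv _ _ T0).
  by apply: eq_Rintegral => x _; rewrite addr0 dotvBr cosB -/W; ring.
set A := fun x => \int[L]_y (G y * cos (dotv x y)) in c1 cR1 *.
set B := fun x => \int[L]_y (G y * sin (dotv x y)) in s1 sR1 *.
have -> : \int[L]_x (W x * (A x ^+ 2 + B x ^+ 2)) =
    \int[L]_x (W x * A x ^+ 2) + \int[L]_x (W x * B x ^+ 2).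
  rewrite -(bfs_intD (RB_bfs cR1) (RB_bfs sR1)).
  by apply: eq_Rintegral => x _; rewrite mulrDr.
rewrite c1 s1 -(bfs_intD (RB_bfs cR2) (RB_bfs sR2)).
have RGK y : RB (fun z => G z * prodv (fejer T) (z - y)).
  by move: (RBD (cR3 y) (sR3 y)); congr RB; apply/funext => z; rewrite -mulrDr KE.
have QE y : G y * (\int[L]_z (G z * \int[L]_x (W x * (cos (dotv x z) * cos (dotv x y))))) +
   G y * (\int[L]_z (G z * \int[L]_x (W x * (sin (dotv x z) * sin (dotv x y))))) =
   G y * \int[L]_z (G z * prodv (fejer T) (z - y)).
  rewrite -mulrDr -(bfs_intD (RB_bfs (cR3 y)) (RB_bfs (sR3 y))); congr (_ * _).
  by apply: eq_Rintegral => z _; rewrite -mulrDr KE.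
have RY : RB (fun y => G y * \int[L]_z (G z * prodv (fejer T) (z - y))).
  by move: (RBD cR2 sR2); congr RB; apply/funext => y; rewrite -QE.
rewrite (_ : \int[L]_x _ = \int[L]_y (G y * \int[L]_z (G z * prodv (fejer T) (z - y)))); last first.
  by apply: eq_Rintegral => y _; exact: QE.
clear c1 cR1 cR2 cR3 s1 sR1 sR2 sR3 RWcc KE QE A B.
have [mG [K GK] [r' Gr']] := RG.
pose r := Num.max r' 1.
have r0 : 0 < r by rewrite lt_max ltr01 orbT.
have Gr x : r < enorm x -> G x = 0.
  by move=> rx; apply: Gr'; rewrite (le_lt_trans _ rx)// le_max lexx.
have r20 : 0 < r * 2 by rewrite mulr_gt0.
(* Two points of the support of [G] have coordinates at most [2 * r] apart, so the majorant may be
   cut there, which puts the product [D] in the class [RB]. *)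
pose h s : R := majorant T s * \1_`[- (r * 2), r * 2] s.
have bh : bfs (@lebesgue_measure R) h by exact: majorant_bfs.
have hr x : r * 2 < `|x| -> h x = 0.
  move=> xr; rewrite /h indicE memNset ?mulr0//= in_itv/= -ler_norml.
  by apply/negP; rewrite -ltNge.
have RD : RB (@prodv R n h) := RB_prodv n (ltW r20) bh hr.
set D := prodv h in RD.
have D0 x : 0 <= D x.
  by apply: prodr_ge0 => i _; rewrite /h mulr_ge0 ?majorant_ge0// indicE.
have ID : \int[L]_x D x <= (5 * pi) ^+ n.
  rewrite (int_prodv _ (ltW r20) bh hr).
  apply: lerXn2r; rewrite ?nnegrE ?mulr_ge0 ?pi_ge0//.
    by apply: bfs_int_ge0 => x; rewrite /h mulr_ge0 ?majorant_ge0// indicE.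
  exact: int_majorant_le.
have IDy y : \int[L]_z D (z - y) = \int[L]_z D z.
  by have [mD _ _] := RD; rewrite (preserving_int (preserving_shift (- y)) mD).
have IDz z : \int[L]_y D (z - y) = \int[L]_z D z.
  by have [mD _ _] := RD; rewrite (preserving_int (preserving_subl z) mD).
have RDy y : RB (fun z => D (z - y)) := RB_shift (- y) RD.
have FD y z : G y != 0 -> G z != 0 -> 0 <= prodv (fejer T) (z - y) <= D (z - y).
  move=> Gy Gz; have yr : enorm y <= r by rewrite leNgt; apply: contra Gy => /Gr ->.
  have zr : enorm z <= r by rewrite leNgt; apply: contra Gz => /Gr ->.
  apply/andP; split.
    by apply: prodr_ge0 => i _; have /andP[] := fejer_bound ((z - y) ord0 i) T0.
  apply: ler_prod => i _; have /andP[-> f2] := fejer_bound ((z - y) ord0 i) T0.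
  rewrite /h indicE mem_set ?mulr1//= in_itv/= -ler_norml.
  by rewrite (le_trans (coord_le_enorm _ _))// (le_trans (enormB _ _))//; lra.
have RG2 := RB_sqr RG.
have [mD [KD DK] _] := RD.
have mk : measurable_fun setT (fun w : E * E => D (w.2 - w.1)).
  by apply: (measurableT_comp mD); exact: measurable_rVB.
have kb : exists K : R, forall w : E * E, `|D (w.2 - w.1)| <= K by exists KD.
have [sw RU1 RU2] := kernel_fubini (RB_ball r) RG2 mk kb.
have half0 : 0 <= 2^-1 :> R by rewrite invr_ge0.
have in0 (y : E) : 0 <= (\1_(eball r) y : R) by rewrite indicE.
have pos1 (y z : E) : 0 <= 2^-1 * (G y ^+ 2 * D (z - y)).
  by apply: (mulr_ge0 half0); apply: mulr_ge0 (D0 _); exact: sqr_ge0.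
have pos2 (y z : E) : 0 <= 2^-1 * (\1_(eball r) y * (G z ^+ 2 * D (z - y))).
  apply: (mulr_ge0 half0); apply: (mulr_ge0 (in0 y)); apply: mulr_ge0 (D0 _).
  exact: sqr_ge0.
(* [G y * G z] is split by the inequality between means. The indicator is kept in the second term so
   that [kernel_fubini], which asks for bounded support in each variable, applies to it. *)
have pt (y z : E) : G y * (G z * prodv (fejer T) (z - y)) <=
    2^-1 * (G y ^+ 2 * D (z - y)) + 2^-1 * (\1_(eball r) y * (G z ^+ 2 * D (z - y))).
  have [->|Gy] := eqVneq (G y) 0.
    by rewrite mul0r expr0n mul0r mulr0 add0r; exact: pos2.
  have [->|Gz] := eqVneq (G z) 0.
    by rewrite mul0r mulr0 expr0n mul0r !mulr0 addr0; exact: pos1.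
  rewrite indicE mem_set ?mul1r; last first.
    by rewrite /eball/= leNgt; apply: contra Gy => /Gr ->.
  have /andP[k0 kD] := FD y z Gy Gz; rewrite mulrA -mulrDr -mulrDl mulrA.
  apply: (@le_trans _ _ (2^-1 * (G y ^+ 2 + G z ^+ 2) * prodv (fejer T) (z - y))).
    exact: ler_wpM2r k0 _ _ (amgm2 _ _).
  apply: ler_wpM2l kD; apply: (mulr_ge0 half0).
  exact: addr_ge0 (sqr_ge0 _) (sqr_ge0 _).
have RGz y : RB (fun z => G z ^+ 2 * D (z - y)).
  apply: (RBM RG2); last by exists KD.
  by apply: (measurableT_comp mD); exact: measurable_rVB.
have bound y : G y * \int[L]_z (G z * prodv (fejer T) (z - y)) <=
    2^-1 * (G y ^+ 2 * \int[L]_z D z) +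
    2^-1 * (\1_(eball r) y * \int[L]_z (G z ^+ 2 * D (z - y))).
  rewrite -(bfs_intZ _ (RB_bfs (RGK y))).
  apply: (le_trans (bfs_int_le _ _ (pt y))).
  - exact/RB_bfs/RBZ.
  - by apply/RB_bfs/RBD; apply/RBZ/RBZ.
  rewrite (bfs_intD (RB_bfs (RBZ _ (RBZ _ (RDy y)))) (RB_bfs (RBZ _ (RBZ _ (RGz y))))).
  rewrite (bfs_intZ _ (RB_bfs (RBZ _ (RDy y)))) (bfs_intZ _ (RB_bfs (RDy y))) IDy.
  by rewrite (bfs_intZ _ (RB_bfs (RBZ _ (RGz y)))) (bfs_intZ _ (RB_bfs (RGz y))).
have RH1 : RB (fun y => G y ^+ 2 * \int[L]_z D z).
  by under eq_fun do rewrite mulrC; exact: RBZ.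
apply: (le_trans (bfs_int_le (RB_bfs RY) _ bound)).
  exact: (RB_bfs (RBD (RBZ _ RH1) (RBZ _ RU1))).
rewrite (bfs_intD (RB_bfs (RBZ _ RH1)) (RB_bfs (RBZ _ RU1))).
rewrite (bfs_intZ _ (RB_bfs RH1)) (bfs_intZ _ (RB_bfs RU1)).
have I2 : 0 <= \int[L]_y G y ^+ 2 by apply: bfs_int_ge0 => x; exact: sqr_ge0.
have e1 : \int[L]_y (G y ^+ 2 * \int[L]_z D z) <= (5 * pi) ^+ n * \int[L]_y (G y ^+ 2).
  under eq_Rintegral do rewrite mulrC.
  by rewrite (bfs_intZ _ (RB_bfs RG2)) ler_wpM2r.
have e2 : \int[L]_y (\1_(eball r) y * \int[L]_z (G z ^+ 2 * D (z - y))) <=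
    (5 * pi) ^+ n * \int[L]_y (G y ^+ 2).
  rewrite sw; apply: le_trans e1; apply: bfs_int_le; [exact: RB_bfs|exact: RB_bfs|].
  move=> z.
  suff : \int[L]_y (\1_(eball r) y * D (z - y)) <= \int[L]_y D y.
    by move=> H; exact: (ler_wpM2l (sqr_ge0 (G z)) H).
  rewrite -(IDz z).
  have RDz : RB (fun y => D (z - y)).
    have [m b s] := RDy z; split.
    - by apply: (measurableT_comp mD); exact: measurable_rVB.
    - by exists KD.
    - have [_ _ [q Dq]] := RD; exists (q + enorm z) => y yq; apply: Dq.
      rewrite -(ltrD2r (enorm z)) enorm_distC.
      exact: lt_le_trans yq (enorm_triangle y z).
  apply: bfs_int_le; [|exact: RB_bfs|].
    apply/RB_bfs/RBM; [exact: RB_ball| |by exists KD].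
    by apply: (measurableT_comp mD); exact: measurable_rVB.
  move=> y; rewrite -[leRHS]mul1r; apply: ler_wpM2r; first exact: D0.
  by rewrite indicE; case: (_ \in _).
move: e1 e2; set u := \int[L]_y _; set v := \int[L]_y _; set w := _ * _.
by clear; lra.
Qed.

(** With [T = r * 2] each factor of the triangle weight is at least [1 / 2] on the ball, hence a
    factor [2 ^+ n] and the constant [10 = 2 * 5]. The phase costs nothing: [cos t * A - sin t * B]
    is one component of a rotated vector. *)
Lemma plancherel_le r t G : 0 < r -> RB G ->
  \int[L]_x (\1_(eball r) x * (\int[L]_y (G y * cos (dotv x y + t))) ^+ 2) <=
  (10 * pi) ^+ n * \int[L]_y (G y ^+ 2).
Proof.
move=> r0 RG; have T0 : 0 < r * 2 by rewrite mulr_gt0.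
have RW := RB_triangle T0; have FE := fejer_energy T0 RG.
have [_ cR1 _ _] := trig_quad RW RG measurable_cos' (@cos_max R).
have [_ sR1 _ _] := trig_quad RW RG measurable_sin' (@sin_max R).
set A := fun x => \int[L]_y (G y * cos (dotv x y)) in cR1 FE *.
set B := fun x => \int[L]_y (G y * sin (dotv x y)) in sR1 FE *.
set W := prodv (triangle (r * 2)) in RW cR1 sR1 FE.
have RGc (c : R -> R) x : measurable_fun setT c -> (forall x, `|c x| <= 1) ->
    RB (fun y => G y * c (dotv x y)).
  move=> mc cK; apply: RBM => //; last by exists 1.
  by apply: (measurableT_comp mc); exact: measurable_fun_dotv.
have AB x : \int[L]_y (G y * cos (dotv x y + t)) = cos t * A x - sin t * B x.
  have b1 := RB_bfs (RGc _ x measurable_cos' (@cos_max R)).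
  have b2 := RB_bfs (RGc _ x measurable_sin' (@sin_max R)).
  rewrite -(bfs_intZ _ b1) -(bfs_intZ _ b2) -(bfs_intB (bfsZ _ b1) (bfsZ _ b2)).
  by apply: eq_Rintegral => y _; rewrite cosD; ring.
have RWAB : RB (fun x => W x * (A x ^+ 2 + B x ^+ 2)).
  by move: (RBD cR1 sR1); congr RB; apply/funext => x; rewrite mulrDr.
have mk : measurable_fun setT (fun w : E * E => cos (dotv w.1 w.2 + t)).
  apply: measurable_cosL; apply: measurable_funD => //.
  exact: measurable_fun_dotv.
have kb : exists K : R, forall w : E * E, `|cos (dotv w.1 w.2 + t)| <= K.
  by exists 1 => w; exact: cos_max.
have [_ R1 _] := kernel_fubini (RB_ball r) RG mk kb.
have Rl : RB (fun x => \1_(eball r) x * (\int[L]_y (G y * cos (dotv x y + t))) ^+ 2).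
  have := RB_sqr R1; congr RB; apply/funext => x /=; rewrite exprMn; congr (_ * _).
  by rewrite indicE; case: (_ \in _); rewrite ?expr1n ?expr0n.
apply: (@le_trans _ _ (\int[L]_x (2 ^+ n * (W x * (A x ^+ 2 + B x ^+ 2))))).
  apply: bfs_int_le; [exact: RB_bfs|exact/RB_bfs/RBZ|] => x.
  rewrite mulrA; apply: ler_pM; [by rewrite indicE|exact: sqr_ge0| |].
    have W0 : 0 <= W x by apply: prodr_ge0 => i _; exact: triangle_ge0.
    rewrite indicE; have [/set_mem xr|_] := boolP (x \in _); last first.
      by rewrite mulr_ge0// exprn_ge0.
    rewrite -[2 ^+ n](_ : \prod_(i < n) 2 = _); last by rewrite prodr_const card_ord.
    rewrite /W /prodv -big_split/=.
    rewrite (@le_trans _ _ (\prod_(i < n) 1))//; first by rewrite big1_eq.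
    apply: ler_prod => i _; rewrite ler01/= -ler_pdivrMl// mulrC.
    apply: triangle_ge => //; rewrite mulfK ?pnatr_eq0//.
    exact: le_trans (coord_le_enorm _ _) xr.
  rewrite AB -subr_ge0.
  rewrite (_ : _ - _ = (sin t * A x + cos t * B x) ^+ 2) ?sqr_ge0//.
  have := cos2Dsin2 t; set c := cos t; set s := sin t => H.
  have -> : A x ^+ 2 + B x ^+ 2 = (c ^+ 2 + s ^+ 2) * (A x ^+ 2 + B x ^+ 2).
    by rewrite H mul1r.
  ring.
rewrite (bfs_intZ _ (RB_bfs RWAB)).
have -> : (10 : R) * pi = 2 * (5 * pi) by ring.
by rewrite exprMn -mulrA ler_wpM2l// exprn_ge0.
Qed.

End plancherel.

(** * Zeros of the Fourier transform of the ball *)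

Section quadratic_derivative.
Context {R : realType}.

(** A quadratic bound on the remainder survives integration, so this criterion gives differentiation
    under the integral sign without any limit theorem. *)
Lemma is_derive_quad (f : R -> R) (x d K : R) :
  (forall h, `|f (x + h) - f x - h * d| <= K * h ^+ 2) ->
  is_derive x (1 : R) f d.
Proof.
move=> fK.
have cv : h^-1 *: ((f \o shift x) (h *: (1 : R)) - f x) @[h --> 0^'] --> d.
  apply/cvgrPdist_le => /= e e0; near=> h.
  have h0 : h != 0 by near: h; exact: nbhs_dnbhs_neq.
  have hK : `|h| * (`|K| + 1) <= e.
    rewrite -ler_pdivlMr; last by rewrite ltr_wpDl.
    near: h; apply: dnbhs0_le.
    by rewrite divr_gt0// ltr_wpDl.
  rewrite /= -[h *: 1]/(h * 1) mulr1 (addrC h).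
  have -> : d - h^-1 *: (f (x + h) - f x) = - (h^-1 * (f (x + h) - f x - h * d)).
    by rewrite /GRing.scale/=; field.
  rewrite normrN normrM normfV ler_pdivrMl ?normr_gt0//.
  rewrite (le_trans (fK h))// mulrC -real_normK ?num_real// expr2 -mulrA.
  rewrite ler_wpM2l// (le_trans _ hK)// ler_wpM2l//.
  by rewrite (le_trans (ler_norm K))// lerDl.
apply: DeriveDef; first by apply/cvg_ex; exists d.
exact: cvg_lim.
Unshelve. all: by end_near. Qed.

Lemma cos_norm_lip (x y : R) : `|cos x - cos y| <= `|x - y|.
Proof.
have key (u v : R) : cos (u + v) - cos (u - v) = - 2 * sin u * sin v.
  by rewrite cosD cosB; ring.
have e : cos x - cos y = - 2 * sin ((x + y) / 2) * sin ((x - y) / 2).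
  by rewrite -key; congr (cos _ - cos _); field.
rewrite e !normrM normrN.
have -> : `|x - y| = 2 * 1 * `|(x - y) / 2|.
  by rewrite normrM (ger0_norm (x := 2^-1))//; field.
apply: ler_pM; rewrite ?mulr_ge0//; last exact: sin_norm_le.
by rewrite normr_nat ler_wpM2l// sin_max.
Qed.

Lemma sin_quad (h : R) : `|sin h - h| <= h ^+ 2.
Proof.
wlog h0 : h / 0 <= h.
  move=> H; have [|h0] := leP 0 h; first exact: H.
  have := H (- h); rewrite oppr_ge0 (ltW h0) sinN sqrrN => /(_ isT).
  by rewrite -opprD normrN.
have df x : is_derive x (1 : R) (fun y => sin y - y) (cos x - 1).
  exact: is_deriveB.
have cf := is_derive_continuous df.
have [c] := MVT_segment h0 (fun x _ => df x) (continuous_subspaceT cf).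
rewrite in_itv/= => /andP[c0 ch]; rewrite sin0 !subr0 => ->.
rewrite normrM (ger0_norm h0) expr2 ler_wpM2r//.
have := cos_norm_lip c 0; rewrite cos0 subr0 => /le_trans; apply.
by rewrite ger0_norm.
Qed.

Lemma cos_quad (a h : R) : `|cos (a + h) - cos a - h * (- sin a)| <= 2 * h ^+ 2.
Proof.
have -> : cos (a + h) - cos a - h * (- sin a) =
    cos a * (cos h - 1) - sin a * (sin h - h) by rewrite cosD; ring.
rewrite (le_trans (ler_normB _ _))// !normrM mulr_natl mulr2n lerD//.
  rewrite -[leRHS]mul1r ler_pM ?cos_max// distrC ger0_norm ?subr_ge0 ?cos_le1//.
  by rewrite (le_trans (oneBcos_le h))//; have := sqr_ge0 h; lra.
by rewrite -[leRHS]mul1r ler_pM ?sin_max// sin_quad.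
Qed.

End quadratic_derivative.

Section trig_integral.
Context {R : realType}.
Local Notation leb := (@lebesgue_measure R).
Variable g : R -> R.
Hypothesis bg : bfs leb g.
Hypothesis g1 : forall x, 1 < `|x| -> g x = 0.

(* A shift of the phase by [pi / 2] lets all derivatives be of the same form. *)
Definition trig_int j (t : R) (l : R) : R :=
  \int[leb]_x (g x * x ^+ j * cos (l * x + t)).

Lemma gj_bfs j : bfs leb (fun x => g x * x ^+ j).
Proof.
have [mg [K gK] [A [mA Aoo gA]]] := bg; split.
- by apply: measurable_funM => //; exact: measurable_funX.
- exists K => x; have [x1|x1] := leP `|x| 1.
    by rewrite normrM -[leRHS]mulr1 ler_pM// normrX exprn_ile1.
  by rewrite g1// mul0r normr0 (le_trans _ (gK x)).
- by exists A; split => // x /gA ->; rewrite mul0r.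
Qed.

Lemma trig_bfs j t l : bfs leb (fun x => g x * x ^+ j * cos (l * x + t)).
Proof.
apply: bfsM; first exact: gj_bfs; last by exists 1 => x; exact: cos_max.
by apply: measurable_cosL; apply: measurable_funD => //; exact: measurable_funM.
Qed.

Lemma is_derive_trig_int j t l :
  is_derive l (1 : R) (trig_int j t) (trig_int j.+1 (t + pi / 2) l).
Proof.
apply: (@is_derive_quad _ _ _ _ (2 * \int[leb]_x `|g x|)) => h.
have [b1 b2 b3] := And3 (trig_bfs j t (l + h)) (trig_bfs j t l)
  (trig_bfs j.+1 (t + pi / 2) l).
rewrite /trig_int -(bfs_intB b1 b2) -(bfs_intZ h b3).
rewrite -(bfs_intB (bfsB b1 b2) (bfsZ h b3)).
apply: (le_trans (bfs_int_norm (bfsB (bfsB b1 b2) (bfsZ h b3)))).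
have bn := bfs_norm bg.
have -> : 2 * \int[leb]_x `|g x| * h ^+ 2 = \int[leb]_x (2 * h ^+ 2 * `|g x|).
  by rewrite (bfs_intZ _ bn); ring.
apply: bfs_int_le; [exact: bfs_norm (bfsB (bfsB b1 b2) (bfsZ h b3))|exact: bfsZ|].
move=> x; have [x1|x1] := leP `|x| 1; last first.
  by rewrite !g1//; rewrite !mul0r mulr0 !subrr normr0 mulr0.
rewrite addrA cosDpihalf exprS.
have -> : g x * x ^+ j * cos ((l + h) * x + t) - g x * x ^+ j * cos (l * x + t) -
    h * (g x * (x * x ^+ j) * - sin (l * x + t)) =
  g x * x ^+ j * (cos (l * x + t + h * x) - cos (l * x + t) -
    (h * x) * (- sin (l * x + t))).
  by rewrite (_ : (l + h) * x + t = l * x + t + h * x); ring.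
have xj : `|x ^+ j| <= 1 by rewrite normrX exprn_ile1.
have hx : 2 * (h * x) ^+ 2 <= 2 * h ^+ 2.
  rewrite ler_wpM2l// exprMn -[leRHS]mulr1 ler_wpM2l ?sqr_ge0//.
  by rewrite -real_normK ?num_real// exprn_ile1.
rewrite normrM (normrM (g x)) [leRHS](_ : _ = `|g x| * 1 * (2 * h ^+ 2)); last by ring.
apply: ler_pM => //; first by rewrite ler_wpM2l.
exact: le_trans (cos_quad _ _) hx.
Qed.

End trig_integral.

Lemma is_derive_pow (R : realType) k (x : R) :
  is_derive x (1 : R) (fun z : R => z ^+ k.+1) (k.+1%:R * x ^+ k).
Proof.
elim: k => [|k IHk].
  by rewrite expr0 mulr1; exact: is_derive_id.
rewrite (_ : (fun z => _) = (fun z : R => z * z ^+ k.+1)); last first.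
  by apply/funext => z; rewrite exprS.
by apply: is_derive_eq; rewrite /GRing.scale/= exprS -(natr1 k.+1); ring.
Qed.

(** * The radial profile of the transform and Bessel's equation *)

Section ball_transform.
Context {R : realType}.
Local Notation leb := (@lebesgue_measure R).
Variable n : nat.

(** Up to the factor [bvol R n], the volume of the section at height [x] of the unit ball of
    dimension [n + 1]. *)
Definition slice (x : R) : R := Num.sqrt (1 - x ^+ 2) ^+ n * \1_`[- 1, 1] x.

Let w (x : R) : R := Num.sqrt (1 - x ^+ 2).

Let continuous_w : continuous w.
Proof.
move=> x; apply: (@continuous_comp _ _ _ (fun y : R => 1 - y ^+ 2) Num.sqrt).
  by apply: cvgB; [exact: cvg_cst|exact: exprn_continuous].
exact: sqrt_continuous.
Qed.

Let continuous_wX j : continuous (fun x => w x ^+ j).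
Proof.
move=> x; apply: (@continuous_comp _ _ _ w (fun y => y ^+ j)).
  exact: continuous_w.
exact: exprn_continuous.
Qed.

Let is_derive_w (x : R) : - 1 < x < 1 -> is_derive x (1 : R) w (- x / w x).
Proof.
move=> /andP[x1 x2].
have x0 : 0 < 1 - x ^+ 2.
  by have := mulr_gt0 (_ : 0 < 1 - x) (_ : 0 < 1 + x); rewrite -subr_sqr expr1n; apply; lra.
have h : is_derive x (1 : R) (fun y : R => 1 - y ^+ 2) (- (2 * x)).
  apply: is_derive_eq; rewrite /GRing.scale/=; ring.
have := @is_derive1_comp R Num.sqrt (fun y => 1 - y ^+ 2) x _ _ (is_derive1_sqrt x0) h.
congr is_derive; rewrite /w; field.
by rewrite gt_eqF// sqrtr_gt0.
Qed.

Lemma slice_bfs : bfs leb slice.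
Proof.
split.
- apply: measurable_funM => //; apply: continuous_measurable_fun.
  exact: continuous_wX.
- exists 1 => x; rewrite /slice indicE; have [/set_mem/=|_] := boolP (x \in _).
    rewrite in_itv/= mulr1 => _; rewrite normrX exprn_ile1// ger0_norm ?sqrtr_ge0//.
    by rewrite -[leRHS]sqrtr1 ler_sqrt// gerBl sqr_ge0.
  by rewrite mulr0 normr0.
- exists (`[(- 1)%R, 1%R]%classic : set R); split => //.
    by rewrite /= lebesgue_measure_itv; case: ifP => _ /=; rewrite -?EFinB ltry.
  by move=> x nx; rewrite /slice indicE memNset// mulr0.
Qed.

Lemma slice_out x : 1 < `|x| -> slice x = 0.
Proof.
move=> x1; rewrite /slice indicE memNset ?mulr0//= in_itv/= -ler_norml.
by apply/negP; rewrite -ltNge.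
Qed.

(** Up to a constant, [J_nu(l) / l ^ nu] with [J_nu] the Bessel function and [nu = (n + 1) / 2]; the
    next two functions are its derivatives. *)
Definition slice_cos := trig_int slice 0 0.
Definition slice_cos1 := trig_int slice 1 (0 + pi / 2).
Definition slice_cos2 := trig_int slice 2 (0 + pi / 2 + pi / 2).

Lemma is_derive_slice_cos l : is_derive l (1 : R) slice_cos (slice_cos1 l).
Proof. exact: is_derive_trig_int slice_bfs slice_out _ _ _. Qed.

Lemma is_derive_slice_cos1 l : is_derive l (1 : R) slice_cos1 (slice_cos2 l).
Proof. exact: is_derive_trig_int slice_bfs slice_out _ _ _. Qed.

(* Bessel's equation: integrate over [[-1, 1]] the derivative of
   [sqrt (1 - x^2) ^ (n + 2) * sin (l x)]. *)
Lemma slice_cos_ode l :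
  l * (slice_cos l + slice_cos2 l) + n.+2%:R * slice_cos1 l = 0.
Proof.
pose f x := l * (w x ^+ n.+2 * cos (l * x)) - n.+2%:R * (x * w x ^+ n * sin (l * x)).
pose F x := w x ^+ n.+2 * sin (l * x).
have csin : continuous (fun x : R => sin (l * x)).
  move=> x; apply: (@continuous_comp _ _ _ (fun y : R => l * y) (@sin R)).
    exact: mulrl_continuous.
  exact: continuous_sin.
have ccos : continuous (fun x : R => cos (l * x)).
  move=> x; apply: (@continuous_comp _ _ _ (fun y : R => l * y) (@cos R)).
    exact: mulrl_continuous.
  exact: continuous_cos.
have cf : continuous f.
  move=> x; apply: cvgB; apply: cvgM; try exact: cvg_cst; apply: cvgM.
  - exact: continuous_wX.
  - exact: ccos.
  - by apply: cvgM; [exact: cvg_id|exact: continuous_wX].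
  - exact: csin.
have cF : continuous F by move=> x; apply: cvgM; [exact: continuous_wX|exact: csin].
have wX (x : R) : - 1 <= x <= 1 -> w x ^+ 2 = 1 - x ^+ 2.
  move=> /andP[x1 x2]; rewrite sqr_sqrtr// subr_ge0.
  by rewrite -real_normK ?num_real// exprn_ile1// ler_norml x1.
have dF (x : R) : - 1 < x < 1 -> is_derive x (1 : R) F (f x).
  move=> x1; have wd := is_derive_w x1.
  have w0 : w x != 0.
    move: x1 => /andP[x1 x2].
    have x0 : 0 < 1 - x ^+ 2.
      by have := mulr_gt0 (_ : 0 < 1 - x) (_ : 0 < 1 + x); rewrite -subr_sqr expr1n; apply; lra.
    by rewrite gt_eqF// sqrtr_gt0.
  have wd2 : is_derive x (1 : R) (fun y => w y ^+ n.+2) (- (n.+2%:R * x * w x ^+ n)).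
    have := @is_derive1_comp R (fun z => z ^+ n.+2) w x _ _ (is_derive_pow n.+1 (w x)) wd.
    by congr is_derive; rewrite exprS; field.
  have sd : is_derive x (1 : R) (fun y => sin (l * y)) (l * cos (l * x)).
    have -> : (fun y => sin (l * y)) = (fun y => sin (y * l + 0)).
      by apply/funext => y; rewrite addr0 mulrC.
    by rewrite -(addr0 (l * x)) (mulrC l x); exact: is_derive_sinL.
  by rewrite /F; apply: is_derive_eq; rewrite /GRing.scale/= /f; ring.
(* For lack of a bounded derivative of [w] at the end points, the fundamental theorem is used with
   derivatives inside the interval and continuity up to its ends, where [F] vanishes. *)
have I0 : \int[leb]_(x in `[- 1, 1]) f x = 0.
  have N11 : - 1 < 1 :> R by lra.
  rewrite /Rintegral (continuous_FTC2 (F := F) N11).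
  - rewrite /F /w sqrrN expr1n subrr sqrtr0 !expr0n/= !mul0r.
    by rewrite subrr.
  - exact: continuous_subspaceT.
  - split.
    + by move=> x; rewrite in_itv/= => /dF[].
    + by apply: cvg_at_right_filter; exact: cF.
    + by apply: cvg_at_left_filter; exact: cF.
  - by move=> x; rewrite in_itv/= => /dF[_ <-]; rewrite derive1E.
rewrite -[RHS]I0 Rintegral_mkcond /slice_cos /slice_cos1 /slice_cos2 /trig_int.
have b0 := trig_bfs slice_bfs slice_out 0 0 l.
have b1 := trig_bfs slice_bfs slice_out 1 (0 + pi / 2) l.
have b2 := trig_bfs slice_bfs slice_out 2 (0 + pi / 2 + pi / 2) l.
rewrite -(bfs_intD b0 b2) -(bfs_intZ l (bfsD b0 b2)) -(bfs_intZ n.+2%:R b1).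
rewrite -(bfs_intD (bfsZ l (bfsD b0 b2)) (bfsZ n.+2%:R b1)).
apply: eq_Rintegral => x _; rewrite patchE /slice indicE.
have [/set_mem/= xI|_] := boolP (x \in _); last by rewrite /= !(mulr0, mul0r, addr0).
rewrite mulr1 /f -addrA -mulr2n -(mulr_natr (pi / 2)) divfK// !add0r addr0.
rewrite cosDpihalf cosDpi -/(w x).
have -> : w x ^+ n.+2 = w x ^+ n * (1 - x ^+ 2).
  by rewrite -addn2 exprD wX// -in_itv.
by ring.
Qed.

End ball_transform.

(** * Sturm comparison and spacing of zeros *)

Section sturm.
Context {R : realType}.
Variables (c : nat) (y y1 y2 : R -> R).
Hypothesis dy : forall x, is_derive x (1 : R) y (y1 x).
Hypothesis dy1 : forall x, is_derive x (1 : R) y1 (y2 x).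
Hypothesis ode : forall x, x * (y x + y2 x) + c.+1%:R * y1 x = 0.

(* Comparison with [v x = exp (- k x) * sin (w x + t)]: the weighted Wronskian
   [x ^ c.+1 * (y v' - y' v)] is increasing where [y, v > 0].  With
   [2 k = c.+1 / m], [m] the midpoint, the term in [cos (w x + t)] of its
   derivative has a sign. *)
Lemma sturm_pos (a l : R) : pi < l -> c.+1%:R / (1 - (pi / l) ^+ 2) <= a ->
  (forall x, a < x < a + l -> 0 < y x) -> 0 <= y a -> 0 <= y (a + l) -> False.
Proof.
move=> lpi ca ypos ya yb; have p0 := @pi_gt0 R.
have l0 : 0 < l by lra.
set w := pi / l in ca.
have w0 : 0 < w by rewrite divr_gt0.
have w1 : w < 1 by rewrite ltr_pdivrMr// mul1r.
have q0 : 0 < 1 - w ^+ 2.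
  by have := mulr_gt0 (_ : 0 < 1 - w) (_ : 0 < 1 + w); rewrite -subr_sqr expr1n; apply; lra.
have q1 : 1 - w ^+ 2 <= 1 by have := sqr_ge0 w; lra.
have c0 : 0 < c.+1%:R :> R by rewrite ltr0n.
have a0 : 0 < a by rewrite (lt_le_trans _ ca)// divr_gt0.
have cq : c.+1%:R <= a * (1 - w ^+ 2) by move: ca; rewrite ler_pdivrMr.
pose m := a + l / 2.
have m0 : 0 < m by rewrite /m; lra.
(* The damping coefficient [c.+1 / x] of the equation is frozen at the midpoint: [v] solves a
   constant-coefficient equation with damping [2 * k]. *)
pose k := c.+1%:R / (2 * m).
have k0 : 0 < k by rewrite divr_gt0// mulr_gt0.
have k1 : k < 1.
  rewrite /k ltr_pdivrMr ?mulr_gt0// mul1r (le_lt_trans cq)//.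
  rewrite (@le_lt_trans _ _ a)//; first by rewrite -[leRHS]mulr1 ler_wpM2l// ltW.
  by rewrite /m; lra.
(* With this phase the sine in [v] vanishes at [a] and, as [w * l = pi], at [a + l]. *)
pose t := - (w * a).
pose e x := expR (- k * x).
pose v x := e x * sin (x * w + t).
pose v1 x := e x * (w * cos (x * w + t) - k * sin (x * w + t)).
pose v2 x := e x * ((k ^+ 2 - w ^+ 2) * sin (x * w + t) - 2 * k * w * cos (x * w + t)).
have de x : is_derive x (1 : R) e (- k * e x).
  have h : is_derive x (1 : R) (fun z : R => - k * z) (- k).
    by apply: is_derive_eq; rewrite /GRing.scale/=; ring.
  have := @is_derive1_comp R expR (fun z => - k * z) x _ _ (is_derive_expR _) h.
  by rewrite mulrC.
have dv x : is_derive x (1 : R) v (v1 x).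
  have h1 := is_derive_sinL w t x; have h2 := de x.
  by rewrite /v; apply: is_derive_eq; rewrite /v1 /GRing.scale/=; ring.
have dv1 x : is_derive x (1 : R) v1 (v2 x).
  have h1 := is_derive_sinL w t x; have h2 := de x; have h3 := is_derive_cosL w t x.
  by rewrite /v1; apply: is_derive_eq; rewrite /v2 /GRing.scale/=; ring.
pose W x := x ^+ c.+1 * (y x * v1 x - y1 x * v x).
have dW x : is_derive x (1 : R) W
    (x ^+ c * (y x * (c.+1%:R * v1 x + x * v2 x + x * v x))).
  have hx : is_derive x (1 : R) (fun z : R => z ^+ c.+1) (c.+1%:R * x ^+ c).
    exact: is_derive_pow.
  have [d1 d2 d3 d4] := And4 (dy x) (dy1 x) (dv x) (dv1 x).
  rewrite /W; apply: is_derive_eq; rewrite /GRing.scale/=.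
  have o : x * y2 x = - (x * y x) - c.+1%:R * y1 x.
    by have := ode x; rewrite mulrDr; lra.
  transitivity (x ^+ c * (x * y x * v2 x - (x * y2 x) * v x) +
    c.+1%:R * x ^+ c * (y x * v1 x - y1 x * v x)); first by rewrite exprS; ring.
  by rewrite o; ring.
have cW := is_derive_continuous dW.
have al : a < a + l by lra.
have [x] := MVT al (fun z _ => dW z) (continuous_subspaceT cW).
rewrite in_itv/= => /andP[xa xb] e1.
have x0 : 0 < x by lra.
have sx : x * w + t = w * (x - a) by rewrite /t; ring.
have wl : w * l = pi by rewrite /w divfK// gt_eqF.
have z0 : 0 < w * (x - a) by rewrite mulr_gt0// subr_gt0.
have zpi : w * (x - a) < pi by rewrite -wl ltr_pM2l//; lra.
have pos : 0 < W (a + l) - W a.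
  rewrite e1 (_ : a + l - a = l); last by ring.
  rewrite mulr_gt0// mulr_gt0 ?exprn_gt0//.
  apply: mulr_gt0; first by apply: ypos; rewrite xa.
  (* The coefficient of the sine is positive: [x * (1 - w ^+ 2)] is at least [c.+1] by the lower
     bound on [a], and [k < 1]. *)
  have -> : c.+1%:R * v1 x + x * v2 x + x * v x =
      e x * ((x * (1 - w ^+ 2) + x * k ^+ 2 - c.+1%:R * k) * sin (x * w + t) +
        w * (c.+1%:R - 2 * k * x) * cos (x * w + t)).
    by rewrite /v /v1 /v2; ring.
  rewrite mulr_gt0 ?expR_gt0// sx ltr_pwDl//.
    rewrite mulr_gt0 ?sin_gt0_pi ?z0// subr_gt0.
    rewrite (@lt_le_trans _ _ c.+1%:R)//; first by rewrite -[ltRHS]mulr1 ltr_pM2l.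
    rewrite (le_trans cq)// (@le_trans _ _ (x * (1 - w ^+ 2)))//.
      by rewrite ler_wpM2r// ltW.
    by rewrite lerDl mulr_ge0 ?sqr_ge0// ltW.
  have -> : c.+1%:R - 2 * k * x = c.+1%:R / m * (m - x).
    by rewrite /k; field; rewrite gt_eqF.
  rewrite -mulrA; apply: (mulr_ge0 (ltW w0)).
  rewrite -[X in 0 <= X]mulrA; apply: mulr_ge0; first exact: ltW (divr_gt0 c0 m0).
  have [xm|xm] := leP x m.
    rewrite mulr_ge0 ?subr_ge0// cos_ge0_pihalf//; apply/andP; split; first lra.
    have -> : pi / 2 = w * (l / 2) by rewrite mulrA wl.
    by rewrite ler_wpM2l ?(ltW w0)//; move: xm; rewrite /m; lra.
  rewrite -mulrNN mulr_ge0//; first lra.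
  have -> : - cos (w * (x - a)) = cos (pi - w * (x - a)).
    by rewrite cosB cospi sinpi; ring.
  have xm2 : pi / 2 <= w * (x - a).
    rewrite (_ : pi / 2 = w * (l / 2)); last by rewrite mulrA wl.
    by rewrite ler_wpM2l ?(ltW w0)//; move: xm; rewrite /m; lra.
  by rewrite cos_ge0_pihalf//; apply/andP; split; move: xm2 zpi p0; lra.
have Wb : W (a + l) <= 0.
  rewrite /W /v /v1 (_ : (a + l) * w + t = pi); last by rewrite -wl /t; ring.
  rewrite cospi sinpi mulr0 mulr_ge0_le0 ?exprn_ge0 ?addr_ge0 ?(ltW a0) ?(ltW l0)//.
  rewrite !mulr0 !subr0 mulrN1 mulrN mulrN oppr_le0.
  by rewrite (mulr_ge0 yb)// mulr_ge0 ?expR_ge0 ?(ltW w0).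
have Wa : 0 <= W a.
  rewrite /W /v /v1 (_ : a * w + t = 0); last by rewrite /t; ring.
  rewrite cos0 sin0 !mulr0 !subr0 mulr1.
  apply: mulr_ge0; first exact: exprn_ge0 (ltW a0).
  by rewrite (mulr_ge0 ya)// mulr_ge0 ?expR_ge0 ?(ltW w0).
by move: pos Wa Wb; lra.
Qed.

End sturm.

Section sturm_zeros.
Context {R : realType}.
Variables (c : nat) (y y1 y2 : R -> R).
Hypothesis dy : forall x, is_derive x (1 : R) y (y1 x).
Hypothesis dy1 : forall x, is_derive x (1 : R) y1 (y2 x).
Hypothesis ode : forall x, x * (y x + y2 x) + c.+1%:R * y1 x = 0.

Lemma no_zero_same_sign a b x0 : (forall x, a < x < b -> y x != 0) ->
  a < x0 < b -> 0 < y x0 ->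
  [/\ forall x, a < x < b -> 0 < y x, 0 <= y a & 0 <= y b].
Proof.
move=> nz x0ab yx0; have cy := is_derive_continuous dy.
have key x : a <= x <= b -> y x < 0 -> False.
  move=> /andP[ax xb] yx; move: x0ab => /andP[ax0 x0b].
  have [xx0|x0x] := leP x x0.
    have [|z] := IVT xx0 (continuous_subspaceT cy) (v := 0).
      by rewrite ge_min le_max (ltW yx)/= (ltW yx0) orbT.
    rewrite in_itv/= => /andP[z1 z2] z0; have zx : z != x.
      by apply: contraTneq yx => <-; rewrite z0 ltxx.
    have := nz z; rewrite z0 eqxx => H; suff : false by [].
    apply: H; rewrite (le_lt_trans z2 x0b) andbT (le_lt_trans ax)//.
    by rewrite lt_neqAle eq_sym zx.
  have [|z] := IVT (ltW x0x) (continuous_subspaceT cy) (v := 0).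
    by rewrite ge_min le_max (ltW yx)/= (ltW yx0) orbT.
  rewrite in_itv/= => /andP[z1 z2] z0; have zx : z != x.
    by apply: contraTneq yx => <-; rewrite z0 ltxx.
  have := nz z; rewrite z0 eqxx => H; suff : false by [].
  by apply: H; rewrite (lt_le_trans ax0 z1)/= (lt_le_trans _ xb)// lt_neqAle zx.
have ab : a <= b by move: x0ab => /andP[? ?]; lra.
split.
- move=> x /[dup] xab /andP[ax xb]; rewrite lt_neqAle eq_sym nz// leNgt.
  by apply/negP => /key; apply; rewrite !ltW.
- by rewrite leNgt; apply/negP => /key; apply; rewrite lexx.
- by rewrite leNgt; apply/negP => /key; apply; rewrite lexx ab.
Qed.

End sturm_zeros.

Lemma sturm_zero (R : realType) c (y y1 y2 : R -> R)
  (dy : forall x, is_derive x (1 : R) y (y1 x))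
  (dy1 : forall x, is_derive x (1 : R) y1 (y2 x))
  (ode : forall x, x * (y x + y2 x) + c.+1%:R * y1 x = 0) (a l : R) :
  pi < l -> c.+1%:R / (1 - (pi / l) ^+ 2) <= a ->
  exists2 z, a < z < a + l & y z = 0.
Proof.
move=> lpi ca; apply: contrapT => nz.
have l0 : 0 < l by have := @pi_gt0 R; lra.
have {}nz x : a < x < a + l -> y x != 0.
  by move=> xal; apply/eqP => yx; apply: nz; exists x.
have mal : a < a + l / 2 < a + l by apply/andP; split; lra.
have [ym|ym|ym] := ltgtP (y (a + l / 2)) 0.
- have dyN x : is_derive x (1 : R) (fun t => - y t) (- y1 x) by exact: is_deriveN.
  have dy1N x : is_derive x (1 : R) (fun t => - y1 t) (- y2 x) by exact: is_deriveN.
  have odeN x : x * (- y x + - y2 x) + c.+1%:R * (- y1 x) = 0.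
    by rewrite -opprD !mulrN -opprD ode oppr0.
  have nzN x : a < x < a + l -> - y x != 0 by move=> /nz; rewrite oppr_eq0.
  have [|p ya yb] := no_zero_same_sign dyN nzN mal; first by rewrite oppr_gt0.
  exact (sturm_pos dyN dy1N odeN lpi ca p ya yb).
- have [p ya yb] := no_zero_same_sign dy nz mal ym.
  exact (sturm_pos dy dy1 ode lpi ca p ya yb).
- by have := nz _ mal; rewrite ym eqxx.
Qed.

Lemma slice_cos_zeros (R : realType) n (l : R) : pi < l ->
  exists2 A : R, 0 < A & exists z : nat -> R, forall m,
    A + l * m%:R < z m < A + l * m.+1%:R /\ slice_cos n (z m) = 0.
Proof.
move=> lpi; have p0 := @pi_gt0 R; have l0 : 0 < l by lra.
have w1 : pi / l < 1 by rewrite ltr_pdivrMr// mul1r.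
have w0 : 0 < pi / l by rewrite divr_gt0.
have q0 : 0 < 1 - (pi / l) ^+ 2.
  by have := mulr_gt0 (_ : 0 < 1 - pi / l) (_ : 0 < 1 + pi / l); rewrite -subr_sqr expr1n; apply; lra.
have A0 : 0 < n.+2%:R / (1 - (pi / l) ^+ 2) by rewrite divr_gt0// ltr0n.
exists (n.+2%:R / (1 - (pi / l) ^+ 2)) => //.
set A := n.+2%:R / _ in A0 *.
have H m : exists z, A + l * m%:R < z < A + l * m.+1%:R /\ slice_cos n z = 0.
  have [|z z1 z2] := sturm_zero (is_derive_slice_cos n) (is_derive_slice_cos1 n)
    (@slice_cos_ode R n) (a := A + l * m%:R) lpi.
    by rewrite -/A lerDl mulr_ge0// ltW.
  by exists z; split => //; move: z1; rewrite -(natr1 m) mulrDr mulr1 addrA.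
by have [z zP] := choice H; exists z.
Qed.

(** * The transform [beta] of the ball as a radial function *)

Section ball_fourier.
Context {R : realType}.
Variable n : nat.
Local Notation L := (@lebesgue_rV R n.+1).
Local Notation E := 'rV[R]_n.+1.
Local Notation B1 := (\1_(eball 1) : E -> R).
Implicit Types x y : E.

Definition beta y : R := \int[L]_z (B1 z * cos (dotv z y)).

Lemma RB_trig (a : E -> R) y t : RB a -> RB (fun z => a z * cos (dotv z y + t)).
Proof.
move=> Ra; apply: (RBM Ra); last by exists 1 => z; exact: cos_max.
apply: measurable_cosL; apply: measurable_funD => //.
exact: measurable_fun_dotv.
Qed.

Lemma RB_trig0 (a : E -> R) y : RB a -> RB (fun z => a z * cos (dotv z y)).
Proof.
by move=> /(RB_trig y 0); congr RB; apply/funext => z; rewrite addr0.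
Qed.

Lemma enorm_householder v x : dotv v v != 0 -> enorm (householder v x) = enorm x.
Proof.
move=> v0; rewrite !enormE; congr Num.sqrt.
by rewrite -[X in dotv _ X]/(householder v x) dotv_householder// householderK.
Qed.

Lemma beta_radial x y : enorm x = enorm y -> beta x = beta y.
Proof.
move=> xy; have [->//|xny] := eqVneq x y.
have v0 : dotv (x - y) (x - y) != 0.
  by rewrite -enorm_sqr sqrf_eq0 enorm_eq0 subr_eq0.
have [mf _ _] := RB_trig0 x (RB_ball 1).
rewrite /beta -(preserving_int (preserving_householder v0) mf).
apply: eq_Rintegral => z _; rewrite !B1E enorm_householder//.
by rewrite dotv_householder// householder_swap.
Qed.

Definition axis (l : R) : E := rV_cons (l, 0).

Lemma dotv_axis x l : dotv x (axis l) = x ord0 ord0 * l.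
Proof.
rewrite /dotv big_ord_recl /axis mxE unlift_none big1 ?addr0// => i _.
by rewrite !mxE liftK mxE mulr0.
Qed.

Lemma enorm_axis l : enorm (axis l) = `|l|.
Proof.
by rewrite enormE dotv_axis mxE unlift_none -expr2 sqrtr_sqr.
Qed.

Lemma betaE y : beta y = beta (axis (enorm y)).
Proof. by apply: beta_radial; rewrite enorm_axis ger0_norm// enorm_ge0. Qed.

(** The bound involves the moduli only, because [beta] can be evaluated on the axis. Near a zero,
    [beta] is therefore small on a whole thin shell, whatever the direction. *)
Lemma beta_lip x y : `|beta x - beta y| <= bvol R n.+1 * `|enorm x - enorm y|.
Proof.
rewrite (betaE x) (betaE y); set l := enorm x; set m := enorm y.
have b1 := RB_bfs (RB_trig0 (axis l) (RB_ball 1)).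
have b2 := RB_bfs (RB_trig0 (axis m) (RB_ball 1)).
rewrite /beta -(bfs_intB b1 b2) mulrC.
apply: (bfs_int_bound (bfsB b1 b2)); [exact: measurable_eball|exact: eball_finite|].
move=> z; rewrite -mulrBr normrM mulrC [`|B1 z|]ger0_norm ?B1_ge0//.
rewrite B1E; have [z1|_] := leP (enorm z) 1; last by rewrite !mulr0.
rewrite !mulr1 !dotv_axis (le_trans (cos_norm_lip _ _))// -mulrBr normrM.
rewrite -[leRHS]mul1r ler_wpM2r// (le_trans _ z1)//.
exact: coord_le_enorm.
Qed.

Lemma int_ball_sin y : \int[L]_z (B1 z * sin (dotv z y)) = 0.
Proof.
have RS : RB (fun z => B1 z * sin (dotv z y)).
  apply: (RBM (RB_ball 1)); last by exists 1 => z; exact: sin_max.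
  by apply: (measurableT_comp measurable_sin'); exact: measurable_fun_dotv.
have [mS _ _] := RS.
have e : \int[L]_z (B1 z * sin (dotv z y)) = - \int[L]_z (B1 z * sin (dotv z y)).
  rewrite -[in LHS](preserving_int preserving_opp mS) -mulN1r -(bfs_intZ _ (RB_bfs RS)).
  by apply: eq_Rintegral => z _; rewrite B1N dotvNl sinN mulrN mulN1r.
by move: e; lra.
Qed.

(** Plane waves are eigenfunctions of ball averaging, with eigenvalue [beta y]; the sine part is odd
    and drops out. *)
Lemma ball_average_cos x y t :
  \int[L]_z (cos (dotv z y + t) * B1 (x - z)) = cos (dotv x y + t) * beta y.
Proof.
have mf : measurable_fun setT (fun w : E => cos (dotv (x - w) y + t) * B1 w).
  apply: measurable_funM; last exact: measurable_B1.
  apply: measurable_cosL; apply: measurable_funD => //.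
  by apply: measurable_fun_dotv => //; exact: measurable_rVB.
transitivity (\int[L]_w (cos (dotv (x - w) y + t) * B1 w)).
  rewrite -(preserving_int (preserving_subl x) mf); apply: eq_Rintegral => z _.
  by have -> : x - (x - z) = z by rewrite opprB addrC subrK.
have b1 := RB_bfs (RB_trig0 y (RB_ball 1)).
have b2 : bfs L (fun z => B1 z * sin (dotv z y)).
  apply: RB_bfs; apply: (RBM (RB_ball 1)); last by exists 1 => z; exact: sin_max.
  by apply: (measurableT_comp measurable_sin'); exact: measurable_fun_dotv.
rewrite /beta -(bfs_intZ _ b1) -[RHS]addr0 -[X in _ + X](mulr0 (sin (dotv x y + t))).
rewrite -(int_ball_sin y) -(bfs_intZ _ b2) -(bfs_intD (bfsZ _ b1) (bfsZ _ b2)).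
apply: eq_Rintegral => w _.
by rewrite (_ : dotv (x - w) y + t = dotv x y + t - dotv w y) ?cosB ?dotvBl; ring.
Qed.

End ball_fourier.

(** Radius [0] is included because it occurs for the sections at [x = 1] and [x = -1]. *)
Lemma fine_lebesgue_eball_ge0 (R : realType) n (r : R) : 0 <= r ->
  fine (lebesgue_rV n (eball r)) = r ^+ n * bvol R n.
Proof.
rewrite le_eqVlt => /predU1P[<-|]; last exact: fine_lebesgue_eball.
case: n => [|n].
  (* In dimension [0] every ball of nonnegative radius is the whole space, in accordance with
     [0 ^+ 0 = 1]. *)
  rewrite expr0 mul1r /bvol; congr (fine (lebesgue_rV _ _)).
  apply/seteqP; split => x _; rewrite /eball/= /enorm big_ord0 sqrtr0//.
rewrite expr0n mul0r.
suff -> : lebesgue_rV n.+1 (eball 0 : set 'rV[R]_n.+1) = 0%E by [].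
have -> : eball 0 = cube 0 :> set 'rV[R]_n.+1.
  apply/seteqP; split; first exact: eball_sub_cube.
  by move=> x /cube_sub_eball; rewrite mul0rn; apply.
by rewrite lebesgue_cube// mul0rn expr0n.
Qed.

(** Along the axis the wave depends on the first coordinate only, and Fubini replaces each section
    of the ball by its volume. *)
Lemma beta_axis (R : realType) n (l : R) :
  beta (axis n l) = bvol R n * slice_cos n l.
Proof.
have b := trig_bfs (slice_bfs n) (@slice_out R n) 0 0 l.
rewrite /beta rV_RintegralS; last exact: RB_trig0 (RB_ball 1).
rewrite /slice_cos /trig_int -(bfs_intZ _ b).
apply: eq_Rintegral => x _.
have en (w : 'rV[R]_n) : enorm (rV_cons (x, w)) ^+ 2 = (x : R) ^+ 2 + enorm w ^+ 2.
  by rewrite !enorm_sqr dotv_cons -expr2.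
pose r := Num.sqrt (1 - (x : R) ^+ 2).
have B1c (w : 'rV[R]_n) : \1_(eball 1) (rV_cons (x, w)) =
    \1_`[- 1, 1] (x : R) * \1_(eball r) w :> R.
  rewrite B1E !indicE mem_setE in_itv/= -ler_norml.
  have -> : (w \in eball r) = (enorm w <= r)%R.
    by apply/idP/idP => [/set_mem|/mem_set]; [|exact].
  rewrite -natrM mulnb; congr (nat_of_bool _)%:R.
  have e1 : (enorm (rV_cons (x, w)) <= 1) = (x ^+ 2 + enorm w ^+ 2 <= 1)%R.
    by rewrite -en -[X in _ = (_ <= X)](expr1n _ 2) ler_sqr ?nnegrE ?enorm_ge0.
  rewrite e1; apply/idP/andP => [H|[H1 H2]].
    split; last by rewrite -[enorm w]ger0_norm ?enorm_ge0// -sqrtr_sqr ler_sqrt; have := sqr_ge0 (enorm w); lra.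
    rewrite -ler_sqr ?nnegrE// expr1n real_normK ?num_real//.
    by have := sqr_ge0 (enorm w); lra.
  have x2 : 0 <= 1 - x ^+ 2.
    by rewrite subr_ge0 -real_normK ?num_real// exprn_ile1.
  have : enorm w ^+ 2 <= r ^+ 2 by rewrite ler_sqr ?nnegrE ?enorm_ge0 ?sqrtr_ge0.
  by rewrite /r sqr_sqrtr//; lra.
under eq_Rintegral => w _.
  rewrite B1c dotv_axis mxE unlift_none/= mulrAC.
  over.
rewrite (bfs_intZ _ (RB_bfs (RB_ball r))) int_indic; last exact: measurable_eball.
rewrite (fine_lebesgue_eball_ge0 n (sqrtr_ge0 _)) /slice addr0 expr0 mulr1 -/r.
by rewrite (mulrC l); ring.
Qed.

(** * Plane waves *)

Section rigid_functions.
Context {R : realType}.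
Variable n : nat.
Local Notation L := (@lebesgue_rV R n.+1).
Local Notation E := 'rV[R]_n.+1.
Local Notation V := (bvol R n.+1).
Implicit Types (a b g : E -> R) (x y z : E) (rho : R).

Definition approximable rho e a := exists b,
  [/\ RB b, forall x, eball rho x -> b x = 0 & N (fun x => a x - b x) <= e].

Definition rigid rho a := RB a /\ forall e : R, 0 < e -> approximable rho e a.

Lemma approximable_close rho e a a' : RB a -> RB a' ->
  approximable rho e a' ->
  approximable rho (2 * (V ^+ 2 * \int[L]_x ((a x - a' x) ^+ 2)) + 2 * e) a.
Proof.
move=> Ra Ra' [b [Rb b0 Nb]]; exists b; split => //.
have -> : (fun x => a x - b x) = (fun x => (a x - a' x) + (a' x - b x)).
  by apply/funext => x; rewrite addrA subrK.
apply: (le_trans (ND_le (RBB Ra Ra') (RBB Ra' Rb))).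
apply: lerD; last exact: ler_wpM2l Nb.
by apply: ler_wpM2l => //; exact: N_le (RBB Ra Ra').
Qed.

Lemma approximable_le rho e e' a : e <= e' -> approximable rho e a ->
  approximable rho e' a.
Proof. by move=> ee' [b [? ? Nb]]; exists b; split => //; exact: le_trans ee'. Qed.

(** By [N_le], an [L2] perturbation changes [N] little, so the rigid functions are closed in [L2];
    together with [rigidD] and [rigidZ] this reduces the problem to a total family. *)
Lemma rigid_close rho a : RB a ->
  (forall e : R, 0 < e -> exists2 a', rigid rho a' &
    \int[L]_x ((a x - a' x) ^+ 2) <= e) -> rigid rho a.
Proof.
move=> Ra H; split => // e e0.
have V0 : 0 < V := bvol_gt0.
have e1 : 0 < e / (4 * V ^+ 2) by rewrite divr_gt0// mulr_gt0// exprn_gt0.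
have [a' [Ra' ra'] aa'] := H _ e1.
have e4 : 0 < e / 4 by rewrite divr_gt0.
apply: approximable_le (approximable_close Ra Ra' (ra' _ e4)).
have h : V ^+ 2 * \int[L]_x ((a x - a' x) ^+ 2) <= e / 4.
  apply: (le_trans (ler_wpM2l (sqr_ge0 V) aa')).
  by rewrite le_eqVlt; apply/orP; left; apply/eqP; field; rewrite gt_eqF.
have q2 : 0 <= 2 :> R by [].
apply: (le_trans (lerD (ler_wpM2l q2 h) (lexx _))).
by rewrite le_eqVlt; apply/orP; left; apply/eqP; field.
Qed.

Lemma rigid0 rho : rigid rho (fun=> 0).
Proof.
split; first exact: RB0.
move=> e e0; exists (fun=> 0); split => //; first exact: RB0.
apply: (le_trans (N_le (RBB RB0 RB0))).
under eq_Rintegral do rewrite subrr expr0n.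
by rewrite Rintegral_cst// mul0r mulr0 ltW.
Qed.

Lemma rigidD rho a a' : rigid rho a -> rigid rho a' ->
  rigid rho (fun x => a x + a' x).
Proof.
move=> [Ra ra] [Ra' ra']; split; first exact: RBD.
move=> e e0; have e4 : 0 < e / 4 by rewrite divr_gt0.
have [[b [Rb b0 Nb]] [b' [Rb' b0' Nb']]] := (ra _ e4, ra' _ e4).
exists (fun x => b x + b' x); split; first exact: RBD.
  by move=> x xr; rewrite b0// b0'// addr0.
have -> : (fun x => a x + a' x - (b x + b' x)) = (fun x => (a x - b x) + (a' x - b' x)).
  by apply/funext => x; rewrite opprD addrACA.
apply: (le_trans (ND_le (RBB Ra Rb) (RBB Ra' Rb'))).
have q2 : 0 <= 2 :> R by [].
apply: (le_trans (lerD (ler_wpM2l q2 Nb) (ler_wpM2l q2 Nb'))).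
by rewrite le_eqVlt; apply/orP; left; apply/eqP; field.
Qed.

Lemma rigidZ rho k a : rigid rho a -> rigid rho (fun x => k * a x).
Proof.
move=> [Ra ra]; split; first exact: RBZ.
move=> e e0; have k1 : 0 < k ^+ 2 + 1 by have := sqr_ge0 k; lra.
have e4 : 0 < e / (k ^+ 2 + 1) by rewrite divr_gt0.
have [b [Rb b0 Nb]] := ra _ e4.
exists (fun x => k * b x); split; first exact: RBZ.
  by move=> x xr; rewrite b0// mulr0.
have -> : (fun x => k * a x - k * b x) = (fun x => k * (a x - b x)).
  by apply/funext => x; rewrite mulrBr.
rewrite (NZ _ (RBB Ra Rb)) (le_trans (ler_wpM2l (sqr_ge0 k) Nb))//.
rewrite mulrA ler_pdivrMr// mulrC mulrDr mulr1 lerDl ltW//.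
Qed.

(** Increments all larger than [e] would carry [J] past [M]. It serves to find one truncation radius
    whose boundary term is cheap. *)
Lemma small_increment (J : nat -> R) (M e : R) : (forall k, 0 <= J k <= M) ->
  0 < e -> exists k, J k.+1 - J k <= e.
Proof.
move=> JM e0; apply: contrapT => H.
have {}H k : J k + e < J k.+1.
  by rewrite -ltrBrDl ltNge; apply/negP => Jk; apply: H; exists k.
have Jk k : e * k%:R <= J k.
  elim: k => [|k IHk]; first by rewrite mulr0; have /andP[] := JM 0%N.
  by rewrite -natr1 mulrDr mulr1 ltW// (le_lt_trans _ (H k))// lerD2r.
have /andP[J0 M0] := JM 0%N.
have Me : 0 <= M / e := divr_ge0 (le_trans J0 M0) (ltW e0).
have := archi_boundP Me; rewrite ltr_pdivrMr// mulrC => Mb.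
have /andP[_ JM2] := JM (Num.bound (M / e)).
by have := le_trans (Jk _) JM2; rewrite leNgt Mb.
Qed.

(* The truncation of [phi x = \int g y cos (x.y + t)] to a large ball is small in the
   norm [N], since there its ball averages are those of [phi], of spectral
   density [g beta], up to a boundary term. *)
Lemma approximable_superposition rho t g (e : R) : 0 < rho -> 0 < e -> RB g ->
  approximable rho
    (2 * ((10 * pi) ^+ n.+1 * \int[L]_y ((g y * beta y) ^+ 2)) + e)
    (fun x => \1_(eball rho) x * \int[L]_y (g y * cos (dotv x y + t))).
Proof.
move=> rho0 e0 Rg; pose phi x := \int[L]_y (g y * cos (dotv x y + t)).
have mk : measurable_fun setT (fun w : E * E => cos (dotv w.1 w.2 + t)).
  apply: measurable_cosL; apply: measurable_funD => //.
  exact: measurable_fun_dotv.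
have kb : exists K : R, forall w : E * E, `|cos (dotv w.1 w.2 + t)| <= K.
  by exists 1 => w; exact: cos_max.
have Rphi r : RB (fun x => \1_(eball r) x * phi x).
  by have [_ ? _] := kernel_fubini (RB_ball r) Rg mk kb.
have mk0 : measurable_fun setT (fun w : E * E => cos (dotv w.1 w.2)).
  by apply: measurable_cosL; exact: measurable_fun_dotv.
have kb0 : exists K : R, forall w : E * E, `|cos (dotv w.1 w.2)| <= K.
  by exists 1 => w; exact: cos_max.
have Rgb : RB (fun y => g y * beta y).
  by have [_ _ ?] := kernel_fubini (RB_ball 1) Rg mk0 kb0.
pose psi x := \int[L]_y (g y * beta y * cos (dotv x y + t)).
have Rpsi r : RB (fun x => \1_(eball r) x * psi x).
  by have [_ ? _] := kernel_fubini (RB_ball r) Rgb mk kb.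
have in01 r x : (\1_(eball r) x : R) ^+ 2 = \1_(eball r) x.
  by rewrite indicE; case: (_ \in _); rewrite ?expr1n ?expr0n.
have Rphi2 r : RB (fun x => \1_(eball r) x * phi x ^+ 2).
  by move: (RB_sqr (Rphi r)); congr RB; apply/funext => x; rewrite exprMn in01.
(* A ball average at [x] sees only points at distance at most [1], so truncating at [r + 2] changes
   nothing for [enorm x <= r + 1]. *)
have Sphi r x : enorm x <= r + 1 -> S (fun z => \1_(eball (r + 2)) z * phi z) x = psi x.
  move=> xr.
  have RB1x : RB (fun z : E => \1_(eball 1) (x - z) : R).
    move: (RB_shift (- x) (RB_ball 1)); congr RB; apply/funext => z.
    exact: B1_distC.
  have [sw _ _] := kernel_fubini RB1x Rg mk kb.
  transitivity (\int[L]_z (\1_(eball 1) (x - z) * \int[L]_y (g y * cos (dotv z y + t)))).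
    apply: eq_Rintegral => z _; rewrite mulrC -/(phi z).
    have [xz|xz] := leP (enorm (x - z)) 1; last first.
      by rewrite B1E leNgt xz !mul0r.
    have zr : eball (r + 2) z.
      rewrite /eball /=; apply: (le_trans (enorm_triangle z x)); rewrite enorm_distC.
      by apply: le_trans (lerD xz xr) _; rewrite addrCA.
    by rewrite [\1_(eball (r + 2)) z]indicE (mem_set zr) mul1r.
  rewrite sw; apply: eq_Rintegral => y _; rewrite -mulrA; congr (_ * _).
  rewrite mulrC -ball_average_cos; apply: eq_Rintegral => z _; exact: mulrC.
pose C := ((10 * pi) ^+ n.+1 : R).
have C0 : 0 <= C by rewrite exprn_ge0// mulr_ge0// pi_ge0.
(* The radii increase by [2], the width of the shell separating the truncations at [r] and [r + 2];
   [J k.+1 - J k] is the squared [L2] norm of [phi] on it. *)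
pose J k := \int[L]_x (\1_(eball (rho + 2 * k%:R)) x * phi x ^+ 2).
have rk k : 0 < rho + 2 * k%:R by rewrite ltr_wpDr// mulr_ge0.
have JM k : 0 <= J k <= C * \int[L]_y (g y ^+ 2).
  apply/andP; split; last exact: plancherel_le.
  by apply: bfs_int_ge0 => x; rewrite mulr_ge0 ?sqr_ge0// indicE.
have V0 : 0 < V := bvol_gt0.
have e1 : 0 < e / (2 * V ^+ 2) by rewrite divr_gt0// mulr_gt0// exprn_gt0.
have [k Jk] := small_increment JM e1.
pose r := rho + 2 * k%:R.
have r2 : rho + 2 * k.+1%:R = r + 2 by rewrite -natr1 /r; ring.
have rr : rho <= r by rewrite /r lerDl mulr_ge0.
(* This is [- phi] on the shell between [rho] and [r]: it vanishes on the ball, and subtracting it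
   leaves [phi] truncated at [r]. *)
exists (fun x => \1_(eball rho) x * phi x - \1_(eball r) x * phi x); split.
- exact: RBB.
- move=> x xr; rewrite !indicE !mem_set ?subrr//.
  exact: le_trans rr.
have -> : (fun x => \1_(eball rho) x * phi x - (\1_(eball rho) x * phi x - \1_(eball r) x * phi x)) =
    (fun x => \1_(eball r) x * phi x).
  by apply/funext => x; rewrite opprB addrC subrK.
pose sh x := \1_(eball (r + 2)) x * phi x - \1_(eball r) x * phi x.
have Rsh : RB sh by exact: RBB.
have Nsh : N sh <= e / 2.
  apply: (le_trans (N_le Rsh)).
  have -> : \int[L]_x (sh x ^+ 2) = J k.+1 - J k.
    rewrite /J r2 -(bfs_intB (RB_bfs (Rphi2 _)) (RB_bfs (Rphi2 _))).
    apply: eq_Rintegral => x _; rewrite /sh -/r !indicE.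
    have [/set_mem xr|_] := boolP (x \in eball r).
      rewrite mem_set ?subrr ?expr0n//.
      by rewrite /eball/= (le_trans xr)// lerDl.
    by case: (_ \in _); rewrite /= !(mul0r, mul1r, subr0)// expr0n.
  apply: (le_trans (ler_wpM2l (sqr_ge0 V) Jk)).
  by rewrite le_eqVlt; apply/orP; left; apply/eqP; field; rewrite gt_eqF.
(* Up to radius [r + 1] the average is [psi] minus that of the shell [sh]; beyond, it vanishes. *)
have pt x : S (fun z => \1_(eball r) z * phi z) x ^+ 2 <=
    2 * (\1_(eball (r + 1)) x * psi x ^+ 2) + 2 * S sh x ^+ 2.
  have [xr|xr] := leP (enorm x) (r + 1); last first.
    have -> : S (fun z => \1_(eball r) z * phi z) x = 0.
      transitivity (\int[L]_(z in setT) (0 : R)); last by rewrite Rintegral_cst ?mul0r.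
      apply: eq_Rintegral => z _.
      have [zr|zr] := leP (enorm z) r; last by rewrite indicE memNset ?mul0r// /eball/=; apply/negP; rewrite -ltNge.
      by rewrite (B1_far zr xr) mulr0.
    have q2 : 0 <= 2 :> R by [].
    rewrite expr0n; apply: addr_ge0; apply: (mulr_ge0 q2); last exact: sqr_ge0.
    by apply: mulr_ge0; [rewrite indicE|exact: sqr_ge0].
  have -> : S (fun z => \1_(eball r) z * phi z) x = psi x - S sh x.
    by rewrite /sh (SB _ (Rphi _) (Rphi _)) Sphi// opprB addrC subrK.
  rewrite indicE mem_set// mul1r -subr_ge0.
  set u := psi x; set v := S sh x.
  by rewrite (_ : _ - _ = (u + v) ^+ 2) ?sqr_ge0//; ring.
have Rpsi2 : RB (fun x => \1_(eball (r + 1)) x * psi x ^+ 2).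
  by move: (RB_sqr (Rpsi (r + 1))); congr RB; apply/funext => x; rewrite exprMn in01.
have RSsh := RB_sqr (RB_S Rsh).
apply: (le_trans (bfs_int_le (RB_bfs (RB_sqr (RB_S (Rphi r)))) _ pt)).
  exact: RB_bfs (RBD (RBZ _ Rpsi2) (RBZ _ RSsh)).
rewrite (bfs_intD (RB_bfs (RBZ _ Rpsi2)) (RB_bfs (RBZ _ RSsh))).
rewrite (bfs_intZ _ (RB_bfs Rpsi2)) (bfs_intZ _ (RB_bfs RSsh)).
have r10 : 0 < r + 1 by rewrite ltr_wpDr// rk.
have P := plancherel_le t r10 Rgb.
apply: lerD; first exact: ler_wpM2l P.
by rewrite mulrC -ler_pdivlMr.
Qed.

End rigid_functions.

(** * Cones of frequencies around a zero of [beta] *)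

Section cone.
Context {R : realType}.
Variable n : nat.
Local Notation L := (@lebesgue_rV R n.+1).
Local Notation E := 'rV[R]_n.+1.
Local Notation V := (bvol R n.+1).
Variable y0 : E.
Hypothesis y0_neq0 : y0 != 0.
Let l := enorm y0.
Implicit Types (x y z : E) (eta e r : R).

(** For [y != 0]: the radial projection of [y] to the sphere through [y0] is within [eta] of [y0].
    Multiplying by [enorm y] avoids the division and makes homogeneity visible. *)
Definition cone eta : set E := [set y | enorm (enorm y *: y0 - l *: y) <= eta * enorm y].

Let l_gt0 : 0 < l.
Proof. by rewrite lt_neqAle enorm_ge0 eq_sym enorm_eq0 y0_neq0. Qed.

Lemma measurable_cone eta : measurable (cone eta).
Proof.
pose f y := enorm (enorm y *: y0 - l *: y) - eta * enorm y.
have mf : measurable_fun setT f.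
  apply: measurable_funB.
    apply: (measurableT_comp measurable_enorm); apply: measurable_rVB.
      by apply: measurable_rVZ => //; exact: measurable_enorm.
    exact: measurable_rVZ.
  by apply: measurable_funM => //; exact: measurable_enorm.
have -> : cone eta = f @^-1` `]-oo, 0].
  by apply/seteqP; split => y /=; rewrite in_itv/= subr_le0.
by rewrite -[X in measurable X]setTI; exact: mf.
Qed.

Lemma cone_scale eta k x : 0 < k -> cone eta (k *: x) <-> cone eta x.
Proof.
move=> k0; rewrite /cone/= enormZ gtr0_norm// -scalerA.
rewrite (scalerA l k) (mulrC l) -scalerA -scalerBr enormZ gtr0_norm//.
by rewrite mulrCA ler_pM2l.
Qed.

(** [y - y0] splits into an angular part, at most [2 * eta] because [enorm y <= 2 * l], and a radial
    part, at most [e * l]. *)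
Lemma cone_near eta y e : 0 <= eta -> cone eta y -> l < enorm y ->
  enorm y <= l * (1 + e) -> e <= 1 -> enorm (y - y0) <= 2 * eta + e * l.
Proof.
move=> eta0 cy ly yl e1.
rewrite -(ler_pM2l l_gt0) -[X in X * enorm _](gtr0_norm l_gt0) -enormZ.
have -> : l *: (y - y0) = (l *: y - enorm y *: y0) + (enorm y - l) *: y0.
  by rewrite scalerBr scalerBl addrA subrK.
apply: (le_trans (enormD _ _)); rewrite enorm_distC enormZ.
rewrite mulrDr; apply: lerD.
  apply: (le_trans cy); rewrite mulrC [leRHS]mulrCA mulrA.
  apply: ler_wpM2r => //; apply: (le_trans yl); rewrite mulrC.
  by apply: ler_wpM2r; [exact: ltW|lra].
rewrite ger0_norm ?subr_ge0 ?(ltW ly)// -/l mulrA; apply: ler_wpM2r; first exact: ltW.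
by rewrite lerBlDl; apply: (le_trans yl); rewrite mulrDr mulr1.
Qed.

Let Qvol eta : \bar R := L (cone eta `&` eball l).

Let mQ eta r : measurable (cone eta `&` eball r).
Proof. by apply: measurableI; [exact: measurable_cone|exact: measurable_eball]. Qed.

Let Qoo eta r : (L (cone eta `&` eball r) < +oo)%E.
Proof.
apply: (@le_lt_trans _ _ (L (eball r))); last exact: eball_finite.
by apply: le_measure; rewrite ?inE; [exact: mQ|exact: measurable_eball|exact: subIsetr].
Qed.

Lemma cone_vol_scale eta k : 0 < k ->
  L (cone eta `&` eball (l * k)) = ((k ^+ n.+1)%:E * Qvol eta)%E.
Proof.
move=> k0; rewrite /Qvol -(lebesgue_scale k0 (mQ eta l)).
have kV : 0 < k^-1 by rewrite invr_gt0.
congr (L _); apply/seteqP; split => x /=; rewrite /eball/= => -[cx xl].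
  split; first exact/cone_scale.
  by rewrite enormZ gtr0_norm// ler_pdivrMl// mulrC.
split; first exact/(cone_scale eta x kV).
by move: xl; rewrite enormZ gtr0_norm// ler_pdivrMl// mulrC.
Qed.

Lemma cone_vol_gt0 eta : 0 < eta -> 0 < fine (Qvol eta).
Proof.
move=> eta0; apply: fine_gt0; rewrite Qoo andbT.
(* A ball around the midpoint of [0] and [y0] fits in the cone: [l / 4] keeps the norms between
   [l / 4] and [l], and [eta / 8] makes the deviation [2 * d * l] at most [eta * (l / 4)]. *)
pose d := Num.min (l / 4) (eta / 8).
have d0 : 0 < d by rewrite lt_min !divr_gt0.
have dl : d <= l / 4 by rewrite ge_min lexx.
have de : d <= eta / 8 by rewrite ge_min lexx orbT.
apply: (@lt_le_trans _ _ (L ((fun x => x + - (2^-1 *: y0)) @^-1` eball d))).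
  rewrite (preserving_set (preserving_shift _) (measurable_eball _)).
  by rewrite lebesgue_eball// mule_gt0 ?lte_fin ?exprn_gt0// eball1_gt0.
apply: le_measure; rewrite ?inE.
- exact: (measurable_preim (preserving_shift (- (2^-1 *: y0))).1 (measurable_eball d)).
- exact: mQ.
move=> y; rewrite /eball/= => yd.
have h2 : enorm (2^-1 *: y0) = l / 2 by rewrite enormZ ger0_norm ?invr_ge0// mulrC.
have yn : `|enorm y - l / 2| <= d by rewrite -h2 (le_trans (enorm_dist _ _)).
have /andP[y1 y2] : l / 2 - d <= enorm y <= l / 2 + d.
  by move: yn; rewrite ler_norml => /andP[? ?]; apply/andP; split; lra.
split => /=; last by apply: (le_trans y2); lra.
rewrite /cone/=.
have -> : enorm y *: y0 - l *: y = (enorm y - l / 2) *: y0 - l *: (y - 2^-1 *: y0).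
  by apply/rowP => i; rewrite !mxE; field.
apply: (le_trans (enormB _ _)); rewrite !enormZ -/l (gtr0_norm l_gt0).
have h3 : `|enorm y - l / 2| * l + l * enorm (y - 2^-1 *: y0) <= d * l + l * d.
  by apply: lerD; [apply: ler_wpM2r|apply: ler_wpM2l] => //; exact: ltW.
apply: (le_trans h3); apply: (@le_trans _ _ (eta * (l / 4))).
  have -> : d * l + l * d = 2 * d * l by ring.
  have -> : eta * (l / 4) = 2 * (eta / 8) * l by field.
  by apply: ler_wpM2r; [exact: ltW|rewrite ler_pM2l].
by apply: ler_wpM2l; [exact: ltW|lra].
Qed.

(** By homogeneity the shell has [(1 + e) ^+ n.+1 - 1 >= e] times the volume of the truncated cone.
    A volume of first order in [e] is what the second order of [beta ^+ 2] has to beat. *)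
Lemma cone_shell eta e : 0 < eta -> 0 < e ->
  exists A : set E, [/\ measurable A, (L A < +oo)%E,
    e * fine (Qvol eta) <= fine (L A) &
    forall y, A y -> [/\ cone eta y, l < enorm y & enorm y <= l * (1 + e)]].
Proof.
move=> eta0 e0; pose A := (cone eta `&` eball (l * (1 + e))) `\` (cone eta `&` eball l).
have mA : measurable A by apply: measurableD; exact: mQ.
have Aoo : (L A < +oo)%E.
  apply: (@le_lt_trans _ _ (L (cone eta `&` eball (l * (1 + e))))); last exact: Qoo.
  by apply: le_measure; rewrite ?inE; [exact: mA|exact: mQ|exact: subDsetl].
exists A; split => //.
  have sub : cone eta `&` eball l `<=` cone eta `&` eball (l * (1 + e)).
    move=> y [cy yl]; split => //; rewrite /eball/=; apply: (le_trans yl).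
    by rewrite ler_pMr// lerDl ltW.
  have -> : fine (L A) = ((1 + e) ^+ n.+1 - 1) * fine (Qvol eta).
    rewrite /A (measureD (mQ eta (l * (1 + e))) (mQ eta l) (Qoo eta _)).
    have e10 : 0 < 1 + e by lra.
    rewrite (setIidr sub) [X in fine (X - _)%E](cone_vol_scale eta e10).
    rewrite [X in fine (_ - X)%E](_ : _ = Qvol eta)//.
    have /fineK <- : Qvol eta \is a fin_num by rewrite ge0_fin_numE; [exact: Qoo|].
    by rewrite -EFinM -EFinB/= mulrBl mul1r.
  apply: ler_wpM2r; first exact/ltW/cone_vol_gt0.
  have : 1 + e <= (1 + e) ^+ n.+1 by rewrite exprS ler_peMr ?exprn_ege1//; lra.
  lra.
move=> y [[cy yl]] nA; split => //; rewrite ltNge; apply/negP => yl'; exact: nA.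
Qed.

Lemma cone_density eta e : beta y0 = 0 -> 0 < eta -> 0 < e -> e <= 1 ->
  exists g : E -> R, [/\ RB g, forall y, 0 <= g y, \int[L]_y g y = 1,
    forall y, g y != 0 -> enorm (y - y0) <= 2 * eta + e * l &
    \int[L]_y ((g y * beta y) ^+ 2) <= (V * l) ^+ 2 / fine (Qvol eta) * e].
Proof.
move=> b0 eta0 e0 e1; have [A [mA Aoo eA AP]] := cone_shell eta0 e0.
have q0 := cone_vol_gt0 eta0.
set a := fine (L A) in eA; have a0 : 0 < a by apply: lt_le_trans eA; rewrite mulr_gt0.
have RA : RB (\1_A : E -> R).
  split; first exact: measurable_indic.
    by exists 1 => x; rewrite indicE; case: (_ \in _) => /=; rewrite ?normr1 ?normr0.
  exists (l * (1 + e)) => y ly; rewrite indicE memNset//= => /AP[_ _].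
  by rewrite leNgt ly.
have aV : 0 <= a^-1 by rewrite invr_ge0 ltW.
exists (fun y => a^-1 * \1_A y); split.
- exact: RBZ.
- by move=> y; rewrite mulr_ge0// indicE.
- by rewrite (bfs_intZ _ (RB_bfs RA)) int_indic// -/a mulVf// gt_eqF.
- move=> y; rewrite indicE; have [/set_mem Ay _|_] := boolP (y \in A); last by rewrite mulr0 eqxx.
  have [cy ly yl] := AP _ Ay; exact: cone_near (ltW eta0) cy ly yl e1.
pose K := (V * (e * l)) ^+ 2.
have V0 : 0 < V := bvol_gt0.
have pt y : (a^-1 * \1_A y * beta y) ^+ 2 <= (a^-1 ^+ 2 * K) * \1_A y.
  rewrite indicE; have [/set_mem Ay|_] := boolP (y \in A); last first.
    by rewrite !mulr0 mul0r expr0n.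
  rewrite !mulr1 exprMn; apply: ler_wpM2l; first exact: sqr_ge0.
  have [cy ly yl] := AP _ Ay.
  rewrite /K -(real_normK (num_real (beta y))) ler_sqr ?nnegrE ?mulr_ge0 ?(ltW V0) ?(ltW e0) ?(ltW l_gt0)//.
  have := beta_lip y y0; rewrite b0 subr0 => /le_trans; apply.
  apply: ler_wpM2l; first exact: ltW.
  rewrite -/l ger0_norm ?subr_ge0 ?(ltW ly)// lerBlDl.
  by apply: (le_trans yl); rewrite mulrDr mulr1 (mulrC l e).
have mk0 : measurable_fun setT (fun w : E * E => cos (dotv w.1 w.2)).
  by apply: measurable_cosL; exact: measurable_fun_dotv.
have kb0 : exists K : R, forall w : E * E, `|cos (dotv w.1 w.2)| <= K.
  by exists 1 => w; exact: cos_max.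
have [_ _ Rgb] := kernel_fubini (RB_ball 1) (RBZ a^-1 RA) mk0 kb0.
apply: (le_trans (bfs_int_le (RB_bfs (RB_sqr Rgb)) (RB_bfs (RBZ _ RA)) pt)).
rewrite (bfs_intZ _ (RB_bfs RA)) int_indic// -/a.
have -> : a^-1 ^+ 2 * K * a = (V * l) ^+ 2 * (e ^+ 2 / a) by rewrite /K; field; rewrite gt_eqF.
rewrite -mulrA; apply: ler_wpM2l; first exact: sqr_ge0.
rewrite ler_pdivrMr// -[leRHS]mulrA [leRHS]mulrC ler_pdivlMr// expr2 -mulrA.
by apply: ler_wpM2l => //; exact: ltW.
Qed.

End cone.

Section plane_waves.
Context {R : realType}.
Variable n : nat.
Local Notation L := (@lebesgue_rV R n.+1).
Local Notation E := 'rV[R]_n.+1.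
Local Notation V := (bvol R n.+1).

Lemma RB_wave rho (y0 : E) t : RB (fun x => \1_(eball rho) x * cos (dotv x y0 + t)).
Proof. exact: RB_trig (RB_ball rho). Qed.

Lemma rigid_wave rho (y0 : E) t : 0 < rho -> y0 != 0 -> beta y0 = 0 ->
  rigid rho (fun x => \1_(eball rho) x * cos (dotv x y0 + t)).
Proof.
move=> rho0 y00 b0; split; first exact: RB_wave.
move=> e e0; set l := enorm y0.
have l0 : 0 < l by rewrite lt_neqAle enorm_ge0 eq_sym enorm_eq0 y00.
have V0 : 0 < V := bvol_gt0.
pose v := fine (L (eball rho)).
have v0 : 0 <= v by apply: fine_ge0.
pose K1 := 2 * (V ^+ 2 * (rho ^+ 2 * v)).
have K10 : 0 <= K1.
  rewrite /K1; apply: mulr_ge0 => //; apply: (mulr_ge0 (sqr_ge0 _)).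
  exact: mulr_ge0 (sqr_ge0 _) v0.
(* Frequencies within [3 * eta] of [y0] give waves within [rho * (3 * eta)] on the ball, at a cost
   [9 * K1 * eta ^+ 2]; [eta <= 1] reduces the square to a first power, and [K1 + 1] avoids a
   division by zero. *)
pose eta := Num.min 1 (e / (2 * (9 * (K1 + 1)))).
have K1p : 0 < K1 + 1 by exact: ltr_wpDl.
have eta0 : 0 < eta by rewrite lt_min ltr01/= divr_gt0// mulr_gt0// mulr_gt0.
have eta1 : eta <= 1 by rewrite ge_min lexx.
have eta2 : eta <= e / (2 * (9 * (K1 + 1))) by rewrite ge_min lexx orbT.
pose q := fine (L (cone y0 eta `&` eball l)).
have q0 : 0 < q by exact: cone_vol_gt0.
pose C := ((10 * pi) ^+ n.+1 : R).
have C0 : 0 <= C by rewrite exprn_ge0// mulr_ge0// pi_ge0.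
pose K2 := 4 * (C * ((V * l) ^+ 2 / q)).
have K20 : 0 <= K2.
  rewrite /K2; apply: mulr_ge0 => //; apply: (mulr_ge0 C0).
  exact: divr_ge0 (sqr_ge0 _) (ltW q0).
(* Chosen after [eta]: the energy bound divides by [q], the volume of the cone of opening [eta]. *)
pose ep := Num.min 1 (Num.min (eta / l) (e / (4 * (K2 + 1)))).
have K2p : 0 < K2 + 1 by exact: ltr_wpDl.
have ep0 : 0 < ep by rewrite !lt_min ltr01/= divr_gt0//= divr_gt0// mulr_gt0.
have ep1 : ep <= 1 by rewrite ge_min lexx.
have ep2 : ep * l <= eta by rewrite -ler_pdivlMr// !ge_min lexx orbT.
have ep3 : ep <= e / (4 * (K2 + 1)) by rewrite !ge_min lexx !orbT.
have [g [Rg g0 g1 gn gb]] := cone_density y00 b0 eta0 ep0 ep1.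
have e8 : 0 < e / 8 by rewrite divr_gt0.
have ap := approximable_superposition t rho0 e8 Rg.
have mk : measurable_fun setT (fun w : E * E => cos (dotv w.1 w.2 + t)).
  apply: measurable_cosL; apply: measurable_funD => //.
  exact: measurable_fun_dotv.
have kb : exists K : R, forall w : E * E, `|cos (dotv w.1 w.2 + t)| <= K.
  by exists 1 => w; exact: cos_max.
have [_ Rphi _] := kernel_fubini (RB_ball rho) Rg mk kb.
apply: approximable_le (approximable_close (RB_wave rho y0 t) Rphi ap).
have d0 : 0 <= (rho * (3 * eta)) ^+ 2 by exact: sqr_ge0.
have dif x : (\1_(eball rho) x * cos (dotv x y0 + t) -
      \1_(eball rho) x * \int[L]_y (g y * cos (dotv x y + t))) ^+ 2 <=
    (rho * (3 * eta)) ^+ 2 * \1_(eball rho) x.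
  rewrite indicE; have [/set_mem xr|_] := boolP (x \in _); last first.
    by rewrite !mul0r subrr expr0n mulr0.
  rewrite !mul1r mulr1.
  have Rgx : RB (fun y => g y * cos (dotv x y + t)).
    by move: (RB_trig x t Rg); congr RB; apply/funext => y; rewrite dotvC.
  (* As [g] has mass [1], the error is an average of differences of two waves. *)
  have -> : cos (dotv x y0 + t) = \int[L]_y (cos (dotv x y0 + t) * g y).
    by rewrite (bfs_intZ _ (RB_bfs Rg)) g1 mulr1.
  have Rgc := RBZ (cos (dotv x y0 + t)) Rg.
  rewrite -(bfs_intB (RB_bfs Rgc) (RB_bfs Rgx)).
  rewrite -(real_normK (num_real (\int[L]_y _))) ler_sqr ?nnegrE//; last first.
    by rewrite mulr_ge0 ?(ltW rho0)// mulr_ge0// ltW.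
  have bB := RB_bfs (RBB Rgc Rgx).
  apply: (le_trans (bfs_int_norm bB)).
  rewrite -[leRHS]mulr1 -[X in _ <= _ * X]g1 -(bfs_intZ _ (RB_bfs Rg)).
  apply: (bfs_int_le (bfs_norm bB) (RB_bfs (RBZ _ Rg))) => y.
  rewrite (mulrC (cos _)) -mulrBr normrM (ger0_norm (g0 y)) mulrC.
  have [->|gy] := eqVneq (g y) 0; first by rewrite !mulr0.
  apply: ler_wpM2r => //; apply: (le_trans (cos_norm_lip _ _)).
  rewrite opprD addrACA subrr addr0 -dotvBr; apply: (le_trans (dotv_norm_le _ _)).
  apply: ler_pM; [exact: enorm_ge0|exact: enorm_ge0|exact: xr|].
  rewrite enorm_distC; apply: (le_trans (gn y gy)).
  by rewrite (_ : 3 * eta = 2 * eta + eta) ?lerD2l//; ring.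
have Rdif := RB_sqr (RBB (RB_wave rho y0 t) Rphi).
have I1 := bfs_int_le (RB_bfs Rdif) (RB_bfs (RBZ _ (RB_ball rho))) dif.
rewrite (bfs_intZ _ (RB_bfs (RB_ball rho))) int_indic in I1; last exact: measurable_eball.
have q2 : 0 <= 2 :> R by [].
apply: (le_trans (lerD (ler_wpM2l q2 (ler_wpM2l (sqr_ge0 V) I1))
  (ler_wpM2l q2 (lerD (ler_wpM2l q2 (ler_wpM2l C0 gb)) (lexx _))))).
have -> : 2 * (V ^+ 2 * ((rho * (3 * eta)) ^+ 2 * fine (L (eball rho)))) =
    9 * K1 * eta ^+ 2 by rewrite -/v /K1; ring.
have -> : 2 * (2 * (C * ((V * l) ^+ 2 / q * ep)) + e / 8) = K2 * ep + e / 4.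
  by rewrite /K2; field; rewrite gt_eqF.
have h1 : 9 * K1 * eta ^+ 2 <= e / 2.
  have ee : eta * eta <= eta by rewrite ler_piMl// ltW.
  have hh : K1 * (eta * eta) <= (K1 + 1) * eta.
    apply: (le_trans (ler_wpM2l K10 ee)).
    by apply: ler_wpM2r; [exact: ltW|rewrite lerDl].
  have -> : 9 * K1 * eta ^+ 2 = 9 * (K1 * (eta * eta)) by ring.
  move: eta2; rewrite ler_pdivlMr ?mulr_gt0//.
  have -> : eta * (2 * (9 * (K1 + 1))) = 18 * ((K1 + 1) * eta) by ring.
  by move: hh; set u := K1 * _; set w := _ * eta; lra.
have h2 : K2 * ep <= e / 4.
  apply: (@le_trans _ _ ((K2 + 1) * ep)); first by apply: ler_wpM2r; [exact: ltW|lra].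
  by move: ep3; rewrite ler_pdivlMr ?mulr_gt0//; lra.
by move: h1 h2; set u := 9 * _ * _; set w := K2 * _; lra.
Qed.

End plane_waves.

(** * Lagrange interpolation of waves in the frequency *)

Section interpolation.
Context {R : realType}.

Lemma rolle_path (f df : R -> R) (x : R) (s : seq R) :
  (forall u, is_derive u (1 : R) f (df u)) -> path <%R x s -> f x = 0 ->
  (forall u, u \in s -> f u = 0) ->
  exists s' : seq R, [/\ size s' = size s, all (fun u => x < u) s',
    sorted <%R s' & forall u, u \in s' -> df u = 0].
Proof.
move=> dff; have cf := is_derive_continuous dff.
elim: s x => [|y s IHs] x /=; first by exists [::].
move=> /andP[xy ys] fx fs.
have fy : f y = 0 by apply: fs; rewrite mem_head.
have [s' [ss' ys' os' fs']] := IHs y ys fy (fun u us => fs u (mem_behead (s := y :: s) us)).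
have drv u : u \in `]x, y[ -> derivable f u 1 by move=> _; have [] := dff u.
have [|c] := Rolle xy drv (continuous_subspaceT cf); first by rewrite fx fy.
rewrite in_itv/= => /andP[xc cy] dc.
have cs' : all (fun u => c < u) s'.
  by apply: sub_all ys' => u; exact: lt_trans.
exists (c :: s'); split => /=.
- by rewrite ss'.
- by rewrite xc/=; apply: sub_all cs' => u; exact: lt_trans.
- by rewrite path_min_sorted.
- move=> u; rewrite in_cons => /predU1P[->|]; last exact: fs'.
  by have [_ <-] := dff c; have [_ ->] := dc.
Qed.

Lemma rolle_iter (D : nat -> R -> R) (n k : nat) (s : seq R) :
  (forall j u, is_derive u (1 : R) (D j) (D j.+1 u)) ->
  sorted <%R s -> size s = n.+1 -> (forall u, u \in s -> D k u = 0) ->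
  exists u, D (k + n)%N u = 0.
Proof.
move=> dD; elim: n k s => [|n IHn] k [//|x s] os ss zs.
  by exists x; rewrite addn0 zs// mem_head.
have zx : D k x = 0 by rewrite zs// mem_head.
have [s' [ss' _ os' zs']] := rolle_path (dD k) os zx
  (fun u us => zs u (mem_behead (s := x :: s) us)).
have [|u Du] := IHn k.+1 s' os' _ zs'; first by rewrite ss'; case: ss.
by exists u; rewrite addnS -addSn.
Qed.

Lemma derivn_top (p : {poly R}) m : (size p <= m.+1)%N ->
  p^`(m) = (p`_m *+ m`!)%:P.
Proof.
move=> sp; apply/polyP => i; rewrite coef_derivn coefC.
case: i => [|i]; first by rewrite addn0 ffactnn.
by rewrite nth_default ?mul0rn// (leq_trans sp)// addnS ltnS leq_addr.
Qed.

(** The value at [x] of Lagrange's basis polynomial for the node [u], the list [ts] being without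
    repetition. *)
Definition lagrange (ts : seq R) (x : R) (u : R) : R :=
  \prod_(v <- rem u ts) ((x - v) / (u - v)).

Lemma is_derive_phase (s t : R) (k : nat) (x : R) :
  is_derive x (1 : R) (fun u => s ^+ k * cos (u * s + (t + pi / 2 *+ k)))
    (s ^+ k.+1 * cos (x * s + (t + pi / 2 *+ k.+1))).
Proof.
have h := is_derive_cosL s (t + pi / 2 *+ k) x.
have -> : x * s + (t + pi / 2 *+ k.+1) = x * s + (t + pi / 2 *+ k) + pi / 2.
  by rewrite mulrSr !addrA.
rewrite cosDpihalf.
by apply: is_derive_eq; rewrite /GRing.scale/= exprS; ring.
Qed.

(** The classical remainder. The difference [D 0] between the wave and a polynomial vanishes at the
    nodes and at [x]; by repeated use of Rolle's theorem its derivative of order [m] vanishes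
    somewhere, and there the derivative of the wave is at most [|s| ^ m]. *)
Lemma lagrange_error (ts : seq R) (x s t : R) : uniq ts -> x \notin ts ->
  `|cos (x * s + t) - \sum_(u <- ts) lagrange ts x u * cos (u * s + t)| <=
  `|s| ^+ size ts * \prod_(u <- ts) `|x - u| / (size ts)`!%:R.
Proof.
move=> uts xts; set m := size ts.
pose F k u : R := s ^+ k * cos (u * s + (t + pi / 2 *+ k)).
have F0 u : F 0%N u = cos (u * s + t) by rewrite /F expr0 mul1r mulr0n addr0.
pose l u : {poly R} := \prod_(v <- rem u ts) ((u - v)^-1 *: ('X - v%:P)).
pose w : {poly R} := \prod_(v <- ts) ('X - v%:P).
have wE y : w.[y] = \prod_(u <- ts) (y - u).
  by rewrite /w horner_prod; apply: eq_bigr => u _; rewrite hornerXsubC.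
have lE u y : (l u).[y] = lagrange ts y u.
  rewrite /l horner_prod; apply: eq_bigr => v _.
  by rewrite hornerZ hornerXsubC mulrC.
have wx : w.[x] != 0.
  rewrite wE prodf_seq_neq0; apply/allP => u uts'; apply/implyP => _.
  by rewrite subr_eq0; apply: contraNneq xts => ->.
set e := cos (x * s + t) - _.
(* The multiple of the nodal polynomial that adds [x] to the points of interpolation; [K] is also
   all that survives [m] derivations, up to the factor [m!]. *)
pose K := e / w.[x].
pose p : {poly R} := \sum_(u <- ts) F 0%N u *: l u + K *: w.
pose D k u := F k u - (p^`(k)).[u].
have dD j u : is_derive u (1 : R) (D j) (D j.+1 u).
  have h1 : is_derive u (1 : R) (F j) (F j.+1 u) by exact: is_derive_phase.
  have h2 := is_derive_poly p^`(j) u.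
  by rewrite /D derivnS; exact: is_deriveB.
have lagr u v : u \in ts -> v \in ts -> lagrange ts v u = (u == v)%:R.
  move=> uu vv; have [<-|uv] := eqVneq u v.
    rewrite /lagrange big_seq big1// => z; rewrite (mem_rem_uniq _ uts) inE => /andP[zu _].
    by rewrite divff// subr_eq0 eq_sym.
  apply/eqP; rewrite /lagrange prodf_seq_eq0; apply/hasP; exists v.
    by rewrite (mem_rem_uniq _ uts) inE eq_sym uv.
  by rewrite subrr mul0r eqxx.
have pE y : p.[y] = \sum_(u <- ts) F 0%N u * lagrange ts y u + K * w.[y].
  rewrite hornerD hornerZ; congr (_ + _).
  by rewrite horner_sum; apply: eq_bigr => u _; rewrite hornerZ lE.
have z1 u : u \in ts -> D 0%N u = 0.
  move=> uu; rewrite /D derivn0 pE wE.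
  have -> : \prod_(v <- ts) (u - v) = 0.
    by apply/eqP; rewrite prodf_seq_eq0; apply/hasP; exists u; rewrite ?subrr ?eqxx.
  rewrite mulr0 addr0 (bigD1_seq u)//= lagr// eqxx mulr1 big1_seq ?addr0 ?subrr//.
  move=> v /andP[vu vv]; rewrite lagr// (negbTE vu) mulr0//.
have z2 : D 0%N x = 0.
  rewrite /D derivn0 pE /K divfK// F0 /e.
  under eq_bigr do rewrite F0 mulrC.
  by rewrite [X in _ - X]addrC subrK subrr.
pose ss := sort <=%R (x :: ts).
have oss : sorted <%R ss.
  rewrite sort_lt_sorted; first by rewrite /= xts.
have sss : size ss = m.+1 by rewrite size_sort.
have [|u] := rolle_iter dD oss sss (k := 0%N).
  by move=> u; rewrite mem_sort in_cons => /predU1P[->|]; [exact: z2|exact: z1].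
rewrite add0n /D => /eqP; rewrite subr_eq0 => /eqP Fm.
have sl v : v \in ts -> (size (l v) <= m)%N.
  move=> vts; rewrite /l scaler_prod (leq_trans (size_scale_leq _ _))//.
  by rewrite size_prod_XsubC size_rem// prednK// /m; case: (ts) vts.
have sw : size w = m.+1 by rewrite /w size_prod_XsubC.
have pm : p^`(m) = (K *+ m`!)%:P.
  rewrite /p derivnD derivnZ linear_sum/= big1_seq ?add0r.
    rewrite derivn_top ?sw// -mul_polyC -polyCM; congr _%:P.
    have : w \is monic by exact: monic_prod_XsubC.
    by rewrite monicE lead_coefE sw/= => /eqP ->; rewrite mulr_natr.
  by move=> v /andP[_ vts]; rewrite derivnZ derivn_poly0 ?scaler0// sl.
rewrite pm hornerC in Fm.
have m0 : 0 < m`!%:R :> R by rewrite ltr0n fact_gt0.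
rewrite ler_pdivlMr//.
have -> : `|e| * m`!%:R = `|w.[x]| * `|F m u|.
  have -> : F m u = K * m`!%:R by rewrite Fm mulr_natr.
  rewrite normrM (ger0_norm (ltW m0)) mulrA; congr (_ * _).
  by rewrite /K normrM normfV mulrCA divff ?mulr1 // normr_eq0.
rewrite mulrC; apply: ler_pM => //.
  by rewrite /F normrM normrX ler_piMr ?exprn_ge0// cos_max.
by rewrite wE normr_prod.
Qed.

Lemma exprn_small (p M e : R) : 0 <= p < 1 -> 0 < e -> exists j, p ^+ j * M <= e.
Proof.
move=> /andP[p0 p1] e0; have [M0|M0] := leP M 0.
  by exists 0%N; rewrite expr0 mul1r (le_trans M0)// ltW.
have np : `|p| < 1 by rewrite ger0_norm.
have /cvgrPdist_le/(_ (e / M))[|N _ HN] := cvg_expr np; first exact: divr_gt0.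
exists N; have := HN N (leqnn N); rewrite /= sub0r normrN -ler_pdivlMr//.
by rewrite ger0_norm ?exprn_ge0.
Qed.

(* The ratio of consecutive terms tends to [(l rho / 2) ^ 2 < 1]. *)
Lemma node_product_small (l rho e : R) (K : nat) : 0 < l -> 0 < rho ->
  l * rho < 2 -> 0 < e ->
  exists N, (\prod_(m < N) (l * (m.+1 + K)%:R) ^+ 2) * rho ^+ N.*2 / (N.*2)`!%:R <= e.
Proof.
move=> l0 rho0 lr e0; set q := l * rho in lr.
have q0 : 0 < q by exact: mulr_gt0.
pose E N : R := (\prod_(m < N) (l * (m.+1 + K)%:R) ^+ 2) * rho ^+ N.*2 / (N.*2)`!%:R.
pose p := (q / 2 + 1) / 2.
have p0 : 0 < p by rewrite /p; lra.
have p1 : p < 1 by rewrite /p; lra.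
have qp : q < 2 * p by rewrite /p; lra.
have E0 N : 0 <= E N.
  rewrite /E divr_ge0// mulr_ge0 ?exprn_ge0 ?(ltW rho0)//.
  by apply: prodr_ge0 => m _; exact: sqr_ge0.
have ES N : E N.+1 = E N * ((q * (N.+1 + K)%:R) ^+ 2 / (N.*2.+1 * N.*2.+2)%:R).
  rewrite /E big_ord_recr/= doubleS !factS !natrM !exprS /q.
  field.
  apply/and3P; split; last by rewrite pnatr_eq0 -lt0n fact_gt0.
    by rewrite gt_eqF// ltr_wpDr.
  by rewrite gt_eqF// ltr_wpDr.
have c0 : 0 <= (q * K%:R + p) / (2 * p - q).
  apply: divr_ge0; last by move: (qp); lra.
  by rewrite addr_ge0 ?(ltW p0)// mulr_ge0 ?(ltW q0).
(* From this index on [q * (N.+1 + K) <= p * N.*2.+1], so the ratio of consecutive terms is at most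
   [p ^+ 2]; this is possible since [q < 2 * p]. *)
pose N0 := Num.bound ((q * K%:R + p) / (2 * p - q)).
have step N : (N0 <= N)%N -> E N.+1 <= p ^+ 2 * E N.
  move=> NN; rewrite ES mulrC; apply: ler_wpM2r => //.
  rewrite ler_pdivrMr ?ltr0n// natrM.
  have b : q * (N.+1 + K)%:R <= p * N.*2.+1%:R.
    have : (q * K%:R + p) / (2 * p - q) <= N.+1%:R.
      by rewrite ltW// (lt_le_trans (archi_boundP c0))// ler_nat (leq_trans NN).
    have -> : (N.+1 + K)%:R = N.+1%:R + K%:R :> R by rewrite natrD.
    have -> : N.*2.+1%:R = 2 * N.+1%:R - 1 :> R.
      by rewrite -[N.*2.+1%:R]natr1 -[N.+1%:R]natr1 -muln2 natrM; lra.
    rewrite ler_pdivrMr ?subr_gt0//; set x := N.+1%:R; set y := K%:R; lra.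
  have b0 : 0 <= q * (N.+1 + K)%:R by rewrite mulr_ge0// ltW.
  apply: (@le_trans _ _ ((p * N.*2.+1%:R) ^+ 2)).
    by rewrite ler_sqr ?nnegrE// mulr_ge0// ltW.
  rewrite exprMn; apply: ler_wpM2l; first exact: sqr_ge0.
  by rewrite expr2; apply: ler_wpM2l => //; rewrite ler_nat.
have geo j : E (N0 + j)%N <= (p ^+ 2) ^+ j * E N0.
  elim: j => [|j IHj]; first by rewrite addn0 expr0 mul1r.
  rewrite addnS (le_trans (step _ (leq_addr _ _)))// [(p ^+ 2) ^+ j.+1]exprS -mulrA.
  by apply: ler_wpM2l => //; exact: sqr_ge0.
have p2 : 0 <= p ^+ 2 < 1.
  by rewrite sqr_ge0/= expr_lt1// ltW.
have [j pj] := exprn_small (E N0) p2 e0.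
by exists (N0 + j)%N; exact: le_trans (geo j) pj.
Qed.

(* Lagrange interpolation at the first nodes [+- z m], which are dense enough
   for the error bound to tend to [0]. *)
Lemma wave_interpolation (l rho A x e : R) (z : nat -> R) : 0 < l -> 0 < rho ->
  l * rho < 2 -> 0 < A -> (forall m, A + l * m%:R < z m < A + l * m.+1%:R) ->
  0 < e -> (forall m, x != z m) -> (forall m, x != - z m) ->
  exists (ts : seq R) (c : R -> R),
    (forall u, u \in ts -> exists m, u = z m \/ u = - z m) /\
    forall s t, `|s| <= rho ->
      `|cos (x * s + t) - \sum_(u <- ts) c u * cos (u * s + t)| <= e.
Proof.
move=> l0 rho0 lr A0 zP e0 xz xNz.
have zpos m : 0 < z m.
  have /andP[zm _] := zP m; apply: lt_trans zm.
  by rewrite ltr_wpDr// mulr_ge0// ltW.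
have zlt m k : (m < k)%N -> z m < z k.
  move=> mk; have /andP[_ z1] := zP m; have /andP[z2 _] := zP k.
  apply: (lt_trans z1); apply: le_lt_trans z2; rewrite lerD2l.
  by apply: ler_wpM2l; [exact: ltW|rewrite ler_nat].
have zinj : injective z.
  move=> m k zmk; have [mk|km|//] := ltngtP m k.
    by move: (zlt _ _ mk); rewrite zmk ltxx.
  by move: (zlt _ _ km); rewrite zmk ltxx.
have c0 : 0 <= (`|x| + A) / l by rewrite divr_ge0 ?addr_ge0// ltW.
(* [l * K] exceeds [|x| + A], hence [|x| + z m <= l * (m.+1 + K)], and this bounds both factors
   [|x - z m|] and [|x + z m|]. *)
pose K := Num.bound ((`|x| + A) / l).
have [N NE] := node_product_small K l0 rho0 lr e0.
pose ts := map z (iota 0 N) ++ map (fun m => - z m) (iota 0 N).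
have uts : uniq ts.
  rewrite cat_uniq !map_inj_uniq ?iota_uniq ?andbT//=; last first.
    by move=> m k /oppr_inj/zinj.
  apply/hasPn => u /mapP[m _ ->]; apply/negP => /mapP[k _ mk].
  by have := zpos m; have := zpos k; rewrite -mk; lra.
have xts : x \notin ts.
  rewrite mem_cat negb_or; apply/andP; split.
    by apply/mapP => -[m _ xm]; have := xz m; rewrite xm eqxx.
  by apply/mapP => -[m _ xm]; have := xNz m; rewrite xm eqxx.
have sts : size ts = N.*2 by rewrite size_cat !size_map size_iota addnn.
exists ts, (lagrange ts x); split.
  by move=> u; rewrite mem_cat => /orP[] /mapP[m _ ->]; exists m; [left|right].
move=> s t srho; apply: (le_trans (lagrange_error _ _ uts xts)).
apply: le_trans NE; rewrite sts; apply: ler_wpM2r; first by rewrite invr_ge0.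
rewrite mulrC; apply: ler_pM; rewrite ?exprn_ge0//.
- by apply: prodr_ge0.
- rewrite big_cat/= !big_map -big_split/=.
  have -> : iota 0 N = index_iota 0 N by rewrite /index_iota subn0.
  rewrite big_mkord.
  apply: ler_prod => m _; rewrite mulr_ge0//= opprK expr2.
  have zm : `|x| + z m <= l * (m.+1 + K)%:R.
    have : (`|x| + A) / l <= K%:R by rewrite ltW// archi_boundP.
    rewrite ler_pdivrMr// natrD mulrDr (mulrC K%:R).
    by have /andP[_ ] := zP m; set y := `|x|; set y' := l * _; set y'' := l * _; lra.
  have zn : `|z m| = z m by rewrite gtr0_norm.
  by rewrite -{1}zn in zm; apply: ler_pM => //; apply: le_trans zm;
    [exact: ler_normB|exact: ler_normD].
- by apply: lerXn2r; rewrite ?nnegrE// ltW.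
Qed.

End interpolation.

(** * Rigidity of all plane waves *)

Section all_waves.
Context {R : realType}.
Variable n : nat.
Local Notation L := (@lebesgue_rV R n.+1).
Local Notation E := 'rV[R]_n.+1.
Implicit Types (a b g : E -> R) (x y z : E).

Lemma rigid_uniform_close rho a : RB a ->
  (forall e : R, 0 < e -> exists2 a', rigid rho a' &
    forall x, `|a x - a' x| <= e * \1_(eball rho) x) -> rigid rho a.
Proof.
move=> Ra H; apply: (rigid_close Ra) => e e0.
pose v := fine (L (eball rho)).
have v0 : 0 <= v by exact: fine_ge0.
have v1 : 0 < v + 1 by exact: ltr_wpDl.
pose c := Num.sqrt (e / (v + 1)).
have c0 : 0 < c by rewrite sqrtr_gt0 divr_gt0.
have [a' ra' aa'] := H c c0; exists a' => //; have [Ra' _] := ra'.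
have le x : (a x - a' x) ^+ 2 <= c ^+ 2 * \1_(eball rho) x.
  have := aa' x; rewrite indicE; case: (x \in _); rewrite ?mulr1 ?mulr0 => h.
    by rewrite -real_normK ?num_real// ler_sqr ?nnegrE// ltW.
  by have /eqP -> : a x - a' x == 0 by [rewrite -normr_le0]; rewrite expr0n.
apply: (le_trans (bfs_int_le (RB_bfs (RB_sqr (RBB Ra Ra')))
  (RB_bfs (RBZ _ (RB_ball rho))) le)).
rewrite (bfs_intZ _ (RB_bfs (RB_ball rho))) int_indic; last exact: measurable_eball.
rewrite sqr_sqrtr; last by rewrite divr_ge0// ltW.
rewrite -/v -mulrA ger_pMr// mulrC ler_pdivrMr// mul1r.
by rewrite lerDl.
Qed.

Lemma rigid_sum rho (I : eqType) (s : seq I) (F : I -> E -> R) :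
  (forall i, i \in s -> rigid rho (F i)) ->
  rigid rho (fun x => \sum_(i <- s) F i x).
Proof.
elim: s => [|i s IHs] h.
  rewrite (_ : (fun _ => _) = fun=> 0); first exact: rigid0.
  by apply/funext => x; rewrite big_nil.
rewrite (_ : (fun _ => _) = fun x => F i x + \sum_(j <- s) F j x).
  apply: rigidD; first by apply: h; rewrite mem_head.
  by apply: IHs => j js; apply: h; rewrite in_cons js orbT.
by apply/funext => x; rewrite big_cons.
Qed.

Lemma unit_direction y : exists2 th : E, enorm th = 1 & y = enorm y *: th.
Proof.
have [->|y0] := eqVneq y 0.
  by exists (axis n 1); rewrite ?enorm_axis ?normr1// enorm0 scale0r.
exists ((enorm y)^-1 *: y).
  by rewrite enormZ normfV ger0_norm ?enorm_ge0// mulVf// enorm_eq0.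
by rewrite scalerA divff ?scale1r// enorm_eq0.
Qed.

(** Along a fixed unit vector [th] a wave is a function of [s = dotv x th], with [|s| <= rho] on the
    ball, so interpolation in one real frequency suffices. All the nodes are zeros of [beta] because
    it is radial. *)
Lemma rigid_all_waves rho y t : 0 < rho -> rho < 2 / pi ->
  rigid rho (fun x => \1_(eball rho) x * cos (dotv x y + t)).
Proof.
move=> rho0 rho1; have pi0 : 0 < pi :> R by exact: pi_gt0.
have r1 : pi < 2 / rho by rewrite ltr_pdivlMr// mulrC -ltr_pdivlMr.
(* A spacing strictly between [pi], required for the zeros, and [2 / rho], required for the
   interpolation; there is room precisely because [rho < 2 / pi]. *)
pose l := (pi + 2 / rho) / 2.
have l1 : pi < l by rewrite /l ltr_pdivlMr// mulr_natr mulr2n ltrD2l.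
have l0 : 0 < l by exact: lt_trans pi0 l1.
have lr : l * rho < 2.
  have -> : l * rho = (pi * rho + 2) / 2 by rewrite /l; field; rewrite gt_eqF.
  rewrite ltr_pdivrMr// [ltRHS]mulr_natr mulr2n ltrD2r.
  by rewrite mulrC -ltr_pdivlMr.
have [A A0 [z zP]] := slice_cos_zeros n l1.
have zA m : A + l * m%:R < z m < A + l * m.+1%:R by have [] := zP m.
have z0 m : 0 < z m.
  have /andP[zm _] := zA m; apply: lt_trans zm.
  by rewrite ltr_wpDr// mulr_ge0// ltW.
have [th th1 yth] := unit_direction y.
have node u : (exists m, u = z m \/ u = - z m) -> forall t',
    rigid rho (fun x => \1_(eball rho) x * cos (dotv x (u *: th) + t')).
  move=> [m um] t'.
  have nu : `|u| = z m by case: um => ->; rewrite ?normrN gtr0_norm.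
  apply: (rigid_wave _ rho0).
    by rewrite -enorm_eq0 enormZ th1 mulr1 nu gt_eqF.
  rewrite betaE enormZ th1 mulr1 nu beta_axis.
  by have [_ ->] := zP m; rewrite mulr0.
(* The interpolation estimate excludes the nodes, where the wave is already known to be rigid. *)
have [[m ym]|/forallNP yz] := pselect (exists m, enorm y = z m \/ enorm y = - z m).
  by rewrite yth; apply: node; exists m.
apply: rigid_uniform_close; first exact: RB_wave.
move=> e e0.
have yz1 m : enorm y != z m by apply/eqP => h; apply: (yz m); left.
have yz2 m : enorm y != - z m by apply/eqP => h; apply: (yz m); right.
have [ts [c [tsz tsc]]] := wave_interpolation l0 rho0 lr A0 zA e0 yz1 yz2.
exists (fun x => \sum_(u <- ts)
    c u * (\1_(eball rho) x * cos (dotv x (u *: th) + t))).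
  by apply: rigid_sum => u uts; apply: rigidZ; apply: node; exact: tsz.
move=> x; under eq_bigr do rewrite mulrCA.
rewrite -mulr_sumr -mulrBr normrM indicE mulrC.
have [/set_mem xr|_] := boolP (x \in _); last by rewrite normr0 !mulr0.
rewrite normr1 !mulr1 {1}yth dotvZr.
under eq_bigr do rewrite dotvZr.
apply: tsc; apply: (le_trans (dotv_norm_le _ _)).
by rewrite th1 mulr1.
Qed.

End all_waves.

(** * Density of trigonometric polynomials *)

Section step_power.
Context {R : realType}.

Lemma bernoulli_sub (u : R) k : 0 <= u <= 1 -> 1 - k%:R * u <= (1 - u) ^+ k.
Proof.
move=> /andP[u0 u1]; elim: k => [|k IHk]; first by rewrite mul0r subr0 expr0.
have v0 : 0 <= 1 - u by rewrite subr_ge0.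
rewrite exprS; apply: le_trans (ler_wpM2l v0 IHk).
rewrite -natr1 mulrDl mul1r mulrBr mulr1 mulrBl mul1r.
have : 0 <= u * (k%:R * u) by rewrite !mulr_ge0.
by lra.
Qed.

Lemma bernoulli_add (u : R) k : 0 <= u -> 1 + k%:R * u <= (1 + u) ^+ k.
Proof.
move=> u0; elim: k => [|k IHk]; first by rewrite mul0r addr0 expr0.
have v0 : 0 <= 1 + u by rewrite addr_ge0.
rewrite exprS; apply: le_trans (ler_wpM2l v0 IHk).
rewrite -natr1 mulrDl mul1r mulrDr mulr1 mulrDl mul1r.
have : 0 <= u * (k%:R * u) by rewrite !mulr_ge0.
by lra.
Qed.

Lemma step_power_itv (x : R) m : 0 <= x <= 1 -> 0 <= (1 - x ^+ m) ^+ (2 ^ m) <= 1.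
Proof.
move=> /andP[x0 x1]; have h : 0 <= 1 - x ^+ m by rewrite subr_ge0 exprn_ile1.
rewrite exprn_ge0//= exprn_ile1// gerBl exprn_ge0//.
Qed.

(** Known from elementary proofs of the Stone-Weierstrass theorem. Below [1 / 2], Bernoulli's
    inequality gives the lower bound [1 - (2 * x) ^+ m]. Above, the product with
    [(1 + x ^+ m) ^+ (2 ^ m) >= (2 * x) ^+ m] is at most [1]. *)
Lemma step_power_cvg (x : R) : 0 <= x <= 1 -> x != 1 / 2 ->
  (1 - x ^+ m) ^+ (2 ^ m) @[m --> \oo] --> ((x < 1 / 2)%R%:R : R).
Proof.
move=> /andP[x0 x1] xn; have xx : 0 <= x <= 1 by rewrite x0.
have xm m : 0 <= x ^+ m <= 1 by rewrite exprn_ge0// exprn_ile1.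
have [xl|xg|xe] := ltgtP x (1 / 2); last by rewrite xe eqxx in xn.
  have c : 1 - (2 * x) ^+ m @[m --> \oo] --> (1 : R).
    rewrite -[X in _ --> X]subr0; apply: cvgB; first exact: cvg_cst.
    by apply: cvg_expr; rewrite ger0_norm ?mulr_ge0//; lra.
  apply: squeeze_cvgr c (cvg_cst _); near=> m.
  have /andP[_ ->] := step_power_itv m xx; rewrite andbT.
  by rewrite exprMn -natrX; exact: bernoulli_sub.
have x2 : 1 < 2 * x by lra.
have x20 : 0 < 2 * x by exact: lt_trans x2.
have c : (2 * x)^-1 ^+ m @[m --> \oo] --> (0 : R).
  by apply: cvg_expr; rewrite ger0_norm ?invr_ge0 ?(ltW x20)// invf_lt1.
apply: squeeze_cvgr (cvg_cst _) c; near=> m.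
have /andP[q0 _] := step_power_itv m xx; rewrite q0/=.
rewrite exprVn -[leRHS]mul1r ler_pdivlMr ?exprn_gt0//.
have /andP[y0 y1] := xm m.
apply: (@le_trans _ _ ((1 - x ^+ m) ^+ (2 ^ m) * (1 + x ^+ m) ^+ (2 ^ m))).
  apply: ler_wpM2l => //; apply: le_trans (bernoulli_add _ y0).
  by rewrite exprMn -natrX lerDr.
rewrite -exprMn exprn_ile1//.
  by rewrite mulr_ge0 ?subr_ge0// addr_ge0.
rewrite (_ : _ * _ = 1 - (x ^+ m) ^+ 2); last by ring.
by rewrite gerBl sqr_ge0.
Unshelve. all: by end_near.
Qed.

End step_power.

Section trigonometric_polynomials.
Context {R : realType}.
Variable n : nat.
Local Notation E := 'rV[R]_n.+1.
Implicit Types (p q : E -> R) (x y z : E).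

Inductive trigpoly : (E -> R) -> Prop :=
| trigpoly_wave c y t : trigpoly (fun x => c * cos (dotv x y + t))
| trigpolyD p q : trigpoly p -> trigpoly q -> trigpoly (fun x => p x + q x).

Lemma trigpoly_cst (c : R) : trigpoly (fun=> c).
Proof.
have := trigpoly_wave c (0 *: (0 : E)) 0.
by congr trigpoly; apply/funext => x; rewrite dotvZr mul0r addr0 cos0 mulr1.
Qed.

Lemma trigpolyZ (k : R) p : trigpoly p -> trigpoly (fun x => k * p x).
Proof.
elim=> [c y t|p1 p2 _ h1 _ h2].
  rewrite (_ : (fun _ => _) = fun x => k * c * cos (dotv x y + t)).
    exact: trigpoly_wave.
  by apply/funext => x; rewrite mulrA.
rewrite (_ : (fun _ => _) = fun x => k * p1 x + k * p2 x).
  exact: trigpolyD.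
by apply/funext => x; rewrite mulrDr.
Qed.

Lemma trigpolyB p q : trigpoly p -> trigpoly q -> trigpoly (fun x => p x - q x).
Proof.
move=> tp tq; have := trigpolyD tp (trigpolyZ (- 1) tq).
by congr trigpoly; apply/funext => x; rewrite mulN1r.
Qed.

Lemma trigpolyM p q : trigpoly p -> trigpoly q -> trigpoly (fun x => p x * q x).
Proof.
elim=> [c y t|p1 p2 _ h1 _ h2] tq; last first.
  have := trigpolyD (h1 tq) (h2 tq).
  by congr trigpoly; apply/funext => x; rewrite mulrDl.
elim: tq => [c' y' t'|p1 p2 _ h1 _ h2]; last first.
  have := trigpolyD h1 h2.
  by congr trigpoly; apply/funext => x; rewrite mulrDr.
have := trigpolyD (trigpoly_wave (c * c' / 2) (y + y') (t + t'))
  (trigpoly_wave (c * c' / 2) (y - y') (t - t')).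
congr trigpoly; apply/funext => x; rewrite dotvDr dotvBr.
rewrite (_ : dotv x y + dotv x y' + (t + t') = (dotv x y + t) + (dotv x y' + t')).
  rewrite (_ : dotv x y - dotv x y' + (t - t') = (dotv x y + t) - (dotv x y' + t')).
    by rewrite cosD cosB; field.
  by ring.
by ring.
Qed.

Lemma trigpolyX p m : trigpoly p -> trigpoly (fun x => p x ^+ m).
Proof.
move=> tp; elim: m => [|m IHm]; first exact: trigpoly_cst.
have := trigpolyM tp IHm.
by congr trigpoly; apply/funext => x; rewrite exprS.
Qed.

Lemma measurable_trigpoly p : trigpoly p -> measurable_fun setT p.
Proof.
elim=> [c y t|p1 p2 _ h1 _ h2]; last exact: measurable_funD.
apply: measurable_funM => //; apply: measurable_cosL.
by apply: measurable_funD => //; exact: measurable_fun_dotv.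
Qed.

End trigonometric_polynomials.

Lemma sqr_add_le (R : realType) (s t s' t' : R) : s ^+ 2 <= s' -> t ^+ 2 <= t' ->
  (s + t) ^+ 2 <= 2 * s' + 2 * t'.
Proof.
move=> h1 h2; have := sqr_ge0 (s - t); rewrite sqrrB sqrrD.
by set m := _ *+ 2; lra.
Qed.

(** * The sigma-algebra of sets with approximable indicator *)

Section approximable_sets.
Context {R : realType}.
Variables (n : nat) (rho : R).
Local Notation L := (@lebesgue_rV R n.+1).
Local Notation E := 'rV[R]_n.+1.
Local Notation F := (\1_(eball rho) : E -> R).
Implicit Types (A B : set E) (p q : E -> R) (x y z : E).

Let F_ge0 x : 0 <= F x. Proof. by rewrite indicE. Qed.

Lemma RB_ball_dist p q : measurable_fun setT p -> measurable_fun setT q ->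
  (forall x, 0 <= p x <= 1) -> (forall x, 0 <= q x <= 1) ->
  RB (fun x => F x * (p x - q x) ^+ 2).
Proof.
move=> mp mq p01 q01; apply: (RBM (RB_ball rho)).
  by apply: measurable_funX; exact: measurable_funB.
exists 1 => x; rewrite ger0_norm ?sqr_ge0//.
have /andP[p0 p1] := p01 x; have /andP[q0 q1] := q01 x.
by rewrite -real_normK ?num_real// expr_le1// ler_norml; lra.
Qed.

Lemma ball_dominated (f : nat -> E -> R) : (forall k, measurable_fun setT (f k)) ->
  (forall k x, `|f k x| <= 1) ->
  {ae L, forall x, eball rho x -> f k x @[k --> \oo] --> (0 : R)} ->
  forall e : R, 0 < e -> exists k, \int[L]_x (F x * f k x ^+ 2) <= e.
Proof.
move=> mf f1 f0 e e0.
have f2 k x : `|f k x ^+ 2| <= 1.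
  by rewrite ger0_norm ?sqr_ge0// -real_normK ?num_real// expr_le1.
have RG k : RB (fun x => F x * f k x ^+ 2).
  apply: (RBM (RB_ball rho)); last by exists 1 => x; exact: f2.
  exact: measurable_funX.
have h1 k : measurable_fun setT (fun x => (F x * f k x ^+ 2)%:E).
  by apply/measurable_EFinP; have [] := RG k.
have h2 : measurable_fun setT (fun x : E => (0%:E : \bar R)) by exact: measurable_cst.
have h3 : {ae L, forall x, setT x ->
    (F x * f k x ^+ 2)%:E @[k --> \oo] --> (0%:E : \bar R)}.
  apply: filterS f0 => x fx _; apply: cvg_EFin; first by near=> k.
  have [xr|xr] := pselect (eball rho x); last first.
    rewrite indicE memNset//.
    have -> : fine \o (fun k => (0 * f k x ^+ 2)%:E) = (fun=> 0 : R).
      by apply/funext => k /=; rewrite mul0r.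
    exact: cvg_cst.
  rewrite indicE mem_set//.
  have -> : fine \o (fun k => (1 * f k x ^+ 2)%:E) = (fun k => f k x * f k x).
    by apply/funext => k /=; rewrite mul1r expr2.
  by rewrite -[X in _ --> X](mulr0 0); apply: cvgM; exact: fx.
have h4 : L.-integrable setT (EFin \o F) by exact: bfs_integrable (RB_bfs (RB_ball rho)).
have h5 : {ae L, forall x, forall k, setT x ->
    (`|(F x * f k x ^+ 2)%:E| <= (EFin \o F) x)%E}.
  apply: aeW => x k _ /=; rewrite lee_fin normrM (ger0_norm (F_ge0 x)).
  exact: ler_piMr.
have [_ _] := dominated_convergence measurableT h1 h2 h3 h4 h5.
rewrite [X in _ --> X]integral0 => /fine_cvg/cvgrPdist_le/(_ e e0)[k _ /(_ k (leqnn k))].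
rewrite /= sub0r normrN => hk; exists k.
by apply: le_trans hk; exact: ler_norm.
Unshelve. all: by end_near.
Qed.

(** The values in [[0, 1]] are required so that products of approximants approximate products of
    indicators; this makes the class stable under intersection. *)
Definition approx_set A := measurable A /\ forall e : R, 0 < e -> exists p,
  [/\ trigpoly p, forall x, 0 <= p x <= 1 &
      \int[L]_x (F x * (p x - \1_A x) ^+ 2) <= e].

Let indic01 A x : 0 <= (\1_A x : R) <= 1.
Proof. by rewrite indicE ler0n lern1 leq_b1. Qed.

Let RBdist A p : measurable A -> trigpoly p -> (forall x, 0 <= p x <= 1) ->
  RB (fun x => F x * (p x - \1_A x) ^+ 2).
Proof.
move=> mA tp p01; apply: RB_ball_dist p01 (indic01 A).
- exact: measurable_trigpoly.
- exact: measurable_indic.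
Qed.

Lemma approx_set0 : approx_set set0.
Proof.
split => // e e0; exists (fun=> 0); split; first exact: trigpoly_cst.
  by move=> x; rewrite lexx ler01.
under eq_Rintegral do rewrite indic0 subrr expr0n mulr0.
by rewrite Rintegral_cst// mul0r ltW.
Qed.

Lemma approx_setC A : approx_set A -> approx_set (~` A).
Proof.
move=> [mA hA]; split; first exact: measurableC.
move=> e e0; have [p [tp p01 pA]] := hA e e0.
exists (fun x => 1 - p x); split.
- by apply: trigpolyB tp; exact: trigpoly_cst.
- by move=> x; have := p01 x; lra.
- apply: le_trans pA; rewrite le_eqVlt; apply/orP; left; apply/eqP.
  apply: eq_Rintegral => x _; rewrite !indicE in_setC.
  by case: (x \in A); rewrite /=; ring.
Qed.

Lemma approx_setI A B : approx_set A -> approx_set B -> approx_set (A `&` B).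
Proof.
move=> [mA hA] [mB hB]; split; first exact: measurableI.
move=> e e0; have e4 : 0 < e / 4 by rewrite divr_gt0.
have [p [tp p01 pA]] := hA _ e4; have [q [tq q01 qB]] := hB _ e4.
have pq01 x : 0 <= p x * q x <= 1.
  have /andP[p0 p1] := p01 x; have /andP[q0 q1] := q01 x.
  by rewrite mulr_ge0//= mulr_ile1.
exists (fun x => p x * q x); split => //; first exact: trigpolyM.
have RA := RBdist mA tp p01; have RBB := RBdist mB tq q01.
have RAB := RBdist (measurableI _ _ mA mB) (trigpolyM tp tq) pq01.
apply: (@le_trans _ _ (2 * \int[L]_x (F x * (p x - \1_A x) ^+ 2) +
    2 * \int[L]_x (F x * (q x - \1_B x) ^+ 2))).
  rewrite -(bfs_intZ _ (RB_bfs RA)) -(bfs_intZ _ (RB_bfs RBB)).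
  rewrite -(bfs_intD (RB_bfs (RBZ _ RA)) (RB_bfs (RBZ _ RBB))).
  apply: (bfs_int_le (RB_bfs RAB) (RB_bfs (RBD (RBZ _ RA) (RBZ _ RBB)))) => x.
  rewrite !(mulrCA 2 (F x)) -mulrDr; apply: ler_wpM2l => //.
  rewrite indicI.
  have := p01 x; have := q01 x; have := indic01 A x; have := indic01 B x.
  set a : R := \1_A x; set b : R := \1_B x; set u := p x; set v := q x.
  move=> /andP[b0 b1] /andP[a0 a1] /andP[v0 v1] /andP[u0 u1].
  have -> : u * v - a * b = v * (u - a) + a * (v - b) by ring.
  have h1 : (v * (u - a)) ^+ 2 <= (u - a) ^+ 2.
    by rewrite exprMn ler_piMl ?sqr_ge0// exprn_ile1.
  have h2 : (a * (v - b)) ^+ 2 <= (v - b) ^+ 2.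
    by rewrite exprMn ler_piMl ?sqr_ge0// exprn_ile1.
  exact: sqr_add_le h1 h2.
move: pA qB; set s := Rintegral _ _ _; set t := Rintegral _ _ _; lra.
Qed.

Lemma approx_setU A B : approx_set A -> approx_set B -> approx_set (A `|` B).
Proof.
move=> hA hB; rewrite -[_ `|` _]setCK setCU.
by apply: approx_setC; apply: approx_setI; exact: approx_setC.
Qed.

Lemma approx_set_close A : measurable A ->
  (forall e : R, 0 < e -> exists2 B, approx_set B &
     \int[L]_x (F x * (\1_B x - \1_A x) ^+ 2) <= e) -> approx_set A.
Proof.
move=> mA hA; split => // e e0; have e4 : 0 < e / 4 by rewrite divr_gt0.
have [B [mB hB] AB] := hA _ e4; have [p [tp p01 pB]] := hB _ e4.
exists p; split => //.
have R1 := RBdist mB tp p01; have R3 := RBdist mA tp p01.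
have R2 : RB (fun x => F x * (\1_B x - \1_A x) ^+ 2).
  by apply: RB_ball_dist (indic01 B) (indic01 A); exact: measurable_indic.
apply: (@le_trans _ _ (2 * \int[L]_x (F x * (p x - \1_B x) ^+ 2) +
    2 * \int[L]_x (F x * (\1_B x - \1_A x) ^+ 2))).
  rewrite -(bfs_intZ _ (RB_bfs R1)) -(bfs_intZ _ (RB_bfs R2)).
  rewrite -(bfs_intD (RB_bfs (RBZ _ R1)) (RB_bfs (RBZ _ R2))).
  apply: (bfs_int_le (RB_bfs R3) (RB_bfs (RBD (RBZ _ R1) (RBZ _ R2)))) => x.
  rewrite !(mulrCA 2 (F x)) -mulrDr; apply: ler_wpM2l => //.
  set a : R := \1_A x; set b : R := \1_B x; set u := p x.
  have -> : u - a = (u - b) + (b - a) by ring.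
  exact: sqr_add_le.
move: pB AB; set s := Rintegral _ _ _; set t := Rintegral _ _ _; lra.
Qed.

Lemma approx_set_bigcup (A : nat -> set E) : (forall k, approx_set (A k)) ->
  approx_set (\bigcup_k A k).
Proof.
move=> hA; have mA k : measurable (A k) by have [] := hA k.
pose B k := \big[setU/set0]_(i < k) A i.
have hB k : approx_set (B k).
  by rewrite /B; elim/big_ind: _ => //; [exact: approx_set0|exact: approx_setU].
have mU : measurable (\bigcup_k A k) by exact: bigcup_measurable.
apply: approx_set_close => // e e0.
have [||| k hk] := @ball_dominated (fun k x => \1_(B k) x - \1_(\bigcup_k A k) x) _ _ _ e e0.
- move=> k; have [mB _] := hB k.
  by apply: measurable_funB; exact: measurable_indic.
- move=> k x; have := indic01 (B k) x; have := indic01 (\bigcup_k A k) x.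
  by rewrite ler_norml; lra.
- apply: aeW => x _; have [[i _ Aix]|xA] := pselect ((\bigcup_k A k) x).
    apply: cvg_near_cst; exists i.+1 => // k /= ik.
    rewrite !indicE !mem_set ?subrr//; first by exists i.
    by rewrite /B -bigcup_mkord; exists i.
  apply: cvg_near_cst; near=> k; rewrite !indicE !memNset ?subrr//.
  by rewrite /B -bigcup_mkord => -[i _ Aix]; apply: xA; exists i.
- by exists (B k).
Unshelve. all: by end_near.
Qed.

End approximable_sets.

Section density.
Context {R : realType}.
Variables (n : nat) (rho : R).
Local Notation L := (@lebesgue_rV R n.+1).
Local Notation E := 'rV[R]_n.+1.
Local Notation F := (\1_(eball rho) : E -> R).
Implicit Types (A B : set E) (p q a : E -> R) (x y z : E).

Lemma hyperplane_null (i : 'I_n.+1) (c : R) : L [set x | x ord0 i = c] = 0%E.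
Proof.
pose G (j : 'I_n.+1) : set (measurableTypeR R) := if j == i then [set c] else setT.
have GE : [set x : E | x ord0 i = c] = [set x : E | forall j, G j (x ord0 j)].
  apply/seteqP; split => x /=; last by move=> /(_ i); rewrite /G eqxx.
  by move=> xc j; rewrite /G; case: eqVneq => // ->.
have mG j : measurable (G j).
  by rewrite /G; case: (j == i); [exact: measurable_set1|exact: measurableT].
rewrite [X in L X]GE [LHS](lebesgue_rV_box mG) (bigD1 i)//= {1}/G eqxx lebesgue_measure_set1 mul0e//.
Qed.

(* [1 - (1 - X ^ m) ^ (2 ^ m)] tends to the indicator of [1 / 2 < X] off
   [X = 1 / 2], and [X = (1 + sin (k (x_i - c))) / 2] compares to [1 / 2] as
   [x_i] does to [c] on the ball when [k] is small. *)
Lemma approx_set_halfspace (i : 'I_n.+1) (c : R) :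
  approx_set rho [set x : E | c < x ord0 i].
Proof.
set A := [set x | _].
have mc : measurable_fun setT (fun x : E => x ord0 i) by exact: measurable_coord.
have mA : measurable A.
  rewrite (_ : A = (fun x : E => x ord0 i) @^-1` `]c, +oo[).
    by rewrite -[X in measurable X]setTI; apply: mc.
  by apply/seteqP; split => x /=; rewrite /A/= in_itv/= andbT.
(* On the ball [|k * (x_i - c)|] is at most [1 < pi], where the sine has the sign of its
   argument. *)
pose k : R := (`|rho| + `|c| + 1)^-1.
have D0 : 0 < `|rho| + `|c| + 1 by rewrite ltr_wpDl// addr_ge0.
have k0 : 0 < k by rewrite invr_gt0.
pose X x : R := (1 + sin (k * (x ord0 i - c))) / 2.
have X01 x : 0 <= X x <= 1.
  have : `|sin (k * (x ord0 i - c))| <= 1 := sin_max _.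
  by rewrite ler_norml /X; set s := sin _; lra.
have tX : trigpoly X.
  (* [sin u = - cos (u + pi / 2)] turns [X] into a constant plus a wave along the axis [i]. *)
  have := trigpolyD (trigpoly_cst n (1 / 2))
    (trigpoly_wave (- (1 / 2)) (k *: (delta_mx ord0 i : E)) (- (k * c) + pi / 2)).
  congr trigpoly; apply/funext => x; rewrite /X dotvZr.
  have -> : dotv x (delta_mx ord0 i) = x ord0 i.
    rewrite /dotv (bigD1 i)//= mxE !eqxx mulr1 big1 ?addr0// => j ji.
    by rewrite mxE (negbTE ji) andbF mulr0.
  rewrite addrA cosDpihalf.
  have -> : k * x ord0 i - k * c = k * (x ord0 i - c) by ring.
  by field.
pose p m x := 1 - (1 - X x ^+ m) ^+ (2 ^ m).
have tp m : trigpoly (p m).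
  apply: trigpolyB; first exact: trigpoly_cst.
  apply: trigpolyX; apply: trigpolyB; first exact: trigpoly_cst.
  exact: trigpolyX.
have p01 m x : 0 <= p m x <= 1.
  have := step_power_itv m (X01 x); rewrite /p; set s := _ ^+ (2 ^ m); lra.
have sgn x : eball rho x -> x ord0 i != c -> (X x != 1 / 2) /\
    (1 - (X x < 1 / 2)%R%:R = (\1_A x : R)).
  move=> xr xc; have xi : `|x ord0 i| <= `|rho|.
    by rewrite (le_trans (coord_le_enorm _ _))// (le_trans xr)// ler_norm.
  have xk : `|k * (x ord0 i - c)| < pi.
    apply: (@le_lt_trans _ _ 1); last by apply: lt_le_trans (pi_ge2 R); rewrite ltr1n.
    rewrite normrM gtr0_norm// /k mulrC ler_pdivrMr// mul1r.
    by apply: (le_trans (ler_normB _ _)); move: xi; lra.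
  move: xk; rewrite ltr_norml => /andP[xk1 xk2].
  rewrite indicE /A; have [xlt|xgt|xe] := ltgtP c (x ord0 i); last first.
  - by rewrite xe eqxx in xc.
  - have s0 : 0 < sin (k * (c - x ord0 i)).
      apply: sin_gt0_pi; rewrite mulr_gt0 ?subr_gt0//=.
      by move: xk1; rewrite ltrNl -mulrN opprB.
    have s1 : sin (k * (x ord0 i - c)) = - sin (k * (c - x ord0 i)).
      by rewrite -sinN -mulrN opprB.
    have X2 : X x < 1 / 2 by rewrite /X s1; move: s0; set s := sin _; lra.
    rewrite X2 memNset ?subrr; last by apply/negP; rewrite -leNgt ltW.
    by split => //; rewrite lt_eqF.
  - have s0 : 0 < sin (k * (x ord0 i - c)).
      by apply: sin_gt0_pi; rewrite mulr_gt0 ?subr_gt0.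
    have X2 : 1 / 2 < X x by rewrite /X; move: s0; set s := sin _; lra.
    rewrite mem_set//; split; first by rewrite gt_eqF.
    by rewrite ltNge (ltW X2)/= subr0.
split => // e e0.
have [||| m hm] := @ball_dominated R n rho (fun m x => p m x - \1_A x) _ _ _ e e0.
- move=> m; apply: measurable_funB; first exact: measurable_trigpoly.
  exact: measurable_indic.
- move=> m x; have := p01 m x; rewrite ler_norml indicE.
  by case: (x \in A); rewrite /=; set s := p m x; lra.
- exists [set x : E | x ord0 i = c]; split.
  + rewrite (_ : [set _ | _] = (fun x : E => x ord0 i) @^-1` [set c]) //.
    by rewrite -[X in measurable X]setTI; apply: mc.
  + exact: hyperplane_null.
  + move=> x; apply: contra_notP => /= /eqP xc xr.
    have [X2 <-] := sgn x xr xc.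
    rewrite -[X in _ --> X](subrr (1 - (X x < 1 / 2)%R%:R)).
    apply: cvgB; last exact: cvg_cst.
    apply: cvgB; first exact: cvg_cst.
    exact: step_power_cvg (X01 x) X2.
- by exists (p m).
Qed.

(** The approximable sets form a sigma-algebra. It contains the half-spaces, which generate the
    measurable sets: open half-lines generate the Borel sets of each coordinate, and coordinates
    generate the rest. *)
Lemma measurable_approx_set A : measurable A -> approx_set rho A.
Proof.
suff h : g_sigma_preimage (@rV_coord R n.+1) `<=` approx_set rho by exact: h.
apply: smallest_sub.
  split => [|B|G].
  - exact: approx_set0.
  - by rewrite setTD; exact: approx_setC.
  - exact: approx_set_bigcup.
rewrite -bigcup_seq => B [i _] [Y mY <-]; rewrite setTI.
have : (RGenOInfty.G (R := R)).-sigma.-measurable Y.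
  by rewrite -RGenOInfty.measurableE.
suff h : (RGenOInfty.G (R := R)).-sigma.-measurable `<=`
    [set Y | approx_set rho (@rV_coord R n.+1 i @^-1` Y)] by exact: h.
apply: smallest_sub.
  split => [|Z|G] /=.
  - by rewrite preimage_set0; exact: approx_set0.
  - by rewrite setTD preimage_setC; exact: approx_setC.
  - by rewrite preimage_bigcup; exact: approx_set_bigcup.
move=> Z /= [c ->].
rewrite (_ : _ @^-1` _ = [set x : E | c < x ord0 i]).
  exact: approx_set_halfspace.
by apply/seteqP; split => x /=; rewrite /rV_coord in_itv/= andbT.
Qed.

(** The sum counts the positive multiples of [e] up to [b], so [e] times it is [b] rounded down to a
    multiple of [e]. *)
Lemma staircase (e : R) J (b : R) : 0 < e -> 0 <= b < J.+1%:R * e ->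
  0 <= b - e * \sum_(j < J) (j.+1%:R * e <= b)%R%:R <= e.
Proof.
move=> e0; elim: J b => [|J IHJ] b /andP[b0 b1].
  by rewrite big_ord0 mulr0 subr0 b0 ltW// -[e]mul1r.
have [be|be] := ltP b e.
  rewrite big1 ?mulr0 ?subr0 ?b0 ?ltW// => j _.
  rewrite leNgt (lt_le_trans be)// ler_peMl ?ler1n// ltW//.
rewrite big_ord_recl /= mul1r be mulrDr mulr1 opprD addrA.
rewrite (eq_bigr (fun j : 'I_J => (j.+1%:R * e <= b - e)%R%:R)); last first.
  by move=> j _; rewrite lerBrDr -[j.+2%:R]natr1 mulrDl mul1r.
apply: IHJ; rewrite subr_ge0 be/= ltrBlDr.
by rewrite -[X in _ + X]mul1r -mulrDl natr1.
Qed.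

Hypothesis rho0 : 0 < rho.
Hypothesis rho1 : rho < 2 / pi.

Lemma rigid_trigpoly p : trigpoly p -> rigid rho (fun x => F x * p x).
Proof.
elim=> [c y t|p1 p2 _ h1 _ h2].
  have := rigidZ c (rigid_all_waves y t rho0 rho1).
  by congr rigid; apply/funext => x; rewrite mulrCA.
have := rigidD h1 h2.
by congr rigid; apply/funext => x; rewrite mulrDr.
Qed.

Lemma rigid_indic A : measurable A -> rigid rho (fun x => F x * \1_A x).
Proof.
move=> mA; have [_ hA] := measurable_approx_set mA.
apply: rigid_close; first exact: RB_indicM (RB_ball rho) mA.
move=> e e0; have [p [tp _ pA]] := hA e e0.
exists (fun x => F x * p x); first exact: rigid_trigpoly.
apply: le_trans pA; rewrite le_eqVlt; apply/orP; left; apply/eqP.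
apply: eq_Rintegral => x _; rewrite !indicE.
by case: (x \in eball _); rewrite ?mul0r ?mul1r; [ring|rewrite subrr expr0n].
Qed.

Lemma rigid_RB a : RB a -> (forall x, ~ eball rho x -> a x = 0) -> rigid rho a.
Proof.
move=> Ra a0; apply: (rigid_uniform_close Ra) => e e0.
have [K K0 aK] := RB_norm_gt0 Ra; have [ma _ _] := Ra.
(* Adding [K] brings the values of [a] into [[0, 2 * K]], covered by [J] steps of height [e]; the
   term in [- K] undoes the shift on the ball. *)
pose J := Num.bound (2 * K / e).
have K2 : 0 <= 2 * K / e by rewrite divr_ge0 ?mulr_ge0 ?(ltW e0).
pose A (j : 'I_J) : set E := [set x | j.+1%:R * e <= a x + K].
have mA j : measurable (A j).
  rewrite (_ : A j = (fun x => a x + K) @^-1` `[j.+1%:R * e, +oo[).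
    rewrite -[X in measurable X]setTI.
    by apply: (measurable_funD ma (measurable_cst K)).
  by apply/seteqP; split => x /=; rewrite /A/= in_itv/= andbT.
exists (fun x => \sum_(j <- index_enum 'I_J) e * (F x * \1_(A j) x) +
    (- K) * (F x * \1_setT x)).
  apply: rigidD; last by apply: rigidZ; exact: rigid_indic.
  by apply: rigid_sum => j _; apply: rigidZ; exact: rigid_indic.
move=> x; rewrite -mulr_sumr -mulr_sumr indicT mulr1.
have [xr|xr] := pselect (eball rho x); last first.
  by rewrite a0// indicE memNset// !mul0r !mulr0 addr0 subrr normr0.
rewrite indicE mem_set// !mul1r !mulr1.
have -> : a x - (e * \sum_j \1_(A j) x - K) = (a x + K) - e * \sum_j \1_(A j) x.
  by ring.
under eq_bigr => j _ do rewrite indicE.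
have -> : \sum_(j < J) (x \in A j)%:R = \sum_(j < J) (j.+1%:R * e <= a x + K)%R%:R :> R.
  by apply: eq_bigr => j _; congr (nat_of_bool _)%:R; apply/idP/idP; rewrite inE.
have /andP[aK1 aK2] : - K <= a x <= K by rewrite -ler_norml.
have /andP[h1 h2] : 0 <= a x + K - e * \sum_(j < J) (j.+1%:R * e <= a x + K)%R%:R <= e.
  apply: staircase => //; apply/andP; split; first by lra.
  rewrite -ltr_pdivrMr//; apply: (@le_lt_trans _ _ (2 * K / e)).
    by rewrite ler_pdivrMr// divfK ?gt_eqF//; lra.
  by apply: (lt_le_trans (archi_boundP K2)); rewrite ler_nat.
by rewrite ger0_norm.
Qed.

End density.

(** * The random measure *)

Section covariance_energy.
Context {R : realType} {n : nat}.
Local Notation L := (@lebesgue_rV R n).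
Local Notation E := 'rV[R]_n.
Local Notation B1 := (\1_(eball 1) : E -> R).
Implicit Types (a b : E -> R) (x y : E).

Lemma S_self_adjoint a b : RB a -> RB b ->
  \int[L]_y (a y * S b y) = \int[L]_y (S a y * b y).
Proof.
move=> Ra Rb; have mk : measurable_fun setT (fun w : E * E => B1 (w.1 - w.2)).
  by apply: measurable_B1; exact: measurable_rVB.
have [|sw _ _] := kernel_fubini Ra Rb mk; first by exists 1 => w; exact: B1_norm.
rewrite [LHS]sw; apply: eq_Rintegral => y _; rewrite [RHS]mulrC.
have -> // : \int[L]_x (a x * B1 (x - y)) = S a y.
by apply: eq_Rintegral => x _; rewrite B1_distC.
Qed.

(* The density of [C] is the autocorrelation of the unit ball, hence the two
   applications of the self-adjoint operator [S]. *)
Lemma covariance_energy (C : {measure set E -> \bar R}) a b :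
  (forall A, measurable A -> C A = (\int[L]_(x in A) (Delta x)%:E)%E) ->
  RB a -> RB b ->
  \int[L]_y \int[C]_x (a y * a (x + y) + b y * b (x + y)) = N a + N b.
Proof.
move=> CE Ra Rb.
have RSa := RB_S Ra; have RSb := RB_S Rb.
have RSSa := RB_S RSa; have RSSb := RB_S RSb.
have prodRB g h : RB g -> RB h -> RB (fun y => g y * h y).
  by move=> Rg [mh [K hK] _]; apply: (RBM Rg) => //; exists K.
have RM g y : RB g -> RB (fun v => g (v + y) * B1 v).
  by move=> Rg; apply: RB_indicM (RB_shift y Rg) _; exact: measurable_eball.
have Svy g u y : RB g -> \int[L]_v (g (u + v + y) * B1 v) = S g (u + y).
  by move=> Rg; rewrite S_alt//; apply: eq_Rintegral => v _; rewrite addrAC.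
have inner y : \int[C]_x (a y * a (x + y) + b y * b (x + y)) =
    a y * S (S a) y + b y * S (S b) y.
  have Ray := RBZ (a y) (RB_shift y Ra); have Rby := RBZ (b y) (RB_shift y Rb).
  have [mg bg _] := RBD Ray Rby.
  rewrite (int_conv_ball CE mg bg).
  have R1 u : RB (fun v => a (u + v + y) * B1 v).
    by move: (RM a (u + y) Ra); congr RB; apply/funext => v; rewrite addrA (addrC v).
  have R2 u : RB (fun v => b (u + v + y) * B1 v).
    by move: (RM b (u + y) Rb); congr RB; apply/funext => v; rewrite addrA (addrC v).
  have R3 : RB (fun u => S a (u + y) * B1 u) := RM _ y RSa.
  have R4 : RB (fun u => S b (u + y) * B1 u) := RM _ y RSb.
  transitivity (\int[L]_u (a y * (S a (u + y) * B1 u) + b y * (S b (u + y) * B1 u))).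
    apply: eq_Rintegral => u _.
    rewrite -(Svy a u y Ra) -(Svy b u y Rb) !mulrA -mulrDl mulrC; congr (_ * _).
    rewrite -(bfs_intZ _ (RB_bfs (R1 u))) -(bfs_intZ _ (RB_bfs (R2 u))).
    rewrite -(bfs_intD (RB_bfs (RBZ _ (R1 u))) (RB_bfs (RBZ _ (R2 u)))).
    by apply: eq_Rintegral => v _; rewrite mulrDl !mulrA.
  rewrite (bfs_intD (RB_bfs (RBZ _ R3)) (RB_bfs (RBZ _ R4))).
  rewrite (bfs_intZ _ (RB_bfs R3)) (bfs_intZ _ (RB_bfs R4)).
  have SS g : RB g -> S g y = \int[L]_u (g (u + y) * B1 u).
    by move=> Rg; rewrite S_alt//; apply: eq_Rintegral => u _; rewrite addrC.
  by rewrite -(SS _ RSa) -(SS _ RSb).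
transitivity (\int[L]_y (a y * S (S a) y + b y * S (S b) y)).
  by apply: eq_Rintegral => y _; exact: inner.
rewrite (bfs_intD (RB_bfs (prodRB _ _ Ra RSSa)) (RB_bfs (prodRB _ _ Rb RSSb))).
have NE g : N g = \int[L]_y (S g y * S g y).
  by apply: eq_Rintegral => y _; rewrite expr2.
have e1 := S_self_adjoint Ra RSa; have e2 := S_self_adjoint Rb RSb.
rewrite -NE in e1; rewrite -NE in e2; exact: (f_equal2 +%R e1 e2).
Qed.

Lemma int_ball_sub (r : R) x : 0 < r ->
  \int[L]_y \1_(eball r) (x - y) = r ^+ n * bvol R n.
Proof.
move=> r0; have m := measurable_eball (R := R) (n := n) r.
rewrite (preserving_int (f := (\1_(eball r) : E -> R)) (preserving_subl x)).
  by rewrite int_indic// fine_lebesgue_eball.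
exact: measurable_indic.
Qed.

Lemma RB_ball_sub (r : R) x : RB (fun y => \1_(eball r) (x - y) : R).
Proof.
move: (RB_shift (- x) (RB_ball r)); congr RB; apply/funext => z.
by rewrite -opprB !indicE; congr (nat_of_bool _)%:R; apply/idP/idP; rewrite !inE eballN.
Qed.

(** The unit balls around [x] and [x'] differ only inside the annulus of radii [1 - e] and [1 + e]
    around [x], whose volume appears on the right. *)
Lemma S_modulus a K x x' (e : R) : RB a -> (forall y, `|a y| <= K) -> 0 < e < 1 ->
  enorm (x - x') <= e ->
  `|S a x - S a x'| <= K * (((1 + e) ^+ n - (1 - e) ^+ n) * bvol R n).
Proof.
move=> Ra aK /andP[e0 e1] xx.
have e10 : 0 < 1 - e by rewrite subr_gt0.
have e20 : 0 < 1 + e by rewrite addr_gt0.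
have Rx := RB_SE x Ra; have Rx' := RB_SE x' Ra.
have Ro := RB_ball_sub (1 + e) x; have Ri := RB_ball_sub (1 - e) x.
rewrite /S -(bfs_intB (RB_bfs Rx) (RB_bfs Rx')).
apply: (le_trans (bfs_int_norm (RB_bfs (RBB Rx Rx')))).
rewrite mulrBl -(int_ball_sub x e20) -(int_ball_sub x e10).
rewrite -(bfs_intB (RB_bfs Ro) (RB_bfs Ri)) -(bfs_intZ _ (RB_bfs (RBB Ro Ri))).
apply: (bfs_int_le (bfs_norm (RB_bfs (RBB Rx Rx'))) (RB_bfs (RBZ _ (RBB Ro Ri)))) => y.
rewrite -mulrBr normrM; apply: ler_pM => //.
have bE (r : R) z : \1_(eball r) z = (enorm z <= r)%R%:R :> R.
  by rewrite indicE; congr (nat_of_bool _)%:R; apply/idP/idP; rewrite inE.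
rewrite !bE.
have t1 : enorm (x - y) <= enorm (x' - y) + e.
  rewrite [leRHS]addrC; apply: le_trans (lerD xx (lexx _)).
  by apply: le_trans (enormD _ _); rewrite addrA subrK.
have t2 : enorm (x' - y) <= enorm (x - y) + e.
  rewrite [leRHS]addrC; apply: le_trans (lerD xx (lexx _)).
  by rewrite (enorm_distC x); apply: le_trans (enormD _ _); rewrite addrA subrK.
move: t1 t2; set u := enorm (x - y); set v := enorm (x' - y) => t1 t2.
have [h1|h1] := leP u 1; have [h2|h2] := leP v 1; rewrite ?subrr ?sub0r ?subr0 ?normrN ?normr0 ?normr1.
- by rewrite subr_ge0 ler_nat; case: leP => //= h3; rewrite (le_trans h3)// lerD2l; lra.
- have -> : u <= 1 + e by lra.
  have -> // : (u <= 1 - e) = false by apply/negP => h3; lra.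
  by rewrite subr0.
- have -> : u <= 1 + e by lra.
  have -> // : (u <= 1 - e) = false by apply/negP => h3; lra.
  by rewrite subr0.
- by rewrite subr_ge0 ler_nat; case: leP => //= h3; rewrite (le_trans h3)// lerD2l; lra.
Qed.

Lemma S_energy_gt0 a (r : R) x : RB a -> 0 < r -> enorm x <= r -> S a x != 0 ->
  0 < \int[L]_z (S a z ^+ 2 * \1_(eball r) z).
Proof.
move=> Ra r0 xr Sx; set eta := `|S a x|.
have eta0 : 0 < eta by rewrite normr_gt0.
have [K K0 aK] := RB_norm_gt0 Ra.
have V0 : 0 < bvol R n := bvol_gt0.
have [e [e0 e1 er eK]] : exists e : R, [/\ 0 < e, e < 1, e <= r &
    K * (((1 + e) ^+ n - (1 - e) ^+ n) * bvol R n) <= eta / 2].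
  have c : K * (((1 + e) ^+ n - (1 - e) ^+ n) * bvol R n) @[e --> (0 : R)] --> (0 : R).
    rewrite -[X in _ --> X](_ : K * (((1 + 0) ^+ n - (1 - 0) ^+ n) * bvol R n) = 0).
      apply: cvgMr; apply: cvgMl; apply: cvgB.
        apply: (@cvg_comp _ _ _ (fun e : R => 1 + e) (fun u : R => u ^+ n)).
          by apply: cvgD; [exact: cvg_cst|exact: cvg_id].
        exact: exprn_continuous.
      apply: (@cvg_comp _ _ _ (fun e : R => 1 - e) (fun u : R => u ^+ n)).
        by apply: cvgB; [exact: cvg_cst|exact: cvg_id].
      exact: exprn_continuous.
    by rewrite addr0 subr0 subrr mul0r mulr0.
  have eta2 : 0 < eta / 2 by rewrite divr_gt0.
  move/cvgrPdist_le/(_ _ eta2)/nbhs_ballP : c => [dl /= dl0 Hdl].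
  pose e := Num.min (dl / 2) (Num.min (1 / 2) r).
  have e0 : 0 < e by rewrite !lt_min r0 !divr_gt0.
  have e1 : e <= 1 / 2 by rewrite !ge_min lexx orbT.
  have er : e <= r by rewrite !ge_min lexx !orbT.
  have ed : e <= dl / 2 by rewrite ge_min lexx.
  exists e; split => //; first by lra.
  have /Hdl : ball 0 dl e.
    by rewrite /ball/= sub0r normrN gtr0_norm//; lra.
  by rewrite /= sub0r normrN; apply: le_trans; exact: ler_norm.
(* [x] may lie on the boundary sphere. Moved inwards by at most [e / 2], it becomes the centre of a
   ball of radius [e / 2] contained in [eball r] and within [e] of [x], where [|S a|] is at least
   [eta / 2]. *)
pose x0 := (1 - e / (2 * r)) *: x.
have t0 : 0 < e / (2 * r) by rewrite divr_gt0// mulr_gt0.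
have te : e / (2 * r) * r = e / 2 by field; rewrite gt_eqF.
have t1 : e / (2 * r) <= 1 by rewrite ler_pdivrMr ?mulr_gt0// mul1r; lra.
have near z : enorm (x0 - z) <= e / 2 -> enorm z <= r /\ enorm (x - z) <= e.
  move=> xz; have tx : e / (2 * r) * enorm x <= e / 2.
    by rewrite -te; apply: ler_wpM2l => //; exact: ltW.
  have nx0 : enorm x0 <= r - e / 2.
    rewrite /x0 enormZ ger0_norm ?subr_ge0//.
    have -> : r - e / 2 = (1 - e / (2 * r)) * r by rewrite mulrBl te mul1r.
    by apply: ler_wpM2l; rewrite ?subr_ge0.
  split.
    apply: (le_trans (enorm_triangle z x0)); rewrite enorm_distC.
    by apply: (le_trans (lerD xz nx0)); rewrite addrC subrK.
  rewrite -(subrK x0 x) -addrA; apply: (le_trans (enormD _ _)).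
  have -> : x - x0 = (e / (2 * r)) *: x by rewrite /x0 scalerBl scale1r opprB addrC subrK.
  rewrite enormZ (ger0_norm (ltW t0)).
  by apply: (le_trans (lerD tx xz)); rewrite -splitr.
have e20 : 0 < e / 2 by rewrite divr_gt0.
have Rb := RB_ball_sub (e / 2) x0.
have RS := RB_indicM (RB_sqr (RB_S Ra)) (measurable_eball r).
apply: (@lt_le_trans _ _ (\int[L]_z ((eta / 2) ^+ 2 * \1_(eball (e / 2)) (x0 - z)))).
  rewrite (bfs_intZ _ (RB_bfs Rb)) int_ball_sub//.
  by rewrite mulr_gt0 ?exprn_gt0 ?divr_gt0// mulr_gt0// exprn_gt0.
apply: (bfs_int_le (RB_bfs (RBZ _ Rb)) (RB_bfs RS)) => z.
rewrite [X in _ * X <= _]indicE; have [/set_mem xz|_] := boolP (_ \in _); last first.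
  by rewrite mulr0 mulr_ge0 ?sqr_ge0// indicE.
have [zr zx] := near z xz.
rewrite mulr1 indicE mem_set// mulr1 -[leRHS]real_normK ?num_real//.
have eta2 : 0 <= eta / 2 by rewrite divr_ge0// ltW.
have Sz0 : 0 <= `|S a z| := normr_ge0 _.
apply: (lerXn2r 2 eta2 Sz0).
have e01 : 0 < e < 1 by rewrite e0.
have := le_trans (S_modulus Ra aK e01 zx) eK.
have : eta <= `|S a x - S a z| + `|S a z|.
  by apply: le_trans (ler_normD _ _); rewrite subrK.
by set u := `|S a x - S a z|; set v := `|S a z|; lra.
Qed.

End covariance_energy.

Section complex_parts.
Context {R : realType}.
Implicit Types z w : R[i].

Lemma ReD z w : complex.Re (z + w) = complex.Re z + complex.Re w.
Proof. by case: z => a b; case: w. Qed.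

Lemma ImD z w : complex.Im (z + w) = complex.Im z + complex.Im w.
Proof. by case: z => a b; case: w. Qed.

Lemma ReB z w : complex.Re (z - w) = complex.Re z - complex.Re w.
Proof. by case: z => a b; case: w. Qed.

Lemma ImB z w : complex.Im (z - w) = complex.Im z - complex.Im w.
Proof. by case: z => a b; case: w. Qed.

Lemma Re_mul_conj z w : complex.Re (z * w^*)%C =
  complex.Re z * complex.Re w + complex.Im z * complex.Im w.
Proof. by case: z => a b; case: w => c d /=; rewrite mulrN opprK. Qed.

Lemma normc_sqr z :
  ComplexField.Normc.normc z ^+ 2 = complex.Re z ^+ 2 + complex.Im z ^+ 2.
Proof. by case: z => a b /=; rewrite sqr_sqrtr// addr_ge0// sqr_ge0. Qed.

Lemma normc_ge0 z : 0 <= ComplexField.Normc.normc z.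
Proof. by case: z => a b /=; exact: sqrtr_ge0. Qed.

Lemma Re_le_normc z : `|complex.Re z| <= ComplexField.Normc.normc z.
Proof.
rewrite -ler_sqr ?nnegrE ?normc_ge0// real_normK ?num_real// normc_sqr.
by rewrite lerDl sqr_ge0.
Qed.

Lemma Im_le_normc z : `|complex.Im z| <= ComplexField.Normc.normc z.
Proof.
rewrite -ler_sqr ?nnegrE ?normc_ge0// real_normK ?num_real// normc_sqr.
by rewrite lerDr sqr_ge0.
Qed.

Lemma normc_le z : ComplexField.Normc.normc z <= `|complex.Re z| + `|complex.Im z|.
Proof.
rewrite -ler_sqr ?nnegrE ?normc_ge0 ?addr_ge0// normc_sqr sqrrD.
rewrite !real_normK ?num_real// -addrA [X in _ <= _ + X]addrC addrA lerDl.
by rewrite mulrn_wge0// mulr_ge0.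
Qed.

End complex_parts.

Section test_function_parts.
Context {R : realType} {n : nat}.
Local Notation E := 'rV[R]_n.
Implicit Types (f g : E -> R[i]) (B : set E).

Lemma Ccb_Re B f : Ccb B f -> RB (fun x => complex.Re (f x)).
Proof.
move=> [[mf _] [K fK] [r fr] _]; split => //.
  by exists K => x; exact: le_trans (Re_le_normc _) (fK x).
exists r => x rx; have [->//|f0] := eqVneq (f x) 0.
by have := fr x f0; rewrite /eball/= leNgt rx.
Qed.

Lemma Ccb_Im B f : Ccb B f -> RB (fun x => complex.Im (f x)).
Proof.
move=> [[_ mf] [K fK] [r fr] _]; split => //.
  by exists K => x; exact: le_trans (Im_le_normc _) (fK x).
exists r => x rx; have [->//|f0] := eqVneq (f x) 0.
by have := fr x f0; rewrite /eball/= leNgt rx.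
Qed.

Lemma RB_Ccb B f : RB (fun x => complex.Re (f x)) -> RB (fun x => complex.Im (f x)) ->
  (forall x, ~ B x -> f x = 0) -> Ccb B f.
Proof.
move=> [m1 [K1 b1] [r1 s1]] [m2 [K2 b2] [r2 s2]] f0; split => //.
- exists (K1 + K2) => x; apply: (le_trans (normc_le _)); exact: lerD.
- exists (Num.max r1 r2) => x /= /eqP fx; rewrite /eball/= leNgt; apply/negP.
  rewrite gt_max => /andP[h1 h2]; apply: fx.
  by move: (s1 x h1) (s2 x h2); case: (f x) => u v /= -> ->.
- by move=> x /= /eqP fx; apply: contrapT => /f0.
Qed.

Lemma Ccb_sub B B' f : B `<=` B' -> Ccb B f -> Ccb B' f.
Proof. by move=> BB' [? ? ? fB]; split => //; exact: subset_trans BB'. Qed.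

Lemma Ccb_setT B f : Ccb B f -> Ccb setT f.
Proof. exact: Ccb_sub. Qed.

Lemma Ccb_eq0 B f x : Ccb B f -> ~ B x -> f x = 0.
Proof. by move=> [_ _ _ fB] Bx; apply/eqP/negPn/negP => /fB. Qed.

Lemma CcbD f g : Ccb setT f -> Ccb setT g -> Ccb setT (fun x => f x + g x).
Proof.
move=> Cf Cg; apply: RB_Ccb; last by move=> x [].
  by move: (RBD (Ccb_Re Cf) (Ccb_Re Cg)); congr RB; apply/funext => x; rewrite ReD.
by move: (RBD (Ccb_Im Cf) (Ccb_Im Cg)); congr RB; apply/funext => x; rewrite ImD.
Qed.

Lemma CcbB f g : Ccb setT f -> Ccb setT g -> Ccb setT (fun x => f x - g x).
Proof.
move=> Cf Cg; apply: RB_Ccb; last by move=> x [].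
  by move: (RBB (Ccb_Re Cf) (Ccb_Re Cg)); congr RB; apply/funext => x; rewrite ReB.
by move: (RBB (Ccb_Im Cf) (Ccb_Im Cg)); congr RB; apply/funext => x; rewrite ImB.
Qed.

Lemma Ccb_translate v f : Ccb setT f -> Ccb setT (translate v f).
Proof.
move=> Cf; apply: RB_Ccb; last by move=> x [].
  exact: RB_shift (- v) (Ccb_Re Cf).
exact: RB_shift (- v) (Ccb_Im Cf).
Qed.

(** Boxes serve as compact sets, products of segments being compact by [rV_compact]. Every larger
    box works too, which yields one compact for several functions. *)
Lemma Ccb_box f : Ccb setT f -> exists r : R, forall r', r <= r' ->
  Ccb [set v : E | forall i, `[- r', r']%classic (v ord0 i)] f.
Proof.
move=> [mf bf [r fr] _]; exists r => r' rr; split => //.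
  by exists r.
move=> x /fr xr i /=; rewrite in_itv/= -ler_norml.
by apply: (le_trans (coord_le_enorm _ _)); exact: le_trans rr.
Qed.

End test_function_parts.

Section charge_integrals.
Context d (T : measurableType d) (R : realType).
Implicit Types (g h : T -> R).

Definition bounded_measurable g :=
  measurable_fun setT g /\ exists K : R, forall x, `|g x| <= K.

Lemma bounded_measurable_bfs (mu : {finite_measure set T -> \bar R}) g :
  bounded_measurable g -> bfs mu g.
Proof.
move=> [mg bg]; split => //; exists setT; split => //; last by move=> x [].
by rewrite ltey_eq fin_num_measure.
Qed.

Lemma charge_RintegralD (nu : {charge set T -> \bar R}) g h :
  bounded_measurable g -> bounded_measurable h ->
  charge_Rintegral nu (fun x => g x + h x) =
  charge_Rintegral nu g + charge_Rintegral nu h.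
Proof.
move=> bg bh; rewrite /charge_Rintegral.
set nuPN := svalP (cid (svalP (cid (Hahn_decomposition nu)))).
have G (mu : {finite_measure set T -> \bar R}) :
    \int[mu]_x (g x + h x) = \int[mu]_x g x + \int[mu]_x h x.
  exact: bfs_intD (bounded_measurable_bfs mu bg) (bounded_measurable_bfs mu bh).
rewrite [X in X - _](G (jordan_pos nuPN)) [X in _ - X](G (jordan_neg nuPN)).
by rewrite opprD addrACA.
Qed.

Lemma complex_measure_integralD (nu nu' : {charge set T -> \bar R}) (f g : T -> R[i]) :
  bounded_measurable (fun x => complex.Re (f x)) ->
  bounded_measurable (fun x => complex.Im (f x)) ->
  bounded_measurable (fun x => complex.Re (g x)) ->
  bounded_measurable (fun x => complex.Im (g x)) ->
  complex_measure_integral nu nu' (fun x => f x + g x) =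
  complex_measure_integral nu nu' f + complex_measure_integral nu nu' g.
Proof.
move=> f1 f2 g1 g2; rewrite /complex_measure_integral.
have -> : (fun x => complex.Re (f x + g x)) = (fun x => complex.Re (f x) + complex.Re (g x)).
  by apply/funext => x; rewrite ReD.
have -> : (fun x => complex.Im (f x + g x)) = (fun x => complex.Im (f x) + complex.Im (g x)).
  by apply/funext => x; rewrite ImD.
rewrite !charge_RintegralD//.
apply/eqP; rewrite eq_complex /=; apply/andP; split; apply/eqP.
  by rewrite opprD addrACA.
by rewrite addrACA.
Qed.

End charge_integrals.

Section square_integrable_variables.
Context d (T : measurableType d) (R : realType) (P : probability T R).
Implicit Types (Y : T -> R) (X : T -> R[i]).

Definition square_integrable_real Y := [/\ measurable_fun setT Y,
  P.-integrable setT (EFin \o Y) & P.-integrable setT (fun w => (Y w ^+ 2)%:E)].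

Lemma square_integrable_realP Y Z : measurable_fun setT Y ->
  (forall w, Y w ^+ 2 <= Z w) -> P.-integrable setT (EFin \o Z) ->
  square_integrable_real Y.
Proof.
move=> mY YZ iZ.
have mY2 : measurable_fun setT (fun w => (Y w ^+ 2)%:E).
  by apply/measurable_EFinP; exact: measurable_funX.
have iY2 : P.-integrable setT (fun w => (Y w ^+ 2)%:E).
  apply: (le_integrable measurableT mY2 _ iZ) => w _ /=.
  by rewrite lee_fin !ger0_norm ?sqr_ge0// (le_trans (sqr_ge0 _) (YZ w)).
split => //.
have i1 := finite_measure_integrable_cst P 1 measurableT.
apply: (le_integrable measurableT _ _ (integrableD measurableT i1 iY2)).
  exact/measurable_EFinP.
move=> w _ /=; rewrite lee_fin [leRHS]ger0_norm; last first.
  by rewrite addr_ge0// sqr_ge0.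
have [y1|y1] := leP `|Y w| 1; first by rewrite (le_trans y1)// lerDl sqr_ge0.
rewrite -[Y w ^+ 2]real_normK ?num_real// (@le_trans _ _ (`|Y w| ^+ 2))//.
  by rewrite expr2 ler_peMr// ltW.
by rewrite lerDr.
Qed.

Lemma variance_real Y : square_integrable_real Y ->
  P.-integrable setT (fun w => ((Y w - \int[P]_x Y x) ^+ 2)%:E) /\
  \int[P]_w (Y w - \int[P]_x Y x) ^+ 2 =
  \int[P]_w (Y w ^+ 2) - (\int[P]_x Y x) ^+ 2.
Proof.
move=> [mY iY iY2]; set m := \int[P]_x Y x.
have i1 : P.-integrable setT (EFin \o (fun w => - (2 * m) * Y w)).
  by have := integrableZl measurableT (- (2 * m)) iY; congr (_.-integrable _).
have i2 : P.-integrable setT (EFin \o (fun=> m ^+ 2)) :=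
  finite_measure_integrable_cst P _ measurableT.
have i3 := integrableD measurableT (integrableD measurableT iY2 i1) i2.
have E : (fun w => (Y w - m) ^+ 2) = (fun w => (Y w ^+ 2 + - (2 * m) * Y w) + m ^+ 2).
  by apply/funext => w; ring.
split.
  move: i3; congr (_.-integrable _); apply/funext => w /=.
  by congr EFin; ring.
rewrite E RintegralD//; last exact: (integrableD measurableT iY2 i1).
rewrite RintegralD// RintegralZl// Rintegral_cst//.
have -> : fine (P setT) = 1 by rewrite probability_setT.
by rewrite -/m; ring.
Qed.

Lemma square_integrable_parts X : square_integrable P X ->
  square_integrable_real (fun w => complex.Re (X w)) /\
  square_integrable_real (fun w => complex.Im (X w)).
Proof.
move=> [[m1 m2] X2].
have iZ : P.-integrable setT
    (EFin \o (fun w => complex.Re (X w) ^+ 2 + complex.Im (X w) ^+ 2)).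
  apply/integrableP; split.
    by apply/measurable_EFinP; apply: measurable_funD; exact: measurable_funX.
  apply: le_lt_trans X2; rewrite le_eqVlt; apply/orP; left; apply/eqP.
  apply: eq_integral => w _ /=; rewrite normc_sqr ger0_norm//.
  by rewrite addr_ge0// sqr_ge0.
split; apply: square_integrable_realP iZ => // w.
  by rewrite lerDl sqr_ge0.
by rewrite lerDr sqr_ge0.
Qed.

(** The second moment is the variance plus the squared modulus of the mean. The covariance measure
    determines only the first term, so the mean is kept apart. *)
Lemma sqnorm_variance X : square_integrable P X ->
  sqnorm_integral P X = (complex.Re (cvariance P X) +
    (complex.Re (cexpectation P X) ^+ 2 + complex.Im (cexpectation P X) ^+ 2))%:E.
Proof.
move=> /square_integrable_parts[s1 s2].
have [i1 v1] := variance_real s1; have [i2 v2] := variance_real s2.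
have [_ _ j1] := s1; have [_ _ j2] := s2.
have -> : complex.Re (cvariance P X) =
    \int[P]_w ((complex.Re (X w) - \int[P]_w complex.Re (X w)) ^+ 2 +
      (complex.Im (X w) - \int[P]_w complex.Im (X w)) ^+ 2).
  rewrite /cvariance /ccovariance {1}/cexpectation /cintegral /=.
  by apply: eq_Rintegral => w _; rewrite Re_mul_conj ReB ImB /= -!expr2.
rewrite RintegralD// v1 v2 /sqnorm_integral.
under eq_integral do rewrite normc_sqr EFinD.
rewrite integralD// -[X in (X + _)%E]fineK; last exact: integrable_fin_num.
rewrite -[X in (_ + X)%E]fineK; last exact: integrable_fin_num.
rewrite -EFinD; congr EFin; rewrite /= /Rintegral; ring.
Qed.

Lemma ae_eq_Rintegral (Y Z : T -> R) : measurable_fun setT Y ->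
  measurable_fun setT Z -> {ae P, forall w, Y w = Z w} ->
  \int[P]_w Y w = \int[P]_w Z w.
Proof.
move=> mY mZ YZ; rewrite /Rintegral; congr fine; apply: ae_eq_integral => //.
- exact/measurable_EFinP.
- exact/measurable_EFinP.
- by apply: filterS YZ => w YZ _; rewrite YZ.
Qed.

Lemma sqnorm_ae_eq X X' : cmeasurable X -> cmeasurable X' ->
  {ae P, forall w, X w = X' w} -> sqnorm_integral P X = sqnorm_integral P X'.
Proof.
move=> [m1 m2] [m1' m2'] XX; apply: ae_eq_integral => //.
- apply/measurable_EFinP; under eq_fun do rewrite normc_sqr.
  by apply: measurable_funD; exact: measurable_funX.
- apply/measurable_EFinP; under eq_fun do rewrite normc_sqr.
  by apply: measurable_funD; exact: measurable_funX.
- by apply: filterS XX => w XX _; rewrite XX.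
Qed.

Lemma cexpectationD X (Y Z : T -> R[i]) : square_integrable P X -> square_integrable P Y ->
  square_integrable P Z -> {ae P, forall w, X w = Y w + Z w} ->
  cexpectation P X = cexpectation P Y + cexpectation P Z.
Proof.
move=> hX hY hZ XYZ; have [[x1 x2] _] := hX.
have [[y1 iy1 _] [y2 iy2 _]] := square_integrable_parts hY.
have [[z1 iz1 _] [z2 iz2 _]] := square_integrable_parts hZ.
apply/eqP; rewrite eq_complex /=; apply/andP; split; apply/eqP.
  rewrite -RintegralD//; apply: ae_eq_Rintegral => //; first exact: measurable_funD.
  by apply: filterS XYZ => w ->; rewrite ReD.
rewrite -RintegralD//; apply: ae_eq_Rintegral => //; first exact: measurable_funD.
by apply: filterS XYZ => w ->; rewrite ImD.
Qed.

End square_integrable_variables.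

Local Open Scope complex_scope.

(** * Second moments of the random measure *)

Section random_measure_energy.
Context (R : realType) (n : nat) (disp : measure_display)
  (Omega : measurableType disp) (P : probability Omega R)
  (M : ('rV[R]_n -> R[i]) -> Omega -> R[i])
  (C : {measure set 'rV[R]_n -> \bar R}).
Hypothesis M_stationary : weakly_stationary_random_measure P M.
Hypothesis M_covariance : covariance_measure P M C.
Hypothesis C_Delta : forall A : set 'rV[R]_n, measurable A ->
  C A = (\int[lebesgue_rV n]_(x in A) (Delta x)%:E)%E.
Local Notation E := 'rV[R]_n.
Implicit Types (f g : E -> R[i]).

Definition energy f := N (fun x => complex.Re (f x)) + N (fun x => complex.Im (f x)).

Lemma energyB f g : energy (fun x => f x - g x) =
  N (fun x => complex.Re (f x) - complex.Re (g x)) +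
  N (fun x => complex.Im (f x) - complex.Im (g x)).
Proof.
rewrite /energy.
have -> : (fun x => complex.Re (f x - g x)) =
    (fun x => complex.Re (f x) - complex.Re (g x)).
  by apply/funext => x; rewrite ReB.
have -> // : (fun x => complex.Im (f x - g x)) =
    (fun x => complex.Im (f x) - complex.Im (g x)).
by apply/funext => x; rewrite ImB.
Qed.

(** The definition does not postulate linearity of [M]. Almost sure additivity comes from the
    complex measure induced on a compact box containing the three supports. *)
Lemma random_measureD f g : Ccb setT f -> Ccb setT g ->
  {ae P, forall w, M (fun x => f x + g x) w = M f w + M g w}.
Proof.
move=> Cf Cg; have [rf Bf] := Ccb_box Cf; have [rg Bg] := Ccb_box Cg.
have [rs Bs] := Ccb_box (CcbD Cf Cg).
pose r := Num.max rf (Num.max rg rs).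
pose K : set E := [set v | forall i, `[- r, r]%classic (v ord0 i)].
have cK : compact K.
  by apply: (@rV_compact R n (fun=> `[- r, r]%classic)) => i; exact: segment_compact.
have Kf : Ccb K f by apply: Bf; rewrite le_max lexx.
have Kg : Ccb K g by apply: Bg; rewrite !le_max lexx orbT.
have Ks : Ccb K (fun x => f x + g x) by apply: Bs; rewrite !le_max lexx !orbT.
apply: filterS (random_measure_induces M_stationary) => w /(_ K cK)[nu [nu' H]].
rewrite !H//; have bm (a : E -> R) : RB a -> bounded_measurable a by move=> [].
by apply: complex_measure_integralD; apply: bm;
  [exact: Ccb_Re Kf|exact: Ccb_Im Kf|exact: Ccb_Re Kg|exact: Ccb_Im Kg].
Qed.

Lemma mean_random_measureD f g : Ccb setT f -> Ccb setT g ->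
  cexpectation P (M (fun x => f x + g x)) =
  cexpectation P (M f) + cexpectation P (M g).
Proof.
move=> Cf Cg; have L2 := random_measure_L2 M_stationary.
apply: (cexpectationD (L2 _ (CcbD Cf Cg)) (L2 _ Cf) (L2 _ Cg)).
exact: random_measureD.
Qed.

Lemma variance_random_measure f : Ccb setT f ->
  complex.Re (cvariance P (M f)) = energy f.
Proof.
move=> Cf; rewrite /cvariance (M_covariance Cf Cf).
rewrite /energy -(covariance_energy C_Delta (Ccb_Re Cf) (Ccb_Im Cf)) /=.
apply: eq_Rintegral => y _; apply: eq_Rintegral => x _.
by rewrite Re_mul_conj.
Qed.

(** [M f - M g] is almost surely [M h], whose variance is [energy h]; the squared mean is added to
    it. *)
Lemma sqnorm_random_measureB f g h : Ccb setT f -> Ccb setT g -> Ccb setT h ->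
  (forall x, f x = h x + g x) ->
  sqnorm_integral P (fun w => M f w - M g w) = (energy h +
    (complex.Re (cexpectation P (M h)) ^+ 2 + complex.Im (cexpectation P (M h)) ^+ 2))%:E.
Proof.
move=> Cf Cg Ch fE; have L2 := random_measure_L2 M_stationary.
rewrite -(variance_random_measure Ch) -(sqnorm_variance (L2 _ Ch)).
have fE' : f = (fun x => h x + g x) by apply/funext.
have [[f1 f2] _] := L2 _ Cf; have [[g1 g2] _] := L2 _ Cg.
apply: sqnorm_ae_eq; last 1 first.
- apply: filterS (random_measureD Ch Cg) => w Mw.
  by rewrite fE' Mw addrK.
- split.
    by under eq_fun do rewrite ReB; exact: measurable_funB.
  by under eq_fun do rewrite ImB; exact: measurable_funB.
- by have [] := L2 _ Ch.
Qed.

End random_measure_energy.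

(** * Rigidity below [2 / pi] and its failure above [2] *)

Section maximal_rigidity.
Context (R : realType) (n : nat) (disp : measure_display)
  (Omega : measurableType disp) (P : probability Omega R)
  (M : ('rV[R]_n.+1 -> R[i]) -> Omega -> R[i])
  (C : {measure set 'rV[R]_n.+1 -> \bar R}).
Hypothesis M_stationary : weakly_stationary_random_measure P M.
Hypothesis M_covariance : covariance_measure P M C.
Hypothesis C_Delta : forall A : set 'rV[R]_n.+1, measurable A ->
  C A = (\int[lebesgue_rV n.+1]_(x in A) (Delta x)%:E)%E.
Local Notation E := 'rV[R]_n.+1.
Implicit Types (f g : E -> R[i]).

Lemma energy_translate v (phi : E -> R[i]) : Ccb setT phi ->
  energy (fun x => phi x - translate v phi x) <= 4 * energy phi.
Proof.
move=> Cp.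
have h (a : E -> R) : RB a -> N (fun x => a x - a (x - v)) <= 4 * N a.
  move=> Ra; apply: (le_trans (NB_le Ra (RB_shift (- v) Ra))).
  by rewrite (N_shift (- v) Ra); lra.
rewrite energyB /energy mulrDr.
exact: lerD (h _ (Ccb_Re Cp)) (h _ (Ccb_Im Cp)).
Qed.

(* Subtracting from the error [f - b] a translate supported far away makes its
   mean vanish, by stationarity, and keeps its energy under control. *)
Lemma approximation_outside_ball (rho e : R) f : stationary_mean P M ->
  rho < 2 / pi -> Ccb (eball rho) f -> 0 < e ->
  exists h, Ccb (~` eball rho) h /\
    exists2 c : R, 0 <= c <= e &
      sqnorm_integral P (fun w => M f w - M h w) = c%:E.
Proof.
(* The radius [rho] may be nonpositive, whereas [rigid_RB] asks for a positive one; [1 / pi] is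
   positive and below [2 / pi]. *)
move=> mean rho1 Cf e0; pose s := Num.max rho (1 / pi).
have pi0 : 0 < pi :> R by exact: pi_gt0.
have s0 : 0 < s by rewrite lt_max divr_gt0// orbT.
have s1 : s < 2 / pi by rewrite gt_max rho1 ltr_pM2r ?invr_gt0// ltr1n.
have rs : rho <= s by rewrite le_max lexx.
have fs x : ~ eball s x -> f x = 0.
  by move=> xs; apply: (Ccb_eq0 Cf) => xr; apply: xs; exact: le_trans rs.
have CfT := Ccb_setT Cf.
have [_ r1] := rigid_RB s0 s1 (Ccb_Re Cf) (fun x xs => congr1 (@complex.Re R) (fs x xs)).
have [_ r2] := rigid_RB s0 s1 (Ccb_Im Cf) (fun x xs => congr1 (@complex.Im R) (fs x xs)).
have e8 : 0 < e / 8 by rewrite divr_gt0.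
have [b1 [Rb1 z1 n1]] := r1 _ e8; have [b2 [Rb2 z2 n2]] := r2 _ e8.
pose b x := b1 x +i* b2 x.
have Cb : Ccb (~` eball s) b.
  apply: (@RB_Ccb R n.+1 _ b Rb1 Rb2) => x /contrapT xs.
  by rewrite /b z1// z2.
have CbT := Ccb_setT Cb.
pose phi x := f x - b x; have Cphi : Ccb setT phi := CcbB CfT CbT.
have [r pr] : exists r : R, forall x, r < enorm x -> phi x = 0.
  have [_ _ [r hr] _] := Cphi; exists r => x xr; apply/eqP/negPn/negP => /hr.
  by rewrite /eball/= leNgt xr.
(* Long enough for [x - v] to have norm larger than [r] when [x] is in the ball of radius [rho], so
   that the translate of [phi] vanishes there. *)
pose v : E := axis n (`|rho| + `|r| + 1).
have ve : enorm v = `|rho| + `|r| + 1.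
  by rewrite enorm_axis ger0_norm// !addr_ge0.
pose h x := b x + translate v phi x.
have CtT : Ccb setT (translate v phi) := Ccb_translate v Cphi.
have ChT : Ccb setT h := CcbD CbT CtT.
have h0 x : eball rho x -> h x = 0.
  move=> xr; have xs : eball s x by exact: le_trans rs.
  rewrite /h /translate /b z1// z2// pr ?addr0//.
  have xr' : enorm x <= `|rho| by exact: le_trans xr (ler_norm rho).
  have := enorm_triangle v x; rewrite ve enorm_distC => vx.
  have := le_trans vx (lerD (lexx _) xr'); rewrite -addrA [leRHS]addrC lerD2l.
  by apply: lt_le_trans; rewrite ltr_pwDr// ler_norm.
pose psi x := phi x - translate v phi x.
have Cpsi : Ccb setT psi := CcbB Cphi CtT.
exists h; split.
  apply: (RB_Ccb (Ccb_Re ChT) (Ccb_Im ChT)) => x /contrapT; exact: h0.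
have fE x : f x = psi x + h x.
  by rewrite /psi /h addrACA addNr addr0 /phi subrK.
(* [phi] is [psi] plus a translate of [phi], and the two copies of [phi] have the same mean. *)
have m0 : cexpectation P (M psi) = 0.
  have := mean_random_measureD M_stationary Cpsi CtT.
  rewrite (_ : (fun x => psi x + translate v phi x) = phi); last first.
    by apply/funext => x; rewrite /psi subrK.
  rewrite (mean phi v Cphi) => /eqP; rewrite -subr_eq subrr eq_sym.
  by move=> /eqP.
have en : energy phi <= e / 8 + e / 8.
  by rewrite /phi energyB; exact: lerD n1 n2.
exists (energy psi).
  apply/andP; split; first by rewrite addr_ge0// N_ge0.
  apply: (le_trans (energy_translate v Cphi)).
  apply: (le_trans (ler_wpM2l _ en)); first by [].
  have -> : 4 * (e / 8 + e / 8) = e by field.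
  exact: lexx.
rewrite (sqnorm_random_measureB M_stationary M_covariance C_Delta CfT ChT Cpsi fE).
by rewrite m0 /= expr0n !addr0.
Qed.

Lemma maximal_rigidity (rho : R) : stationary_mean P M -> rho < 2 / pi ->
  linearly_maximally_rigid P M (eball rho).
Proof.
move=> mean rho1 f Cf.
have H k : exists h, Ccb (~` eball rho) h /\ exists2 c : R, 0 <= c <= k.+1%:R^-1 &
    sqnorm_integral P (fun w => M f w - M h w) = c%:E.
  by apply: approximation_outside_ball => //; rewrite invr_gt0.
have [h hP] := choice H.
exists h; split; first by move=> k; have [] := hP k.
have H' k : exists c : R, 0 <= c <= k.+1%:R^-1 /\
    sqnorm_integral P (fun w => M f w - M (h k) w) = c%:E.
  by have [_ [c c1 c2]] := hP k; exists c.
have [c cP] := choice H'.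
rewrite (_ : (fun _ => _) = (fun k => (c k)%:E)); last first.
  by apply/funext => k; have [_ ->] := cP k.
apply: cvg_EFin; first by near=> k.
apply: (squeeze_cvgr _ (cvg_cst 0) cvg_harmonic).
by near=> k; have [] := cP k.
Unshelve. all: by end_near.
Qed.

(* Test functions vanishing on [eball rho] do not affect [S f] on
   [eball (rho - 1)]. *)
Lemma not_rigid (rho : R) f : 2 < rho -> Ccb setT f -> csupp f = eball rho ->
  (exists2 x, eball (rho - 1) x & cconv f (fun z => (\1_(eball 1) z)%:C) x != 0) ->
  ~ linearly_rigid P M f.
Proof.
move=> rho2 Cf sf [x xr fx] [h [Ch lim]].
rewrite sf in Ch; have r0 : 0 < rho - 1 by lra.
pose W (a : E -> R) := \int[lebesgue_rV n.+1]_z (S a z ^+ 2 * \1_(eball (rho - 1)) z).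
have W_ge0 a : 0 <= W a.
  by apply: bfs_int_ge0 => z; rewrite mulr_ge0 ?sqr_ge0// indicE.
have W_le a b : RB a -> RB b -> (forall z, eball rho z -> b z = 0) ->
    W a <= N (fun z => a z - b z).
  move=> Ra Rb b0; have RA := RB_indicM (RB_sqr (RB_S Ra)) (measurable_eball (rho - 1)).
  apply: (bfs_int_le (RB_bfs RA) (RB_bfs (RB_sqr (RB_S (RBB Ra Rb))))) => z.
  rewrite indicE; have [/set_mem zr|_] := boolP (z \in _); last first.
    by rewrite mulr0 sqr_ge0.
  rewrite mulr1 SB// [X in _ - X](_ : _ = 0) ?subr0//.
  transitivity (Rintegral (lebesgue_rV n.+1) setT (fun _ : E => 0 : R)).
    apply: eq_Rintegral => y _; have [yr|yr] := leP (enorm y) rho.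
      by rewrite b0// mul0r.
    have zr' : enorm z <= rho - 1 := zr.
    have zy : 1 < enorm (z - y).
      by have := enorm_triangle y z; rewrite enorm_distC; lra.
    by rewrite B1E leNgt zy mulr0.
  by rewrite Rintegral_cst// mul0r.
pose c := W (fun z => complex.Re (f z)) + W (fun z => complex.Im (f z)).
have c0 : 0 < c.
  have Wp (a : E -> R) : RB a -> S a x != 0 -> 0 < W a.
    by move=> Ra; exact: S_energy_gt0.
  have Sf : cconv f (fun z => (\1_(eball 1) z)%:C) x =
      S (fun z => complex.Re (f z)) x +i* S (fun z => complex.Im (f z)) x.
    rewrite /cconv /cintegral; apply/eqP; rewrite eq_complex/=.
    apply/andP; split; apply/eqP; apply: eq_Rintegral => z _.
      by case: (f z) => u w /=; rewrite mulr0 subr0.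
    by case: (f z) => u w /=; rewrite mulr0 add0r.
  have [S1|S1] := eqVneq (S (fun z => complex.Re (f z)) x) 0; last first.
    by apply: ltr_wpDr => //; exact: Wp (Ccb_Re Cf) S1.
  have [S2|S2] := eqVneq (S (fun z => complex.Im (f z)) x) 0; last first.
    by apply: ltr_wpDl => //; exact: Wp (Ccb_Im Cf) S2.
  by move: fx; rewrite Sf S1 S2 eqxx.
have low k : exists2 u : R, c <= u &
    sqnorm_integral P (fun w => M f w - M (h k) w) = u%:E.
  have Ck := Ccb_setT (Ch k); have Cd := CcbB Cf Ck.
  have fE z : f z = (f z - h k z) + h k z by rewrite subrK.
  have hk0 z : eball rho z -> h k z = 0 by move=> zr; apply: (Ccb_eq0 (Ch k)) => /(_ zr).
  rewrite (sqnorm_random_measureB M_stationary M_covariance C_Delta Cf Ck Cd fE).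
  eexists; last by [].
  apply: (@le_trans _ _ (energy (fun z => f z - h k z))); last first.
    by rewrite lerDl addr_ge0// sqr_ge0.
  rewrite /c energyB; apply: lerD.
    by apply: W_le (Ccb_Re Cf) (Ccb_Re Ck) _ => z /hk0 ->.
  by apply: W_le (Ccb_Im Cf) (Ccb_Im Ck) _ => z /hk0 ->.
move/fine_cvg/cvgrPdist_lt/(_ c c0) : lim => [k _ /(_ k (leqnn k))].
have [u cu /= ->] := low k; rewrite /= sub0r normrN.
by move=> uc; have := le_lt_trans (le_trans cu (ler_norm u)) uc; rewrite ltxx.
Qed.

End maximal_rigidity.

Theorem theorem8 (R : realType) (d : nat) (d_gt0 : (0 < d)%N)
    (disp : measure_display) (Omega : measurableType disp)
    (P : probability Omega R)
    (M : ('rV[R]_d -> R[i]) -> Omega -> R[i])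
    (C : {measure set 'rV[R]_d -> \bar R})
    (M_stationary : weakly_stationary_random_measure P M)
    (M_covariance : covariance_measure P M C)
    (C_Delta : forall A : set 'rV[R]_d, measurable A ->
       C A = (\int[lebesgue_rV d]_(x in A) (Delta x)%:E)%E) :
  (stationary_mean P M ->
   forall rho : R, rho < 2 / pi ->
     linearly_maximally_rigid P M (eball rho)) /\
  (forall (rho : R) (f : 'rV[R]_d -> R[i]), 2 < rho ->
     Ccb setT f -> csupp f = eball rho ->
     (exists2 x, eball (rho - 1) x &
        cconv f (fun z => (\1_(eball 1) z)%:C) x != 0) ->
     ~ linearly_rigid P M f).
Proof.
case: d d_gt0 M C M_stationary M_covariance C_Delta => // n _ M C sM cM CD.
split => [mean rho|rho f]; first exact: (maximal_rigidity sM cM CD mean).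
exact: (not_rigid sM cM CD).
Qed.
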